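(* Let $\mathcal{G}$ be a second-countable, locally compact, étale groupoid such that $\mathcal{G}^{(0)}$ is Hausdorff. (1) If $C^*(\mathcal{G})$ is simple, then $C^*(\mathcal{G})=C^*_r(\mathcal{G})$, $\mathcal{G}$ is effective, and for every nonzero $a\in C^*_r(\mathcal{G})$, $\operatorname{supp}(j(a))$ has nonempty interior in $\mathcal{G}$. (2) If $C^*_r(\mathcal{G})$ is simple, then $\mathcal{G}$ is minimal. (3) If $\mathcal{G}$ is minimal and effective and for every nonzero $a\in C^*_r(\mathcal{G})$, $\operatorname{supp}(j(a))$ has nonempty interior in $\mathcal{G}$, then $C^*_r(\mathcal{G})$ is simple. In particular, if $C^*(\mathcal{G})=C^*_r(\mathcal{G})$, then $C^*(\mathcal{G})$ is simple if and only if $\mathcal{G}$ is minimal, effective, and for every nonzero $a\in C^*_r(\mathcal{G})$, $\operatorname{supp}(j(a))$ has nonempty interior in $\mathcal{G}$.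
   Context: Groupoids $\mathcal{G}$ are topological groupoids with unit space $\mathcal{G}^{(0)}$ and range and source maps $r,s$, not necessarily Hausdorff. An open bisection is an open set $U\subseteq\mathcal{G}$ such that $r$ and $s$ each restrict to a homeomorphism of $U$ onto an open subset of $\mathcal{G}^{(0)}$. $\mathcal{G}$ is étale if its topology has a basis of open bisections. $\operatorname{Iso}(\mathcal{G})=\{\gamma: r(\gamma)=s(\gamma)\}$, and $\mathcal{G}$ is effective if the interior of $\operatorname{Iso}(\mathcal{G})$ equals $\mathcal{G}^{(0)}$. $\mathcal{G}$ is minimal if for every $u\in\mathcal{G}^{(0)}$ the orbit $s(r^{-1}(u))$ is dense in $\mathcal{G}^{(0)}$. $\mathcal{C}(\mathcal{G})$ is the complex linear span, inside the functions $\mathcal{G}\to\mathbb{C}$, of the spaces $C_c(U)$ for open bisections $U\subseteq\mathcal{G}$, where an element of $C_c(U)$ (a continuous function on $U$ vanishing outside a compact subset of $U$) is extended by $0$ to $\mathcal{G}$. It is a $*$-algebra with $f*g(\gamma)=\sum_{r(\eta)=r(\gamma)}f(\eta)g(\eta^{-1}\gamma)$ and $f^*(\gamma)=\overline{f(\gamma^{-1})}$. The full $C^*$-algebra $C^*(\mathcal{G})$ is the completion of $\mathcal{C}(\mathcal{G})$ in the universal norm, i.e. the supremum of $\|\pi(f)\|$ over $*$-representations $\pi$ of $\mathcal{C}(\mathcal{G})$ on Hilbert spaces. For $u\in\mathcal{G}^{(0)}$ let $\mathcal{G}_u=s^{-1}(u)$ and let $L_u:\mathcal{C}(\mathcal{G})\to\mathcal{B}(\ell^2(\mathcal{G}_u))$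 be the representation $L_u(f)\delta_\gamma=\sum_{\alpha\in\mathcal{G}_{r(\gamma)}}f(\alpha)\delta_{\alpha\gamma}$. $C^*_r(\mathcal{G})$ is the completion of the image of $\mathcal{C}(\mathcal{G})$ under $\bigoplus_{u}L_u$; each $L_u$ extends to it. ''$C^*(\mathcal{G})=C^*_r(\mathcal{G})$'' means that the canonical surjection $C^*(\mathcal{G})\to C^*_r(\mathcal{G})$ is an isomorphism. For $a\in C^*_r(\mathcal{G})$ define $j(a):\mathcal{G}\to\mathbb{C}$ by $j(a)(\gamma)=(L_{s(\gamma)}(a)\delta_{s(\gamma)}\mid\delta_\gamma)$; $j(f)=f$ for $f\in\mathcal{C}(\mathcal{G})$. For a function $h$, $\operatorname{supp}(h)=\{\gamma: h(\gamma)\ne0\}$ (no closure). A $C^*$-algebra is simple if its only closed two-sided ideals are $0$ and itself. *)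

(* Defs.v *)
From HB Require Import structures.
From mathcomp Require Import all_boot all_order all_algebra.
From mathcomp Require Import all_classical all_reals all_analysis.
From mathcomp Require Import complex.
From mathcomp Require Import ring lra.
Set Implicit Arguments. Unset Strict Implicit. Unset Printing Implicit Defensive.
Import Order.TTheory GRing.Theory Num.Theory.
Import numFieldNormedType.Exports.
Local Open Scope classical_set_scope.
Local Open Scope ring_scope.
Local Open Scope complex_scope.

(* The inner product is linear in its first variable. *)
HB.mixin Record CompleteNormedModule_isHilbert (R : realType) H
    & CompleteNormedModule R[i] H := {
  inner : H -> H -> R[i] ;
  inner_linearl : forall y, scalar (inner ^~ y) ;
  inner_conj : forall x y, inner y x = (inner x y)^* ;
  inner_norm : forall x, inner x x = `|x| ^+ 2
}.

#[short(type="hilbertType")]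
HB.structure Definition Hilbert (R : realType) :=
  {H of CompleteNormedModule R[i] H & CompleteNormedModule_isHilbert R H}.

(* C*-algebras are not required to have a unit, nor to be nonzero. *)
HB.mixin Record CompleteNormedModule_isCstarAlg (R : realType) A
    & CompleteNormedModule R[i] A := {
  amul : A -> A -> A ;
  astar : A -> A ;
  amulA : associative amul ;
  amul_linearl : forall b, linear (amul ^~ b) ;
  amul_linearr : forall a, linear (amul a) ;
  astar_semilinear : forall (k : R[i]) (a b : A),
    astar (k *: a + b) = k^* *: astar a + astar b ;
  astarK : involutive astar ;
  astarM : forall a b, astar (amul a b) = amul (astar b) (astar a) ;
  norm_amul : forall a b, `|amul a b| <= `|a| * `|b| ;
  norm_astar_amul : forall a, `|amul (astar a) a| = `|a| ^+ 2
}.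

#[short(type="cstarAlgType")]
HB.structure Definition CstarAlg (R : realType) :=
  {A of CompleteNormedModule R[i] A & CompleteNormedModule_isCstarAlg R A}.

Section Ideals.
Context {R : realType}.

Definition closed_ideal (A : cstarAlgType R) (J : set A) : Prop :=
  [/\ closed J, J 0,
      forall (k : R[i]) a b, J a -> J b -> J (k *: a + b),
      forall a b, J b -> J (amul a b) &
      forall a b, J a -> J (amul a b)].

Definition simple_cstar (A : cstarAlgType R) : Prop :=
  forall J : set A, closed_ideal J -> J = [set 0] \/ J = [set: A].

End Ideals.

Section Operators.
Context {R : realType}.

Definition bounded_operator (H : normedModType R[i]) (T : H -> H) : Prop :=
  linear T /\ continuous T.

Definition op_norm (H : normedModType R[i]) (T : H -> H) : \bar R :=
  ereal_sup [set (complex.Re `|T x|)%:E | x in [set x : H | `|x| <= 1]].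

(* [D] is to be thought of as a *-algebra, with the product [m] and the
   involution [st]; only the values of [phi] and [pi] on [D] matter. *)
Definition star_hom (V : lmodType R[i]) (m : V -> V -> V) (st : V -> V)
    (D : set V) (A : cstarAlgType R) (phi : V -> A) : Prop :=
  [/\ forall (k : R[i]) a b, D a -> D b ->
        phi (k *: a + b) = k *: phi a + phi b,
      forall a b, D a -> D b -> phi (m a b) = amul (phi a) (phi b) &
      forall a, D a -> phi (st a) = astar (phi a)].

Definition star_rep (V : lmodType R[i]) (m : V -> V -> V) (st : V -> V)
    (D : set V) (H : hilbertType R) (pi : V -> H -> H) : Prop :=
  [/\ forall a, D a -> bounded_operator (pi a),
      forall (k : R[i]) a b, D a -> D b ->
        pi (k *: a + b) = k *: pi a + pi b,
      forall a b, D a -> D b -> pi (m a b) = pi a \o pi b &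
      forall a, D a -> forall x y, inner (pi (st a) x) y = inner x (pi a y)].

Definition linear_span (V : lmodType R[i]) (S : set V) : set V :=
  [set v | exists (n : nat) (c : 'I_n -> R[i]) (s : 'I_n -> V),
    (forall i, S (s i)) /\ v = \sum_(i < n) c i *: s i].

End Operators.

Section NormSq.
Context {R : realType}.
Implicit Types z w : R[i].

Definition normsq z : R := complex.Re z ^+ 2 + complex.Im z ^+ 2.

Lemma normsq_ge0 z : 0 <= normsq z.
Proof. by rewrite addr_ge0 ?sqr_ge0. Qed.

Lemma normsqE z : `|z| ^+ 2 = (normsq z)%:C.
Proof.
case: z => a b; rewrite /normsq normc_def /= -rmorphXn /= sqr_sqrtr //.
by rewrite addr_ge0 ?sqr_ge0.
Qed.

Lemma normsqM z w : normsq (z * w) = normsq z * normsq w.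
Proof. case: z w => [a b] [c d]; rewrite /normsq /=; ring. Qed.

Lemma normsqD_le (e : R) z w : 0 < e ->
  normsq (z + w) <= (1 + e) * normsq z + (1 + e^-1) * normsq w.
Proof.
move=> e0; case: z w => [a b] [c d]; rewrite /normsq /=.
rewrite -subr_ge0.
have -> : (1 + e) * (a ^+ 2 + b ^+ 2) + (1 + e^-1) * (c ^+ 2 + d ^+ 2) -
  ((a + c) ^+ 2 + (b + d) ^+ 2) =
  ((e * a - c) ^+ 2 + (e * b - d) ^+ 2) * e^-1.
  by field; rewrite gt_eqF.
by rewrite mulr_ge0 ?invr_ge0 ?(ltW e0) ?addr_ge0 ?sqr_ge0.
Qed.

Lemma normsqD z w : normsq (z + w) <= 2 * normsq z + 2 * normsq w.
Proof. by have := @normsqD_le 1 z w ltr01; rewrite invr1. Qed.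

Lemma normsq0 : normsq 0 = 0. Proof. by rewrite /normsq /= expr0n /= addr0. Qed.

Lemma normsq_eq0 z : normsq z = 0 -> z = 0.
Proof.
case: z => a b; rewrite /normsq /= => /eqP.
by rewrite paddr_eq0 ?sqr_ge0 // !sqrf_eq0 => /andP[/eqP -> /eqP ->].
Qed.

Lemma Re_mul_conj_le z w : `|complex.Re (z * w^*)| <= normsq z + normsq w.
Proof.
case: z w => [a b] [c d]; rewrite ler_norml /normsq.
have -> : complex.Re ((a +i* b) * (c +i* d)^*) = a * c + b * d by move=> /=; ring.
have := (sqr_ge0 (a + c), sqr_ge0 (a - c), sqr_ge0 (b + d), sqr_ge0 (b - d)).
have := (sqr_ge0 a, sqr_ge0 b, sqr_ge0 c, sqr_ge0 d).
move=> [[[? ?] ?] ?] [[[? ?] ?] ?] /=; apply/andP; split; lra.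
Qed.

Lemma Im_mul_conj_le z w : `|complex.Im (z * w^*)| <= normsq z + normsq w.
Proof.
case: z w => [a b] [c d]; rewrite ler_norml /normsq.
have -> : complex.Im ((a +i* b) * (c +i* d)^*) = b * c - a * d by move=> /=; ring.
have := (sqr_ge0 (b + c), sqr_ge0 (b - c), sqr_ge0 (a + d), sqr_ge0 (a - d)).
have := (sqr_ge0 a, sqr_ge0 b, sqr_ge0 c, sqr_ge0 d).
move=> [[[? ?] ?] ?] [[[? ?] ?] ?] /=; apply/andP; split; lra.
Qed.

End NormSq.

Section Ell2.
Variables (R : realType) (X : choiceType).
Implicit Types f g : X -> R[i].

Definition sum_normsq f : \bar R := (\esum_(x in [set: X]) (normsq (f x))%:E)%E.

Lemma sum_normsq_ge0 f : (0 <= sum_normsq f)%E.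
Proof. by apply: esum_ge0 => x _; rewrite lee_fin normsq_ge0. Qed.

Lemma esumZl (c : R) (h : X -> R) : 0 <= c -> (forall x, 0 <= h x) ->
  (\esum_(x in [set: X]) (c * h x)%:E = c%:E * \esum_(x in [set: X]) (h x)%:E)%E.
Proof.
move=> c0 h0; have le (d : R) (k : X -> R) : 0 <= d -> (forall x, 0 <= k x) ->
    (\esum_(x in [set: X]) (d * k x)%:E <= d%:E * \esum_(x in [set: X]) (k x)%:E)%E.
  move=> d0 k0; apply: ge_ereal_sup => _ [F FT <-].
  under eq_fsbigr do rewrite EFinM.
  rewrite -ge0_mule_fsumr; last by move=> x; rewrite lee_fin.
  apply: lee_wpmul2l; rewrite ?lee_fin //.
  by apply: ereal_sup_ubound; exists F.
apply/eqP; rewrite eq_le le //=.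
have [<-|cn0] := eqVneq 0 c.
  by rewrite mul0e esum_ge0 // => x _; rewrite mul0r.
have {}c0 : 0 < c by rewrite lt_def eq_sym cn0.
rewrite -lee_pdivlMl // muleC.
have := le c^-1 (fun x => c * h x).
rewrite invr_ge0 (ltW c0) => /(_ isT) H.
rewrite muleC; apply: le_trans (H _); last by move=> x; rewrite mulr_ge0 // ltW.
by apply: le_esum => x _; rewrite mulKf ?gt_eqF.
Qed.

Definition ell2_pred : pred (X -> R[i]) :=
  fun f => `[< (sum_normsq f < +oo)%E >].

Lemma ell2P f : reflect (sum_normsq f < +oo)%E (f \in ell2_pred).
Proof. exact: asboolP. Qed.

Lemma sum_normsqD_le (e : R) f g : 0 < e -> (sum_normsq (f + g)%R <=
  (1 + e)%:E * sum_normsq f + (1 + e^-1)%:E * sum_normsq g)%E.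
Proof.
move=> e0; have e1 : 0 <= 1 + e by rewrite addr_ge0 // ltW.
have e2 : 0 <= 1 + e^-1 by rewrite addr_ge0 // invr_ge0 ltW.
rewrite -!esumZl //; try by move=> x; exact: normsq_ge0.
rewrite -esumD; try by move=> x _; rewrite lee_fin mulr_ge0 // normsq_ge0.
by apply: le_esum => x _; rewrite lee_fin normsqD_le.
Qed.

Lemma sum_normsqZ (k : R[i]) f :
  sum_normsq (k *: f) = ((normsq k)%:E * sum_normsq f)%E.
Proof.
rewrite -esumZl ?normsq_ge0 //; last by move=> x; exact: normsq_ge0.
by apply: eq_esum => x _; rewrite -normsqM.
Qed.

Lemma ell2_submod_closed : GRing.submod_closed ell2_pred.
Proof.
split.
  apply/ell2P; rewrite /sum_normsq esum1 // => x _.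
  by rewrite [(0 : X -> R[i]) x]/(0 : R[i]) normsq0.
move=> k f g /ell2P ff /ell2P fg; apply/ell2P.
apply: le_lt_trans (sum_normsqD_le _ _ ltr01) _.
rewrite sum_normsqZ; apply: lte_add_pinfty.
  apply: lte_mul_pinfty; rewrite ?lee_fin ?addr_ge0 //.
  by apply: lte_mul_pinfty; rewrite ?lee_fin ?normsq_ge0.
by apply: lte_mul_pinfty; rewrite ?lee_fin ?addr_ge0 ?invr_ge0.
Qed.

HB.instance Definition _ :=
  GRing.isSubmodClosed.Build R[i] (X -> R[i]) ell2_pred ell2_submod_closed.

Record ell2 : Type := Ell2 { ell2_fun :> X -> R[i]; _ : ell2_fun \in ell2_pred }.

HB.instance Definition _ := [isSub for ell2_fun].
HB.instance Definition _ := [Choice of ell2 by <:].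
HB.instance Definition _ := [SubChoice_isSubLmodule of ell2 by <:].

Implicit Types a b : ell2.

Lemma ell2_lt a : (sum_normsq a < +oo)%E.
Proof. by apply/ell2P; case: a. Qed.

Lemma ell2_fin a : sum_normsq a \is a fin_num.
Proof. by rewrite ge0_fin_numE ?sum_normsq_ge0 ?ell2_lt. Qed.

Lemma ell2D a b x : (a + b) x = a x + b x. Proof. by []. Qed.
Lemma ell2N a x : (- a) x = - a x. Proof. by []. Qed.
Lemma ell2Z k a x : (k *: a) x = k * a x. Proof. by []. Qed.

Definition ell2_rnorm a : R := Num.sqrt (fine (sum_normsq a)).

Lemma ell2_rnorm_sqr a : (ell2_rnorm a ^+ 2)%:E = sum_normsq a.
Proof. by rewrite sqr_sqrtr ?fine_ge0 ?sum_normsq_ge0 // fineK // ell2_fin. Qed.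

Lemma ell2_rnorm_ge0 a : 0 <= ell2_rnorm a. Proof. exact: sqrtr_ge0. Qed.

Lemma ell2_coord_le a x : normsq (a x) <= ell2_rnorm a ^+ 2.
Proof.
rewrite -lee_fin ell2_rnorm_sqr.
apply: ereal_sup_ubound => /=; exists [set x]; first by split.
by rewrite fsbig_set1.
Qed.

Lemma ell2_rnorm_eq0 a : ell2_rnorm a = 0 -> a = 0.
Proof.
move=> a0; apply: val_inj; apply/funext => x; apply: normsq_eq0.
apply/eqP; rewrite eq_le normsq_ge0 andbT.
by rewrite (le_trans (ell2_coord_le a x)) // a0 expr0n.
Qed.

Lemma ell2_rnormZ k a : ell2_rnorm (k *: a) = complex.Re `|k| * ell2_rnorm a.
Proof.
rewrite /ell2_rnorm.
have -> : sum_normsq (k *: a : ell2) = ((normsq k)%:E * sum_normsq a)%E.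
  exact: (sum_normsqZ k a).
rewrite fineM ?ell2_fin // sqrtrM ?normsq_ge0 //; congr (_ * _).
by case: k => c d; rewrite normc_def.
Qed.

Lemma ell2_rnormD a b : ell2_rnorm (a + b) <= ell2_rnorm a + ell2_rnorm b.
Proof.
have [->|/eqP a0] := eqVneq a 0; first by rewrite add0r ler_wpDl ?ell2_rnorm_ge0.
have [->|/eqP b0] := eqVneq b 0; first by rewrite addr0 ler_wpDr ?ell2_rnorm_ge0.
have pa : 0 < ell2_rnorm a.
  by rewrite lt_def ell2_rnorm_ge0 andbT; apply/eqP => /ell2_rnorm_eq0.
have pb : 0 < ell2_rnorm b.
  by rewrite lt_def ell2_rnorm_ge0 andbT; apply/eqP => /ell2_rnorm_eq0.
rewrite -(@ler_pXn2r _ 2) ?nnegrE ?ell2_rnorm_ge0 ?addr_ge0 ?ell2_rnorm_ge0 //.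
have e0 : 0 < ell2_rnorm b / ell2_rnorm a by rewrite divr_gt0.
have := sum_normsqD_le a b e0.
have -> : sum_normsq (val a + val b) = sum_normsq (a + b : ell2) by [].
rewrite -!ell2_rnorm_sqr -!EFinM -EFinD lee_fin => /le_trans; apply.
set u := ell2_rnorm a in pa e0 *; set v := ell2_rnorm b in pb e0 *.
suff -> : (1 + v / u) * u ^+ 2 + (1 + (v / u)^-1) * v ^+ 2 = (u + v) ^+ 2 by [].
by field; rewrite !gt_eqF.
Qed.

Definition ell2_norm a : R[i] := (ell2_rnorm a)%:C.

Lemma ell2_normD a b : ell2_norm (a + b) <= ell2_norm a + ell2_norm b.
Proof. by rewrite -rmorphD lecR ell2_rnormD. Qed.

Lemma ell2_normZ (k : R[i]) a : ell2_norm (k *: a) = `|k| * ell2_norm a.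
Proof.
by rewrite /ell2_norm ell2_rnormZ rmorphM.
Qed.

Lemma ell2_norm_eq0 a : ell2_norm a = 0 -> a = 0.
Proof. by move=> /complexI /ell2_rnorm_eq0. Qed.

HB.instance Definition _ :=
  Lmodule_isNormed.Build R[i] ell2 ell2_normD ell2_normZ ell2_norm_eq0.

Lemma ell2_Re_le a x : `|complex.Re (a x)| <= ell2_rnorm a.
Proof.
rewrite -(@ler_pXn2r _ 2) ?nnegrE ?normr_ge0 ?ell2_rnorm_ge0 //.
by rewrite real_normK ?num_real // (le_trans _ (ell2_coord_le a x)) // lerDl sqr_ge0.
Qed.

Lemma ell2_Im_le a x : `|complex.Im (a x)| <= ell2_rnorm a.
Proof.
rewrite -(@ler_pXn2r _ 2) ?nnegrE ?normr_ge0 ?ell2_rnorm_ge0 //.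
by rewrite real_normK ?num_real // (le_trans _ (ell2_coord_le a x)) // lerDr sqr_ge0.
Qed.

Lemma ell2_complete (F : set_system ell2) : ProperFilter F -> cauchy F -> cvg F.
Proof.
move=> FF /cauchyP cF.
have {}cF (e : R) : 0 < e ->
    exists a0 : ell2, \forall g \near F, ell2_rnorm (a0 - g) < e.
  move=> e0; have e0' : 0 < e%:C by rewrite ltcR.
  have [a0 Fa0] := cF _ e0'; exists a0.
  apply: filterS Fa0 => g; rewrite -ball_normE /= => H.
  by rewrite -ltcR.
have cvgc (p : R[i] -> R) : (forall u v, p (u - v) = p u - p v) ->
    (forall a x, `|p (a x)| <= ell2_rnorm a) ->
    exists l : X -> R, forall x, (fun g : ell2 => p (g x)) @ F --> l x.
  move=> pB ple.
  have H x : cvg ((fun g : ell2 => p (g x)) @ F).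
    apply: cauchy_cvg; apply/cauchyP => e /cF [a0 Fa0].
    exists (p (a0 x)); apply: filterS Fa0 => g.
    by rewrite -ball_normE /= -pB => /(le_lt_trans _); apply; exact: (ple (a0 - g)).
  by exists (fun x => lim ((fun g : ell2 => p (g x)) @ F)) => x; exact: H.
have [lr Flr] := cvgc (@complex.Re R) (fun u v => raddfB _ u v) ell2_Re_le.
have [li Fli] := cvgc (@complex.Im R) (fun u v => raddfB _ u v) ell2_Im_le.
pose l : X -> R[i] := fun x => lr x +i* li x.
have key (e : R) (a0 : ell2) : 0 < e ->
    (\forall g \near F, ell2_rnorm (a0 - g) < e) ->
    (sum_normsq (val a0 - l)%R <= (e ^+ 2)%:E)%E.
  move=> e0 Fa0; apply: ge_ereal_sup => _ [J [finJ _] <-].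
  rewrite fsbig_finite // sumEFin lee_fin.
  pose S (g : ell2) : R := \sum_(x <- finmap.enum_fset (fset_set J)) normsq (a0 x - g x).
  have FS : S @ F --> \sum_(x <- finmap.enum_fset (fset_set J)) normsq (a0 x - l x).
    apply: cvg_big => [|x _]; first exact: add_continuous.
    rewrite /normsq.
    have hr : (fun g : ell2 => complex.Re (a0 x - g x)) @ F --> complex.Re (a0 x - l x).
      have -> : complex.Re (a0 x - l x) = complex.Re (a0 x) - lr x by rewrite raddfB.
      under eq_fun do rewrite raddfB.
      by apply: cvgB; [exact: cvg_cst | exact: Flr].
    have hi : (fun g : ell2 => complex.Im (a0 x - g x)) @ F --> complex.Im (a0 x - l x).
      have -> : complex.Im (a0 x - l x) = complex.Im (a0 x) - li x by rewrite raddfB.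
      under eq_fun do rewrite raddfB.
      by apply: cvgB; [exact: cvg_cst | exact: Fli].
    by apply: cvgD; apply: cvgM.
  suff SF : \forall g \near F, S g <= e ^+ 2.
    exact: (@closed_cvg _ _ F _ S (fun y : R => y <= e ^+ 2)
      (@closed_le R (e ^+ 2)) SF _ FS).
  apply: filterS Fa0 => g ge.
  rewrite -lee_fin -sumEFin -fsbig_finite //.
  apply: (@le_trans _ _ (sum_normsq (a0 - g : ell2))).
    by apply: ereal_sup_ubound; exists J.
  by rewrite -ell2_rnorm_sqr lee_fin lerXn2r ?nnegrE ?ell2_rnorm_ge0 // ltW.
have l2 : l \in ell2_pred.
  have [a0 Fa0] := cF 1 ltr01.
  rewrite -(subKr (val a0) l) rpredB ?(valP a0) //.
  by apply/ell2P; apply: le_lt_trans (key _ _ ltr01 Fa0) _; rewrite ltry.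
apply/cvg_ex; exists (Ell2 l2); apply/fcvgrPdist_lt => -[e e'].
rewrite ltcE /= => /andP[/eqP -> e0].
have e20 : 0 < e / 2 by rewrite divr_gt0.
have [a0 Fa0] := cF _ e20.
apply: filterS (Fa0) => g ge.
change ((ell2_rnorm (Ell2 l2 - g))%:C < e%:C); rewrite ltcR.
rewrite -(subrKA a0) (le_lt_trans (ell2_rnormD _ _)) //.
rewrite [ltRHS]splitr ler_ltD //.
rewrite -opprB -scaleN1r ell2_rnormZ normrN1 /= mul1r.
rewrite -(@ler_pXn2r _ 2) ?nnegrE ?ell2_rnorm_ge0 ?(ltW e20) //.
by rewrite -lee_fin ell2_rnorm_sqr; exact: key.
Qed.

HB.instance Definition _ := Uniform_isComplete.Build ell2 ell2_complete.


(* The sum of an absolutely summable family, through its positive and negative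
   parts, and through its real and imaginary parts. *)
Definition rsum (h : X -> R) : R :=
  fine (\esum_(x in [set: X]) (Num.max (h x) 0)%:E)%E -
  fine (\esum_(x in [set: X]) (Num.max (- h x) 0)%:E)%E.

Definition csum (h : X -> R[i]) : R[i] :=
  rsum (fun x => complex.Re (h x)) +i* rsum (fun x => complex.Im (h x)).

Definition abs_summable (h : X -> R) : Prop :=
  (\esum_(x in [set: X]) `|h x|%:E < +oo)%E.

Lemma esum_fin (p q : X -> R) : abs_summable q ->
  (forall x, 0 <= p x <= `|q x|) -> \esum_(x in [set: X]) (p x)%:E \is a fin_num.
Proof.
move=> sq pq; rewrite ge0_fin_numE.
  apply: le_lt_trans sq; apply: le_esum => x _.
  by rewrite lee_fin; case/andP: (pq x).
by apply: esum_ge0 => x _; rewrite lee_fin; case/andP: (pq x).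
Qed.

Lemma rsumB (p q : X -> R) : abs_summable p -> abs_summable q ->
  (forall x, 0 <= p x) -> (forall x, 0 <= q x) ->
  rsum (fun x => p x - q x) =
  fine (\esum_(x in [set: X]) (p x)%:E)%E - fine (\esum_(x in [set: X]) (q x)%:E)%E.
Proof.
move=> sp sq p0 q0; rewrite /rsum.
have f1 : \esum_(x in [set: X]) (Num.max (p x - q x) 0)%:E \is a fin_num.
  apply: (esum_fin sp) => x; rewrite le_max lexx orbT /= ger0_norm // ge_max p0.
  by rewrite andbT gerBl.
have f2 : \esum_(x in [set: X]) (Num.max (- (p x - q x)) 0)%:E \is a fin_num.
  apply: (esum_fin sq) => x; rewrite le_max lexx orbT /= ger0_norm // ge_max q0.
  by rewrite andbT opprB gerBl.
have f3 : \esum_(x in [set: X]) (p x)%:E \is a fin_num.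
  by apply: (esum_fin sp) => x; rewrite p0 ler_norm.
have f4 : \esum_(x in [set: X]) (q x)%:E \is a fin_num.
  by apply: (esum_fin sq) => x; rewrite q0 ler_norm.
apply/eqP; rewrite subr_eq addrAC eq_sym subr_eq addrC [X in _ == X]addrC; apply/eqP.
apply: EFin_inj; rewrite !EFinD !fineK // -!esumD; last 4 first.
- by move=> x _; rewrite lee_fin.
- by move=> x _; rewrite lee_fin le_max lexx orbT.
- by move=> x _; rewrite lee_fin le_max lexx orbT.
- by move=> x _; rewrite lee_fin.
apply: eq_esum => x _; rewrite -!EFinD; congr (_%:E).
rewrite opprB; case: (lerP (p x) (q x)) => pq.
  rewrite [Num.max (p x - q x) 0]max_r ?subr_le0 // max_l ?subr_ge0 //; lra.
rewrite [Num.max (p x - q x) 0]max_l ?subr_ge0 ?(ltW pq) // max_r ?subr_le0 ?(ltW pq) //; lra.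
Qed.

Lemma abs_summable_le (h k : X -> R) : abs_summable k ->
  (forall x, `|h x| <= `|k x|) -> abs_summable h.
Proof. by move=> sk hk; apply: le_lt_trans sk; apply: le_esum => x _; rewrite lee_fin. Qed.

Lemma abs_summableD (h k : X -> R) : abs_summable h -> abs_summable k ->
  abs_summable (fun x => h x + k x).
Proof.
move=> sh sk; apply: le_lt_trans (lte_add_pinfty sh sk).
rewrite -esumD; try by move=> x _; rewrite lee_fin.
by apply: le_esum => x _; rewrite -EFinD lee_fin ler_normD.
Qed.

Lemma abs_summableZ c (h : X -> R) : abs_summable h ->
  abs_summable (fun x => c * h x).
Proof.
move=> sh; rewrite /abs_summable; under eq_esum do rewrite normrM.
by rewrite esumZl // lte_mul_pinfty // lee_fin.
Qed.

Let pos (h : X -> R) x := Num.max (h x) 0.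
Let neg (h : X -> R) x := Num.max (- h x) 0.

Let pos_ge0 h x : 0 <= pos h x. Proof. by rewrite le_max lexx orbT. Qed.
Let neg_ge0 h x : 0 <= neg h x. Proof. by rewrite le_max lexx orbT. Qed.
Let pos_neg h x : h x = pos h x - neg h x.
Proof.
rewrite /pos /neg; case: (lerP (h x) 0) => h0.
  by rewrite max_l ?oppr_ge0 // sub0r opprK.
by rewrite max_r ?oppr_le0 ?(ltW h0) // subr0.
Qed.
Let pos_sum h : abs_summable h -> abs_summable (pos h).
Proof.
move=> sh; apply: (abs_summable_le sh) => x; rewrite ger0_norm //.
by rewrite ge_max ler_norm normr_ge0.
Qed.
Let neg_sum h : abs_summable h -> abs_summable (neg h).
Proof.
move=> sh; apply: (abs_summable_le sh) => x; rewrite ger0_norm //.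
by rewrite ge_max -normrN ler_norm normr_ge0.
Qed.

Lemma rsumD (h k : X -> R) : abs_summable h -> abs_summable k ->
  rsum (fun x => h x + k x) = rsum h + rsum k.
Proof.
move=> sh sk.
have -> : (fun x => h x + k x) =
    (fun x => (pos h x + pos k x) - (neg h x + neg k x)).
  by apply/funext => x; rewrite [in LHS](pos_neg h) [in LHS](pos_neg k) opprD addrACA.
have [ph nh pk nk] : [/\ abs_summable (pos h), abs_summable (neg h),
    abs_summable (pos k) & abs_summable (neg k)].
  by split; [exact: pos_sum|exact: neg_sum|exact: pos_sum|exact: neg_sum].
rewrite rsumB; [|exact: abs_summableD|exact: abs_summableD|
  by move=> x; rewrite addr_ge0|by move=> x; rewrite addr_ge0].
have E (p q : X -> R) : abs_summable p -> abs_summable q ->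
  (forall x, 0 <= p x) -> (forall x, 0 <= q x) ->
  fine (\esum_(x in [set: X]) (p x + q x)%:E)%E =
  fine (\esum_(x in [set: X]) (p x)%:E)%E + fine (\esum_(x in [set: X]) (q x)%:E)%E.
  move=> sp sq p0 q0.
  under eq_esum do rewrite EFinD.
  rewrite esumD ?fineD //; try by move=> x _; rewrite lee_fin.
    by apply: (esum_fin sp) => x; rewrite p0 ler_norm.
  by apply: (esum_fin sq) => x; rewrite q0 ler_norm.
by rewrite (E _ _ ph pk (pos_ge0 h) (pos_ge0 k)) (E _ _ nh nk (neg_ge0 h) (neg_ge0 k))
  opprD addrACA.
Qed.

Lemma rsumN (h : X -> R) : rsum (fun x => - h x) = - rsum h.
Proof. by rewrite /rsum opprB; under [in X in _ - X]eq_esum do rewrite opprK. Qed.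

Lemma rsum0 : rsum (fun=> 0) = 0.
Proof. by rewrite /rsum oppr0 subrr. Qed.

Lemma rsum_ge0 (p : X -> R) : (forall x, 0 <= p x) ->
  rsum p = fine (\esum_(x in [set: X]) (p x)%:E)%E.
Proof.
move=> p0; rewrite /rsum [X in _ - fine X]esum1 ?subr0; last first.
  by move=> x _; rewrite max_r // oppr_le0.
by congr fine; apply: eq_esum => x _; rewrite max_l.
Qed.

Lemma rsumZ c (h : X -> R) : abs_summable h -> rsum (fun x => c * h x) = c * rsum h.
Proof.
move=> sh.
have pos_c d : 0 <= d -> rsum (fun x => d * h x) = d * rsum h.
  move=> d0; rewrite /rsum mulrBr.
  have E k : d * fine (\esum_(x in [set: X]) (Num.max (k x) 0)%:E)%E =
      fine (\esum_(x in [set: X]) (Num.max (d * k x) 0)%:E)%E.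
    under [in RHS]eq_esum do rewrite -{1}(mulr0 d) -maxr_pMr //.
    rewrite esumZl //; last by move=> x; rewrite le_max lexx orbT.
    have [->|d1] := eqVneq d 0; first by rewrite mul0e mul0r.
    by case: (\esum_(x in _) _)%E => //= [|];
      rewrite mulr_infty gtr0_sg ?lt_def ?d1 ?d0 // mul1e /= mulr0.
  by rewrite !E; under [in X in _ = _ - X]eq_esum do rewrite mulrN.
case: (lerP 0 c) => c0; first exact: pos_c.
have -> : (fun x => c * h x) = (fun x => - (- c * h x)).
  by apply/funext => x; rewrite mulNr opprK.
by rewrite rsumN pos_c ?oppr_ge0 ?(ltW c0) // mulNr opprK.
Qed.

Lemma rsum_lin (c d : R) (p q r : X -> R) :
  abs_summable p -> abs_summable q -> abs_summable r ->
  rsum (fun x => (c * p x + d * q x) + r x) =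
  (c * rsum p + d * rsum q) + rsum r.
Proof.
move=> sp sq sr; have cp := abs_summableZ c sp; have dq := abs_summableZ d sq.
rewrite (rsumD (abs_summableD cp dq) sr) (rsumD cp dq).
by rewrite (rsumZ c sp) (rsumZ d sq).
Qed.

Definition ell2_inner a b : R[i] := csum (fun x => a x * (b x)^*).

Lemma sum_normsq_abs a : abs_summable (fun x => normsq (a x)).
Proof.
rewrite /abs_summable; under eq_esum do rewrite ger0_norm ?normsq_ge0 //.
exact: ell2_lt.
Qed.

Lemma ell2_inner_summable a b :
  abs_summable (fun x => complex.Re (a x * (b x)^*)) /\
  abs_summable (fun x => complex.Im (a x * (b x)^*)).
Proof.
have s := abs_summableD (sum_normsq_abs a) (sum_normsq_abs b).
have n x : 0 <= normsq (a x) + normsq (b x) by rewrite addr_ge0 ?normsq_ge0.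
split; apply: (abs_summable_le s) => x; rewrite [leRHS]ger0_norm //.
  exact: Re_mul_conj_le.
exact: Im_mul_conj_le.
Qed.

Lemma ell2_inner_linear b : scalar (ell2_inner ^~ b).
Proof.
move=> k u v; rewrite /ell2_inner /csum.
have [ur ui] := ell2_inner_summable u b.
have [vr vi] := ell2_inner_summable v b.
set ru := (fun x => complex.Re (u x * _)) in ur *.
set iu := (fun x => complex.Im (u x * _)) in ui *.
set rv := (fun x => complex.Re (v x * _)) in vr *.
set iv := (fun x => complex.Im (v x * _)) in vi *.
case: k => k k'.
have -> : (fun x => complex.Re (((k +i* k') *: u + v : ell2) x * (b x)^*)) =
    (fun x => (k * ru x + - k' * iu x) + rv x).
  apply/funext => x; rewrite ell2D ell2Z /ru /iu /rv.
  case: (u x) => ? ?; case: (v x) => ? ?; case: (b x) => ? ? /=; ring.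
have -> : (fun x => complex.Im (((k +i* k') *: u + v : ell2) x * (b x)^*)) =
    (fun x => (k * iu x + k' * ru x) + iv x).
  apply/funext => x; rewrite ell2D ell2Z /ru /iu /iv.
  case: (u x) => ? ?; case: (v x) => ? ?; case: (b x) => ? ? /=; ring.
rewrite (rsum_lin k (- k') ur ui vr) (rsum_lin k k' ui ur vi) mulNr.
by [].
Qed.

Lemma ell2_inner_conj a b : ell2_inner b a = (ell2_inner a b)^*.
Proof.
rewrite /ell2_inner /csum /=; congr (_ +i* _); last rewrite -rsumN;
  congr rsum; apply/funext => x;
  case: (a x) => ? ?; case: (b x) => ? ? /=; ring.
Qed.

Lemma ell2_inner_norm a : ell2_inner a a = `|a| ^+ 2.
Proof.
have -> : `|a| = (ell2_rnorm a)%:C by [].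
rewrite -rmorphXn /= sqr_sqrtr ?fine_ge0 ?sum_normsq_ge0 // /ell2_inner /csum.
have -> : (fun x => complex.Re (a x * (a x)^*)) = (fun x => normsq (a x)).
  by apply/funext => x; case: (a x) => ? ?; rewrite /normsq /=; ring.
have -> : (fun x => complex.Im (a x * (a x)^*)) = (fun=> 0).
  by apply/funext => x; case: (a x) => ? ?; rewrite /normsq /=; ring.
by rewrite rsum0 rsum_ge0 // => x; exact: normsq_ge0.
Qed.

HB.instance Definition _ := CompleteNormedModule_isHilbert.Build R ell2
  ell2_inner_linear ell2_inner_conj ell2_inner_norm.

Lemma ell2_delta_subproof (y : X) :
  (fun x => if x == y then 1 else 0) \in ell2_pred.
Proof.
apply/ell2P; rewrite /sum_normsq (esumID [set y]); last first.
  by move=> x _; rewrite lee_fin normsq_ge0.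
rewrite !setTI esum_set1 ?lee_fin ?normsq_ge0 // esum1 ?adde0 ?ltry //.
by move=> x /= /eqP /negbTE ->; rewrite normsq0.
Qed.

Definition delta (y : X) : ell2 := Ell2 (ell2_delta_subproof y).

End Ell2.

(* The product [gmul g h] is meaningful only when [gsrc g = grng h]. *)
HB.mixin Record Topological_isGroupoid G & Topological G := {
  gsrc : G -> G ;
  grng : G -> G ;
  ginv : G -> G ;
  gmul : G -> G -> G ;
  gsrc_src : forall g, gsrc (gsrc g) = gsrc g ;
  grng_src : forall g, grng (gsrc g) = gsrc g ;
  gsrc_rng : forall g, gsrc (grng g) = grng g ;
  grng_rng : forall g, grng (grng g) = grng g ;
  gsrc_mul : forall g h, gsrc g = grng h -> gsrc (gmul g h) = gsrc h ;
  grng_mul : forall g h, gsrc g = grng h -> grng (gmul g h) = grng g ;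
  gmulA : forall g h k, gsrc g = grng h -> gsrc h = grng k ->
    gmul g (gmul h k) = gmul (gmul g h) k ;
  gmul_rng : forall g, gmul (grng g) g = g ;
  gmul_src : forall g, gmul g (gsrc g) = g ;
  gsrc_inv : forall g, gsrc (ginv g) = grng g ;
  grng_inv : forall g, grng (ginv g) = gsrc g ;
  gmulVg : forall g, gmul (ginv g) g = gsrc g ;
  gmulgV : forall g, gmul g (ginv g) = grng g ;
  ginv_continuous : continuous ginv ;
  gmul_continuous : {within [set p : G * G | gsrc p.1 = grng p.2],
    continuous (fun p : G * G => gmul p.1 p.2)}
}.

#[short(type="topGroupoidType")]
HB.structure Definition TopGroupoid :=
  {G of Topological G & Topological_isGroupoid G}.

Section Groupoid.
Variable G : topGroupoidType.

Definition units : set G := range (@gsrc G).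

Definition homeo_onto_open (f : G -> G) (U : set G) : Prop :=
  {within U, continuous f} /\
  exists h : G -> G, [/\ {within f @` U, continuous h},
    forall x, U x -> h (f x) = x &
    exists2 O, open O & f @` U = O `&` units].

Definition open_bisection (U : set G) : Prop :=
  [/\ open U, homeo_onto_open (@grng G) U & homeo_onto_open (@gsrc G) U].

Definition etale : Prop := basis open_bisection.

Definition isotropy : set G := [set g | grng g = gsrc g].

Definition effective : Prop := interior isotropy = units.

Definition orbit (u : G) : set G := @gsrc G @` [set g | grng g = u].

Definition minimal : Prop := forall u, units u -> units `<=` closure (orbit u).

End Groupoid.

(* The library's [locally_compact] asks for closed compact neighbourhoods, which
   is too much for a space that is not Hausdorff. *)
Definition loc_compact (T : topologicalType) : Prop :=
  forall (x : T) V, nbhs x V -> exists K, [/\ nbhs x K, K `<=` V & compact K].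

Section Convolution.
Variables (R : realType) (G : topGroupoidType).
Implicit Types (f h : G -> R[i]) (U : set G).

(* A function on [U] is represented by its extension by 0 to [G]. *)
Definition Cc U f : Prop :=
  {within U, continuous (f : G -> R[i]^o)} /\
  exists K, [/\ compact K, K `<=` U & forall g, ~ K g -> f g = 0].

Definition convAlg : set (G -> R[i]) :=
  linear_span [set f | exists2 U, open_bisection U & Cc U f].

(* For [f] and [h] in [convAlg] the summand is nonzero for finitely many [e]
   only, so that this finitely supported sum is the sum of the product formula. *)
Definition conv f h : G -> R[i] := fun g =>
  \sum_(e \in [set e | grng e = grng g]) f e * h (gmul (ginv e) g).

Definition conv_star f : G -> R[i] := fun g => (f (ginv g))^*.

Definition univ_norm f : \bar R :=
  ereal_sup [set e | exists (H : hilbertType R) (pi : (G -> R[i]) -> H -> H),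
    star_rep conv conv_star convAlg pi /\ e = op_norm (pi f)].

Definition fiber (u : G) : Type := set_type [set g : G | gsrc g = u].

Lemma fiber_subproof (g : G) : g \in [set h | gsrc h = gsrc g].
Proof. by rewrite inE. Qed.

Definition in_fiber (g : G) : fiber (gsrc g) := SigSub (fiber_subproof g).

Definition in_fiber_src (g : G) : fiber (gsrc g).
Proof. exists (gsrc g); rewrite inE; exact: gsrc_src. Defined.

Lemma fiber_mul_subproof u (c : fiber u) (a : fiber (grng (val c))) :
  gmul (val a) (val c) \in [set h | gsrc h = u].
Proof.
have /set_mem /= ha := valP a; have /set_mem /= hc := valP c.
by rewrite inE /= gsrc_mul.
Qed.

Definition fiber_mul u (c : fiber u) (a : fiber (grng (val c))) : fiber u :=
  SigSub (fiber_mul_subproof a).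

(* [T] is the operator [L_u(f)]; as bounded operators are determined by their
   values on the basis, there is at most one such [T]. *)
Definition is_regular (u : G) f (T : ell2 R (fiber u) -> ell2 R (fiber u)) :
    Prop :=
  bounded_operator T /\
  forall c : fiber u, T (delta R c) =
    \sum_(a \in [set: fiber (grng (val c))]) f (val a) *: delta R (fiber_mul a).

(* the norm of the direct sum of the [L_u(f)]; the value 0 is added to the
   supremum for the sake of the empty groupoid *)
Definition red_norm f : \bar R :=
  ereal_sup (0%E |` [set e | exists u (T : ell2 R (fiber u) -> ell2 R (fiber u)),
    [/\ units u, is_regular f T & e = op_norm T]]).

Definition is_completion (nrm : (G -> R[i]) -> \bar R) (A : cstarAlgType R)
    (iota : (G -> R[i]) -> A) : Prop :=
  [/\ star_hom conv conv_star convAlg iota,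
      forall f, convAlg f -> (complex.Re `|iota f|)%:E = nrm f &
      dense (iota @` convAlg)].

(* As usual, a completion is given by an isometric map with dense range into a
   complete algebra; it is unique up to a unique isomorphism compatible with
   these maps. *)
Record full_cstar := FullCstar {
  full_alg :> cstarAlgType R ;
  full_map : (G -> R[i]) -> full_alg ;
  full_mapP : is_completion univ_norm full_map
}.

(* [red_rep u] is the extension of [L_u] by continuity. *)
Record red_cstar := RedCstar {
  red_alg :> cstarAlgType R ;
  red_map : (G -> R[i]) -> red_alg ;
  red_mapP : is_completion red_norm red_map ;
  red_rep : forall u, red_alg -> ell2 R (fiber u) -> ell2 R (fiber u) ;
  red_repP : forall u, units u ->
    star_rep (@amul R red_alg) (@astar R red_alg) [set: red_alg] (@red_rep u) ;
  red_rep_le : forall u, units u -> forall a x, `|@red_rep u a x| <= `|a| * `|x| ;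
  red_rep_map : forall u, units u -> forall f, convAlg f ->
    is_regular f (@red_rep u (red_map f))
}.

Definition jmap (B : red_cstar) (a : B) : G -> R[i] := fun g =>
  inner (@red_rep B (gsrc g) a (delta R (in_fiber_src g))) (delta R (in_fiber g)).

Definition supp (h : G -> R[i]) : set G := [set g | h g <> 0].

Definition supp_interior (B : red_cstar) : Prop :=
  forall a : B, a <> 0 -> interior (supp (jmap a)) !=set0.

Definition canonical_map (A : full_cstar) (B : red_cstar) (q : A -> B) : Prop :=
  [/\ star_hom (@amul R A) (@astar R A) [set: A] q, continuous q &
      forall f, convAlg f -> q (full_map A f) = red_map B f].

Definition full_eq_reduced (A : full_cstar) (B : red_cstar) : Prop :=
  exists2 q : A -> B, canonical_map q & bijective q.

End Convolution.

(* Main.v *)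
(* If [C^*(G)] is simple, the kernel of [C^*(G) -> C^*_r(G)] vanishes, and an injective
   *-homomorphism is isometric: apply to [f^* f] polynomials converging to [t (|t - r| + t - r)],
   which vanishes on [0, r] but not at 1. A function on a bisection of isotropy elements and its
   transport to the sources of these elements have the same image under the augmentation
   representation, which sends [delta_u] to the sum of [f(g) delta_{r(g)}] over [g] with source
   [u]; so simplicity forces effectiveness. If [supp (j a)] has empty interior, [j a] vanishes
   wherever the terms of a sequence in [C(G)] converging to [a] are all continuous; by Baire
   there is a unit [u] for which this covers all the matrix entries of [L_u(a)], so [L_u(a) = 0],
   and [a = 0] by simplicity. A function on the units vanishing on the orbit of [u] is in the
   kernel of [L_u], whence minimality. Conversely, a nonzero ideal [J] contains some [b] with [j
   b] nonzero on an open set of units. Approximate [b] by [f] in [C(G)]; by effectiveness, [f]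
   can be compressed to a small set of units on which it is almost constant, and a Neumann series
   puts a nonzero function on the units in [J]. Translates of it by bisections lie in [J], and by
   minimality their sums are positive on any compact set of units. *)
Require Import Defs.
From HB Require Import structures.
From mathcomp Require Import all_boot all_order all_algebra.
From mathcomp Require Import all_classical all_reals all_analysis.
From mathcomp Require Import complex.
From mathcomp Require Import ring lra.
Set Implicit Arguments. Unset Strict Implicit. Unset Printing Implicit Defensive.
Import Order.TTheory GRing.Theory Num.Theory.
Import numFieldNormedType.Exports.
Import Defs.
Local Open Scope classical_set_scope.
Local Open Scope ring_scope.
Local Open Scope complex_scope.

(** * Real-valued norms over the complex field *)

Section RealNorm.
Context {R : realType}.

(** Two obstacles shape the proof. The groupoid need not be Hausdorff: compact sets need not be
    closed, functions in C(G) need not be continuous, and j(a) is only a uniform limit of such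
    functions. Each bisection is Hausdorff, being homeomorphic to its set of sources, so supports
    are studied inside one bisection at a time. Where continuity fails, Baire category on the unit
    space takes its place, both to find a good unit and to bound |j(b)| from below on a dense set of
    units. The second obstacle is that the norm of C*(G) is a supremum over representations.
    Estimates in C*(G) are therefore made vector by vector in an arbitrary representation, with
    constants independent of it. There |t - r| is obtained from explicit polynomials, Visser's
    iteration for a square root, whose error is controlled by the scalar sequence [1 - vbound n].
    The factor t in t (|t - r| + t - r) makes these polynomials vanish at 0, so that they can be
    evaluated in an algebra without unit. *)

Definition rnorm (V : normedZmodType R[i]) (x : V) : R := complex.Re `|x|.

Lemma rnormE (V : normedZmodType R[i]) (x : V) : `|x| = (rnorm x)%:C.
Proof. by rewrite /rnorm RRe_real ?normr_real. Qed.

Lemma rnorm_ge0 (V : normedZmodType R[i]) (x : V) : 0 <= rnorm x.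
Proof. by rewrite -lecR -rnormE rmorph0 normr_ge0. Qed.

Lemma rnormD (V : normedZmodType R[i]) (x y : V) :
  rnorm (x + y) <= rnorm x + rnorm y.
Proof. by rewrite -lecR rmorphD /= -!rnormE ler_normD. Qed.

Lemma rnormN (V : normedZmodType R[i]) (x : V) : rnorm (- x) = rnorm x.
Proof. by rewrite /rnorm normrN. Qed.

Lemma rnormBC (V : normedZmodType R[i]) (x y : V) : rnorm (x - y) = rnorm (y - x).
Proof. by rewrite -rnormN opprB. Qed.

Lemma rnormB (V : normedZmodType R[i]) (x y : V) :
  rnorm (x - y) <= rnorm x + rnorm y.
Proof. by rewrite -(rnormN y) rnormD. Qed.

Lemma rnorm_tri (V : normedZmodType R[i]) (y x z : V) :
  rnorm (x - z) <= rnorm (x - y) + rnorm (y - z).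
Proof. by rewrite -[x - z](subrKA y) rnormD. Qed.

Lemma rnorm0 (V : normedZmodType R[i]) : rnorm (0 : V) = 0.
Proof. by rewrite /rnorm normr0. Qed.

Lemma rnorm0_eq0 (V : normedZmodType R[i]) (x : V) : rnorm x = 0 -> x = 0.
Proof. by move=> x0; apply/normr0_eq0; rewrite rnormE x0. Qed.

Lemma rnormZ (V : normedModType R[i]) (k : R[i]) (x : V) :
  rnorm (k *: x) = rnorm k * rnorm x.
Proof. by apply: (@complexI R); rewrite rmorphM /= -!rnormE normrZ. Qed.

Lemma rnormZr (V : normedModType R[i]) (k : R) (x : V) :
  rnorm (k%:C *: x) = `|k| * rnorm x.
Proof. by rewrite rnormZ /rnorm normc_def /= expr0n addr0 sqrtr_sqr. Qed.

Lemma rnorm_real (k : R) : rnorm k%:C = `|k|.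
Proof. by rewrite /rnorm normc_def /= expr0n addr0 sqrtr_sqr. Qed.

Lemma rnormM (a b : R[i]) : rnorm (a * b) = rnorm a * rnorm b.
Proof. by apply: (@complexI R); rewrite rmorphM /= -!rnormE normrM. Qed.

Lemma rnorm_conj (a : R[i]) : rnorm (conjc a) = rnorm a.
Proof. by rewrite /rnorm; case: a => a b; rewrite !normc_def /= sqrrN. Qed.

Lemma rnorm_sqr (a : R[i]) : rnorm a ^+ 2 = normsq a.
Proof. by apply: (@complexI R); rewrite rmorphXn /= -rnormE normsqE. Qed.

Lemma rnorm_neq0 (V : normedZmodType R[i]) (x : V) : x != 0 -> 0 < rnorm x.
Proof.
move=> x0; rewrite lt_def rnorm_ge0 andbT; apply: contra x0 => /eqP.
by move=> /rnorm0_eq0 ->.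
Qed.

Lemma rnorm_small (V : normedZmodType R[i]) (x : V) :
  (forall e, 0 < e -> rnorm x < e) -> x = 0.
Proof.
move=> h; have [//|x0] := eqVneq x 0.
by have := h _ (rnorm_neq0 x0); rewrite ltxx.
Qed.

Lemma nbhs_rnorm (V : normedModType R[i]) (x : V) (P : set V) :
  nbhs x P <-> exists2 e : R, 0 < e & forall y, rnorm (x - y) < e -> P y.
Proof.
split.
  move=> /nbhs_normP[[e e'] /=]; rewrite ltcE /= => /andP[/eqP -> e0] H.
  exists e => // y xy; apply: H => /=.
  by rewrite rnormE ltcR.
move=> [e e0 H]; apply/nbhs_normP; exists e%:C; first by rewrite /= ltcR.
by move=> y /=; rewrite rnormE ltcR => /H.
Qed.

Lemma continuous_rnorm (T : topologicalType) (V : normedModType R[i]) (f : T -> V) x :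
  {for x, continuous f} <->
  forall e : R, 0 < e -> \forall y \near x, rnorm (f x - f y) < e.
Proof.
split=> [cf e e0|H P].
  by apply: (cf [set y | rnorm (f x - y) < e]); apply/nbhs_rnorm; exists e.
by move=> /nbhs_rnorm[e e0 eP]; apply: filterS (H e e0) => y /eP.
Qed.

Lemma closed_rnorm (V : normedModType R[i]) (J : set V) :
  closed J <->
  forall x, (forall e : R, 0 < e -> exists2 y, J y & rnorm (x - y) < e) -> J x.
Proof.
split=> [cJ x H|H x xJ].
  apply: cJ => P /nbhs_rnorm[e e0 eP]; have [y Jy xy] := H _ e0.
  by exists y; split => //; exact: eP.
apply: H => e e0; have [|y [Jy xy]] := xJ [set y | rnorm (x - y) < e].
  by apply/nbhs_rnorm; exists e.
by exists y.
Qed.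

Lemma dense_rnorm (V : normedModType R[i]) (D : set V) :
  dense D -> forall (x : V) (e : R), 0 < e -> exists2 y, D y & rnorm (x - y) < e.
Proof.
move=> dD x e e0.
have : nbhs x [set y | rnorm (x - y) < e] by apply/nbhs_rnorm; exists e.
rewrite nbhsE => -[U [oU Ux] UP].
have [y [Uy Dy]] := dD U (ex_intro _ x Ux) oU.
by exists y; [|exact: UP].
Qed.

(** Letting m tend to infinity in the Cauchy estimate keeps the rate [e n], so the limit comes with
    an explicit error bound. *)
Lemma rnorm_complete (V : completeNormedModType R[i]) (x : nat -> V) (e : nat -> R) :
  (forall n m, (n <= m)%N -> rnorm (x m - x n) <= e n) -> e @ \oo --> (0 : R) ->
  exists l, forall n, rnorm (l - x n) <= e n.
Proof.
move=> xe e0.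
have small (d : R) : 0 < d -> exists N, forall n, (N <= n)%N -> e n < d.
  move=> d0; have := cvgr_lt _ e0 _ d0.
  by case=> N _ NH; exists N => n /NH.
have cx : cvg (x @ \oo).
  apply: cauchy_cvg; apply/cauchyP => -[d d'].
  rewrite ltcE /= => /andP[/eqP -> d0].
  have [N Nd] := small _ d0.
  exists (x N); exists N => // n /= Nn.
  rewrite -ball_normE /= -/(rnorm _) rnormE ltcR rnormBC.
  by apply: le_lt_trans (xe _ _ Nn) (Nd _ _).
have /cvg_ex[l xl] := cx.
exists l => n; apply/ler_addgt0Pr => d d0.
have /nbhs_rnorm : nbhs l [set y | rnorm (l - y) < d].
  by apply/nbhs_rnorm; exists d.
move=> H; have : \forall m \near \oo, rnorm (l - x m) < d.
  by apply: (xl [set y | rnorm (l - y) < d]); apply/nbhs_rnorm; exists d.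
move=> [N _ NH]; have := NH (maxn N n) (leq_maxl _ _) => /= l1.
have := xe n _ (leq_maxr N n).
have := rnorm_tri (x (maxn N n)) l (x n); lra.
Qed.

End RealNorm.

(** * Polynomials approximating the absolute value of an operator *)

Section RealInner.
Context {R : realType} {H : hilbertType R}.
Implicit Types (x y z : H) (k : R).

(** A real inner product with the same norm. Visser's iteration has real coefficients, so its
    identities and estimates can be stated over [R]. *)
Definition rinner x y : R := complex.Re (inner x y).

Lemma rinnerC x y : rinner x y = rinner y x.
Proof. by rewrite /rinner (inner_conj x y); case: (inner x y). Qed.

Lemma rinnerP k x y z : rinner (k%:C *: x + y) z = k * rinner x z + rinner y z.
Proof.
rewrite /rinner inner_linearl; case: (inner x z) => a b; case: (inner y z) => c d.
by rewrite /=; ring.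
Qed.

Lemma rinnerDl x y z : rinner (x + y) z = rinner x z + rinner y z.
Proof. by have := rinnerP 1 x y z; rewrite scale1r mul1r. Qed.

Lemma rinner0l z : rinner 0 z = 0.
Proof. by have := rinnerDl 0 0 z; rewrite addr0; lra. Qed.

Lemma rinnerZl k x z : rinner (k%:C *: x) z = k * rinner x z.
Proof. by have := rinnerP k x 0 z; rewrite addr0 rinner0l addr0. Qed.

Lemma rinnerNl x z : rinner (- x) z = - rinner x z.
Proof. by have := rinnerDl (- x) x z; rewrite addNr rinner0l; lra. Qed.

Lemma rinnerDr x y z : rinner z (x + y) = rinner z x + rinner z y.
Proof. by rewrite !(rinnerC z) rinnerDl. Qed.

Lemma rinnerZr k x z : rinner z (k%:C *: x) = k * rinner z x.
Proof. by rewrite !(rinnerC z) rinnerZl. Qed.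

Lemma rinnerNr x z : rinner z (- x) = - rinner z x.
Proof. by rewrite !(rinnerC z) rinnerNl. Qed.

Definition rinnerE := (rinnerDl, rinnerDr, rinnerNl, rinnerNr, rinnerZl, rinnerZr).

Lemma rinner_sqr x : rinner x x = rnorm x ^+ 2.
Proof. by rewrite /rinner inner_norm rnormE -rmorphXn. Qed.

(** Cauchy-Schwarz read off the triangle inequality, which the norm of a Hilbert space already
    satisfies here: expand the square of the norm of x + y. *)
Lemma rinner_le x y : rinner x y <= rnorm x * rnorm y.
Proof.
have : rnorm (x + y) ^+ 2 <= (rnorm x + rnorm y) ^+ 2.
  by rewrite lerXn2r ?nnegrE ?addr_ge0 ?rnorm_ge0 ?rnormD.
rewrite -rinner_sqr !rinnerE !rinner_sqr (rinnerC y x) sqrrD; lra.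
Qed.

Lemma rinner_ext x y : (forall z, rinner x z = rinner y z) -> x = y.
Proof.
move=> xy; apply/eqP; rewrite -subr_eq0; apply/eqP/rnorm0_eq0/eqP.
by rewrite -sqrf_eq0 -rinner_sqr rinnerDl rinnerNl xy subrr.
Qed.

End RealInner.

(** Pairing with an arbitrary vector turns a vector identity with real coefficients into a
    polynomial identity over [R]. *)
Ltac rinner_ring := let z := fresh in
  apply: rinner_ext => z; rewrite !rinnerE; ring.

Section VisserBound.
Context {R : realType}.

(** Visser's iteration for the scalar Z = 1, its slowest case. It increases to 1 and dominates the
    operator iteration. *)
Fixpoint vbound (n : nat) : R := if n is m.+1 then (1 + vbound m ^+ 2) / 2 else 0.

Lemma vbound_ge0 n : 0 <= vbound n.
Proof. by case: n => //= n; rewrite divr_ge0 ?addr_ge0 ?sqr_ge0. Qed.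

Lemma vbound_le1 n : vbound n <= 1.
Proof.
elim: n => //= n IH; have := vbound_ge0 n.
have : vbound n ^+ 2 <= 1 by rewrite exprn_ile1 ?vbound_ge0.
lra.
Qed.

Lemma vbound_leS n : vbound n <= vbound n.+1.
Proof. by have := sqr_ge0 (vbound n - 1); rewrite /= sqrrB1; lra. Qed.

Lemma vbound_le n m : (n <= m)%N -> vbound n <= vbound m.
Proof.
elim: m => [|m IH]; first by rewrite leqn0 => /eqP ->.
rewrite leq_eqVlt ltnS => /orP[/eqP -> //|/IH] /le_trans; apply.
exact: vbound_leS.
Qed.

Lemma vbound_rate n : 1 - vbound n <= 2 / n.+2%:R.
Proof.
elim: n => [|n IH]; first by rewrite /= subr0 divff.
have d0 : 0 <= 1 - vbound n by rewrite subr_ge0 vbound_le1.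
have -> : 1 - vbound n.+1 = (1 - vbound n) - (1 - vbound n) ^+ 2 / 2 by rewrite /=; field.
move: d0 IH; set d := 1 - vbound n => d0 IH.
have n0 : 0 < n.+2%:R :> R by rewrite ltr0n.
have n3 : 0 < n.+3%:R :> R by rewrite ltr0n.
pose b : R := 2 / n.+2%:R.
have b1 : b <= 1 by rewrite /b ler_pdivrMr // mul1r ler_nat.
have -> : n.+3%:R = n.+2%:R + 1 :> R by rewrite -[LHS]natr1.
suff : b - b ^+ 2 / 2 <= 2 / (n.+2%:R + 1).
  (* This product is twice the difference of the values of x - x^2/2 at b and at d: that map is
     monotone on [0, 1]. *)
  apply: le_trans; have : 0 <= (b - d) * (2 - b - d).
    by rewrite mulr_ge0 // /b; [move: IH; rewrite -/b|move: IH; rewrite -/b]; lra.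
  lra.
rewrite ler_pdivlMr ?addr_gt0 // /b.
have -> : (2 / n.+2%:R - (2 / n.+2%:R) ^+ 2 / 2) * (n.+2%:R + 1) =
   2 - 2 / n.+2%:R ^+ 2 :> R by field; rewrite gt_eqF.
by rewrite gerBl divr_ge0 // sqr_ge0.
Qed.

Lemma vbound_small (C e : R) : 0 < e -> exists n, C * (1 - vbound n) < e.
Proof.
move=> e0; have [n nC] : exists n : nat, 2 * `|C| / e < n%:R.
  by exists (Num.bound (2 * `|C| / e)); rewrite archi_boundP ?divr_ge0 ?mulr_ge0 // ltW.
exists n; have n0 : 0 < n.+2%:R :> R by rewrite ltr0n.
apply: (@le_lt_trans _ _ (`|C| * (2 / n.+2%:R))).
  apply: (@le_trans _ _ (`|C| * (1 - vbound n))).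
    by rewrite ler_wpM2r ?ler_norm // subr_ge0 vbound_le1.
  by rewrite ler_wpM2l ?vbound_rate.
rewrite mulrA ltr_pdivrMr // [_ * 2]mulrC.
move: nC; rewrite ltr_pdivrMr // => /lt_trans; apply.
by rewrite mulrC ltr_pM2l // ltr_nat.
Qed.

Lemma vbound_cvg (C : R) : (fun n => (1 - vbound n) * C) @ \oo --> (0 : R).
Proof.
apply/cvgrPdist_lt => e e0; have [n nC] := vbound_small `|C| e0.
exists n => // m /= nm; rewrite sub0r normrN normrM.
rewrite ger0_norm ?subr_ge0 ?vbound_le1 //; apply: le_lt_trans nC; rewrite mulrC.
by rewrite ler_wpM2l // lerB // vbound_le.
Qed.

Lemma vbound_null (V : normedZmodType R[i]) (v : V) C :
  (forall n, rnorm v <= C * (1 - vbound n)) -> v = 0.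
Proof.
move=> h; apply: rnorm_small => e e0; have [n] := vbound_small C e0.
exact: le_lt_trans.
Qed.

Lemma vbound_le0 (v C : R) : (forall n, v <= C * (1 - vbound n)) -> v <= 0.
Proof.
move=> h; rewrite leNgt; apply/negP => e0; have [n] := vbound_small C e0.
by have := h n; lra.
Qed.

End VisserBound.

(** * Visser's iteration for a positive contraction *)

Section PositiveContraction.
Context {R : realType} {H : hilbertType R}.
Implicit Types (x y z : H) (k : R) (F : H -> H).

Definition real_linear F := forall k x y, F (k%:C *: x + y) = k%:C *: F x + F y.

Definition real_symmetric F := forall x y, rinner (F x) y = rinner x (F y).

Lemma real_linearD F x y : real_linear F -> F (x + y) = F x + F y.
Proof. by move=> lF; have := lF 1 x y; rewrite !scale1r. Qed.

Lemma real_linear0 F : real_linear F -> F 0 = 0.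
Proof. by move=> lF; apply: (addrI (F 0)); rewrite -real_linearD // !addr0. Qed.

Lemma real_linearZ F k x : real_linear F -> F (k%:C *: x) = k%:C *: F x.
Proof. by move=> lF; have := lF k x 0; rewrite !addr0 real_linear0 // addr0. Qed.

Lemma real_linearN F x : real_linear F -> F (- x) = - F x.
Proof.
by move=> lF; apply: (addrI (F x)); rewrite -real_linearD // !subrr real_linear0.
Qed.

Lemma real_linearB F x y : real_linear F -> F (x - y) = F x - F y.
Proof. by move=> lF; rewrite real_linearD // real_linearN. Qed.

(** By symmetry the hypothesis says that the form of F^3 vanishes. Evaluating it at y + F y leaves
    twice the squared norm of F (F y), so F^2 = 0, and then F = 0 by symmetry again. *)
Lemma cube_eq0 F : real_linear F -> real_symmetric F ->
  (forall y, rinner (F (F y)) (F y) = 0) -> forall x, F x = 0.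
Proof.
move=> linF symF FF x; have FF0 y : F (F y) = 0.
  apply/rnorm0_eq0/eqP; rewrite -sqrf_eq0 -rinner_sqr; apply/eqP.
  have := FF (y + F y); rewrite !(real_linearD _ _ linF) !rinnerDl !rinnerDr.
  rewrite FF (FF (F y)) [rinner (F (F (F y))) (F y)]symF; lra.
by apply/rnorm0_eq0/eqP; rewrite -sqrf_eq0 -rinner_sqr -symF FF0 rinner0l.
Qed.

(** The hypothesis [posT] is the form of T^2 <= T, that is of 0 <= T <= 1: positivity is immediate
    from it, and contractivity follows by Cauchy-Schwarz. *)
Variables (T : H -> H) (r : R).
Hypotheses (linT : real_linear T) (symT : real_symmetric T)
  (posT : forall x, rnorm (T x) ^+ 2 <= rinner (T x) x) (r_gt0 : 0 < r) (r_le1 : r <= 1).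

Let rnormT x : rnorm (T x) <= rnorm x.
Proof.
have [->|/rnorm_neq0 Tx] := eqVneq (T x) 0; first by rewrite rnorm0 rnorm_ge0.
rewrite -(ler_pM2l Tx) -expr2; exact: le_trans (posT x) (rinner_le _ _).
Qed.

(** The locks keep these operators atomic, so that the iteration does not expand into words in [T]
    under simplification. *)
Definition shift := locked (fun x => T x - r%:C *: x).
Definition gap := locked (fun x => x - shift (shift x)).

Let shiftE x : shift x = T x - r%:C *: x. Proof. by rewrite /shift -lock. Qed.
Let gapE x : gap x = x - shift (shift x). Proof. by rewrite /gap -lock. Qed.

(* Visser's iteration for a square root: if [Y = (Z + Y^2) / 2] then [(I - Y)^2 = I - Z]. Here
   [I - Z = S^2], so that [I - Y] is the absolute value of [S]. *)
Fixpoint visser (n : nat) x :=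
  if n is m.+1 then 2^-1%:C *: (gap x + visser m (visser m x)) else 0.

Local Notation S := shift.
Local Notation Z := gap.
Local Notation Y := visser.

Let visserS n x : Y n.+1 x = 2^-1%:C *: (Z x + Y n (Y n x)). Proof. by []. Qed.

Lemma visserE n x : visser n.+1 x = 2^-1%:C *:
  (x - (T (T x - r%:C *: x) - r%:C *: (T x - r%:C *: x)) + visser n (visser n x)).
Proof. by rewrite visserS gapE !shiftE. Qed.

Let linS : real_linear S.
Proof.
move=> k x y; rewrite !shiftE linT scalerBr [r%:C *: (_ + _)]scalerDr !scalerA.
by rewrite [r%:C * _]mulrC opprD addrACA.
Qed.

Let linZ : real_linear Z.
Proof.
by move=> k x y; rewrite !gapE !linS scalerBr opprD [LHS]addrACA.
Qed.

Let linY n : real_linear (Y n).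
Proof.
elim: n => [|n IH] k x y /=; first by rewrite scaler0 addr0.
rewrite linZ !IH scalerA mulrC -scalerA -scalerDr; congr (_ *: _).
by rewrite scalerDr [LHS]addrACA.
Qed.

Let symS : real_symmetric S.
Proof. by move=> x y; rewrite !shiftE !rinnerE symT. Qed.

Let symZ : real_symmetric Z.
Proof. by move=> x y; rewrite !gapE rinnerDl rinnerNl rinnerDr rinnerNr !symS. Qed.

Let symY n : real_symmetric (Y n).
Proof.
elim: n => [|n IH] x y /=; first by rewrite rinner0l rinnerC rinner0l.
by rewrite rinnerZl rinnerZr rinnerDl rinnerDr symZ !IH.
Qed.

Let commY F n : real_linear F -> (forall x, F (Z x) = Z (F x)) ->
  forall x, F (Y n x) = Y n (F x).
Proof.
move=> lF FZ; elim: n => [|n IH] x /=; first exact: real_linear0.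
by rewrite real_linearZ // real_linearD // FZ !IH.
Qed.

Let commTS x : T (S x) = S (T x).
Proof. by rewrite !shiftE real_linearB // real_linearZ. Qed.

Let commTZ x : T (Z x) = Z (T x).
Proof. by rewrite !gapE real_linearB // !commTS. Qed.

Let commSZ x : S (Z x) = Z (S x).
Proof. by rewrite !gapE real_linearB. Qed.

Let commYY n m x : Y n (Y m x) = Y m (Y n x).
Proof.
by apply: commY => // y; exact/esym/commY.
Qed.

Let rnormS x : rnorm (S x) <= rnorm x.
Proof.
rewrite -(@ler_pXn2r _ 2) ?nnegrE ?rnorm_ge0 //.
rewrite -rinner_sqr shiftE !rinnerE !rinner_sqr (rinnerC x).
have := posT x; have := rnormT x; have := rnorm_ge0 (T x).
have r1 : 0 <= r * (1 - r) by rewrite mulr_ge0 ?subr_ge0 // ltW.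
have le2 : rnorm (T x) <= rnorm x -> rnorm (T x) ^+ 2 <= rnorm x ^+ 2.
  by move=> h; rewrite lerXn2r ?nnegrE ?rnorm_ge0.
move: le2; set a := rnorm (T x); set b := rnorm x; set c := rinner _ _.
move=> le2 a0 /le2 ab ac.
(* The combination 2 h1 + h2 + h3 + h4 is exactly the squared norm of x minus that of S x. *)
have h1 : 0 <= r * (c - a ^+ 2) by rewrite mulr_ge0 ?subr_ge0 // ltW.
have h2 : 0 <= r * a ^+ 2 by rewrite mulr_ge0 ?sqr_ge0 // ltW.
have h3 : 0 <= (1 - r) * (b ^+ 2 - a ^+ 2) by rewrite mulr_ge0 ?subr_ge0.
have h4 : 0 <= (r * (1 - r)) * b ^+ 2 by rewrite mulr_ge0 ?sqr_ge0.
have h5 : 0 <= b ^+ 2 by rewrite sqr_ge0.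
lra.
Qed.

Let rnormZ x : rnorm (Z x) <= rnorm x.
Proof.
rewrite -(@ler_pXn2r _ 2) ?nnegrE ?rnorm_ge0 //.
rewrite -!rinner_sqr !gapE !(rinnerDl, rinnerNl) !(rinnerDr, rinnerNr).
have -> : rinner (shift (shift x)) x = rinner (S x) (S x) by exact: symS.
have -> : rinner x (shift (shift x)) = rinner (S x) (S x).
  by rewrite rinnerC; exact: symS.
rewrite !rinner_sqr.
have : rnorm (S (S x)) ^+ 2 <= rnorm (S x) ^+ 2.
  by rewrite lerXn2r ?nnegrE ?rnorm_ge0 ?rnormS.
have := sqr_ge0 (rnorm (S x)).
lra.
Qed.

Let rnormY n x : rnorm (Y n x) <= vbound n * rnorm x.
Proof.
elim: n x => [|n IH] x /=; first by rewrite rnorm0 mul0r.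
rewrite rnormZr ger0_norm ?invr_ge0 //.
have := rnormD (gap x) (visser n (visser n x)); have := rnormZ x.
have : rnorm (Y n (Y n x)) <= vbound n * (vbound n * rnorm x).
  by apply: le_trans (IH _) _; rewrite ler_wpM2l ?vbound_ge0.
lra.
Qed.

(** As the iterates commute, the increment is half a difference of squares, (Y' - Y)(Y' + Y) / 2.
    [vbound] obeys the same recursion, so the bound propagates. *)
Let rnormYS n x : rnorm (Y n.+1 x - Y n x) <= (vbound n.+1 - vbound n) * rnorm x.
Proof.
elim: n x => [|n IH] x.
  by have := rnormY 1 x; rewrite /= !subr0.
have -> : Y n.+2 x - Y n.+1 x =
    2^-1%:C *: (Y n.+1 (Y n.+1 x + Y n x) - Y n (Y n.+1 x + Y n x)).
  transitivity (2^-1%:C *: (Y n.+1 (Y n.+1 x) - Y n (Y n x))).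
    rewrite (visserS n.+1) [in X in _ - X]visserS -scalerBr; congr (_ *: _).
    by rewrite opprD addrACA subrr add0r.
  congr (_ *: _).
  have := commYY n n.+1 x; have := linY n; have := linY n.+1.
  move: (Y n) (Y n.+1) => F G linG linF FG.
  rewrite (real_linearD _ _ linG) (real_linearD _ _ linF) FG.
  by move: (G (G x)) (F (F x)) (G (F x)) => a b c; rinner_ring.
rewrite rnormZr ger0_norm ?invr_ge0 //.
have h : rnorm (Y n.+1 x + Y n x) <= (vbound n.+1 + vbound n) * rnorm x.
  rewrite mulrDl; apply: le_trans (rnormD _ _) _.
  by rewrite lerD ?rnormY.
have := IH (Y n.+1 x + Y n x).
have : (vbound n.+1 - vbound n) * rnorm (Y n.+1 x + Y n x) <=
  (vbound n.+1 - vbound n) * ((vbound n.+1 + vbound n) * rnorm x).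
  by rewrite ler_wpM2l // subr_ge0 vbound_leS.
have -> : vbound n.+2 - vbound n.+1 = (vbound n.+1 ^+ 2 - vbound n ^+ 2) / 2 :> R.
  by rewrite /=; field.
rewrite subr_sqr; lra.
Qed.

Lemma rnorm_visserB n m x : (n <= m)%N ->
  rnorm (visser m x - visser n x) <= (vbound m - vbound n) * rnorm x.
Proof.
elim: m => [|m IH]; first by rewrite leqn0 => /eqP ->; rewrite !subrr rnorm0 mul0r.
rewrite leq_eqVlt ltnS => /orP[/eqP ->|/IH le]; first by rewrite !subrr rnorm0 mul0r.
have := rnorm_tri (Y m x) (Y m.+1 x) (Y n x); have := rnormYS m x.
lra.
Qed.

Let rnormY1 n x : rnorm (Y n x) <= rnorm x.
Proof.
have := rnormY n x; have := mulr_ge0 (rnorm_ge0 x) (_ : 0 <= 1 - vbound n).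
by rewrite subr_ge0 vbound_le1 => /(_ isT); lra.
Qed.

Let rnormYB n m x : (n <= m)%N -> rnorm (Y m x - Y n x) <= (1 - vbound n) * rnorm x.
Proof.
move=> nm; apply: le_trans (rnorm_visserB _ nm) _.
by rewrite ler_wpM2r ?rnorm_ge0 // lerB // vbound_le1.
Qed.

(* As [visser n] converges to [I - |T - r|], this approximates [T (|T - r| + T - r)]. *)
Definition visser_poly n x := T (x - visser n x) + T (T x) - r%:C *: T x.

Lemma rnorm_visser_polyB n m x : (n <= m)%N ->
  rnorm (visser_poly m x - visser_poly n x) <= (1 - vbound n) * rnorm x.
Proof.
move=> nm; rewrite /visser_poly [X in rnorm X](_ : _ = T (visser n x - visser m x)).
  by apply: le_trans (rnormT _) _; rewrite rnormBC rnormYB.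
rewrite !(real_linearB _ _ linT).
by move: (T _) (T (visser m x)) (T (visser n x)) (T (T x)) => a b c d; rinner_ring.
Qed.

Let lim_ex x : exists l, forall n, rnorm (l - Y n x) <= (1 - vbound n) * rnorm x.
Proof.
by apply: rnorm_complete (vbound_cvg _) => n m; exact: rnormYB.
Qed.

Let L : H -> H := locked (fun x => sval (cid (lim_ex x))).

Let LY n x : rnorm (L x - Y n x) <= (1 - vbound n) * rnorm x.
Proof. by rewrite /L -lock; case: cid => l /=. Qed.

Let rnormL x : rnorm (L x) <= rnorm x.
Proof.
rewrite -subr_le0; apply: (@vbound_le0 _ _ (rnorm x)) => n.
have := rnormD (L x - Y n x) (Y n x); have := LY n x; have := rnormY1 n x.
rewrite subrK; lra.
Qed.

Let linL : real_linear L.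
Proof.
move=> k x y; apply/eqP; rewrite -subr_eq0; apply/eqP.
apply: (@vbound_null _ _ _ (rnorm (k%:C *: x + y) + (`|k| * rnorm x + rnorm y))) => n.
have -> : L (k%:C *: x + y) - (k%:C *: L x + L y) =
  (L (k%:C *: x + y) - Y n (k%:C *: x + y)) -
  (k%:C *: (L x - Y n x) + (L y - Y n y)).
  by rewrite linY; move: (L _) (L _) (L _) (Y _ _) (Y _ _) => a b c d e; rinner_ring.
apply: le_trans (rnormB _ _) _.
have := rnormD (k%:C *: (L x - Y n x)) (L y - Y n y).
have := LY n (k%:C *: x + y); have := LY n y.
have : `|k| * rnorm (L x - Y n x) <= `|k| * ((1 - vbound n) * rnorm x).
  by rewrite ler_wpM2l ?LY.
rewrite -rnormZr; lra.
Qed.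

Let symL : real_symmetric L.
Proof.
suff le x y : rinner (L x) y <= rinner x (L y).
  by move=> x y; apply/le_anti; rewrite le /= rinnerC (rinnerC (L x)) le.
rewrite -subr_le0; apply: (@vbound_le0 _ _ (2 * (rnorm x * rnorm y))) => n.
have -> : rinner (L x) y - rinner x (L y) =
    rinner (L x - Y n x) y + rinner x (- (L y - Y n y)).
  by rewrite rinnerDl rinnerNl rinnerNr rinnerDr rinnerNr symY; lra.
have := rinner_le (L x - Y n x) y; have := rinner_le x (- (L y - Y n y)).
rewrite rnormN.
have : rnorm x * rnorm (L y - Y n y) <= rnorm x * ((1 - vbound n) * rnorm y).
  by rewrite ler_wpM2l ?rnorm_ge0 ?LY.
have : rnorm (L x - Y n x) * rnorm y <= ((1 - vbound n) * rnorm x) * rnorm y.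
  by rewrite ler_wpM2r ?rnorm_ge0 ?LY.
lra.
Qed.

Let commL F : real_linear F -> (forall x, rnorm (F x) <= rnorm x) ->
  (forall x, F (Z x) = Z (F x)) -> forall x, F (L x) = L (F x).
Proof.
move=> lF bF FZ x; apply/eqP; rewrite -subr_eq0; apply/eqP.
apply: (@vbound_null _ _ _ (2 * rnorm x)) => n.
have -> : F (L x) - L (F x) = F (L x - Y n x) - (L (F x) - Y n (F x)).
  by rewrite real_linearB // commY // opprB addrA subrK.
have := rnormB (F (L x - Y n x)) (L (F x) - Y n (F x)).
have := LY n x; have := LY n (F x); have := bF (L x - Y n x).
have := bF x; have d0 : 0 <= 1 - vbound n :> R by rewrite subr_ge0 vbound_le1.
move=> Fx; have : (1 - vbound n) * rnorm (F x) <= (1 - vbound n) * rnorm x.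
  by rewrite ler_wpM2l.
lra.
Qed.

Let LE x : 2%:C *: L x = Z x + L (L x).
Proof.
apply/eqP; rewrite -subr_eq0; apply/eqP.
apply: (@vbound_null _ _ _ (2 * rnorm x + (rnorm (L x) + rnorm x))) => n.
have -> : 2%:C *: L x - (Z x + L (L x)) = 2%:C *: (L x - Y n.+1 x) -
    ((L (L x) - Y n (L x)) + Y n (L x - Y n x)).
  rewrite (real_linearB _ _ (linY n)) visserS.
  move: (L x) (L _) (Z x) (Y n _) (Y n _) => a b c d e.
  by apply: rinner_ext => z; rewrite !rinnerE; field.
have := rnormB (2%:C *: (L x - Y n.+1 x)) ((L (L x) - Y n (L x)) + Y n (L x - Y n x)).
have := rnormD (L (L x) - Y n (L x)) (Y n (L x - Y n x)).
have := LY n (L x); have := LY n.+1 x; have := rnormY1 n (L x - Y n x).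
have := LY n x; rewrite rnormZr ger0_norm //.
have := mulr_ge0 (_ : 0 <= vbound n.+1 - vbound n) (rnorm_ge0 x).
rewrite subr_ge0 vbound_leS => /(_ isT); lra.
Qed.

Let X : H -> H := locked (fun x => x - L x).

Let XE x : X x = x - L x. Proof. by rewrite /X -lock. Qed.

Let linX : real_linear X.
Proof.
move=> k x y; rewrite !XE linL; move: (L x) (L y) => a b; rinner_ring.
Qed.

Let symX : real_symmetric X.
Proof. by move=> x y; rewrite !XE rinnerDl rinnerNl rinnerDr rinnerNr symL. Qed.

Let posX x : 0 <= rinner (X x) x.
Proof.
rewrite XE rinnerDl rinnerNl rinner_sqr subr_ge0; apply: le_trans (rinner_le _ _) _.
by rewrite expr2 ler_wpM2r ?rnorm_ge0 ?rnormL.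
Qed.

Let commTX x : T (X x) = X (T x).
Proof. by rewrite !XE (real_linearB _ _ linT) commL. Qed.

Let commSX x : S (X x) = X (S x).
Proof. by rewrite !XE (real_linearB _ _ linS) commL. Qed.

Let XX x : X (X x) = S (S x).
Proof.
have := LE x; rewrite !XE gapE (real_linearB _ _ linL).
move: (L x) (L (L x)) (S (S x)) => a b c E.
apply: rinner_ext => z; have := congr1 (rinner ^~ z) E.
by rewrite /= !rinnerE; lra.
Qed.

Let rnorm_poly_lim n x :
  rnorm (visser_poly n x - T (X x + S x)) <= (1 - vbound n) * rnorm x.
Proof.
rewrite [X in rnorm X](_ : _ = T (L x - visser n x)).
  by apply: le_trans (rnormT _) (LY _ _).
have -> : T (X x + S x) = T (x - L x) + (T (T x) - r%:C *: T x).
  by rewrite (real_linearD _ _ linT) XE shiftE [T (T x - _)](real_linearB _ _ linT)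
    (real_linearZ _ _ linT).
rewrite /visser_poly !(real_linearB _ _ linT).
by move: (T _) (T (L x)) (T (visser n x)) (T (T x)) => a b c d; rinner_ring.
Qed.

(** Here S <= 0, and D = X + S must vanish. Since X^2 = S^2, (X - S) D = 0; thus X and S have the
    same form on the range of D, one nonnegative and the other nonpositive. Both forms vanish there,
    and [cube_eq0] applies to D. *)
Lemma visser_poly_small : (forall x, rnorm (T x) <= r * rnorm x) ->
  forall n x, rnorm (visser_poly n x) <= (1 - vbound n) * rnorm x.
Proof.
move=> Tr n x; suff D0 : X x + S x = 0.
  by have := rnorm_poly_lim n x; rewrite D0 real_linear0 // subr0.
pose D y := X y + S y.
have linD : real_linear D.
  by move=> k u v; rewrite /D linX linS; move: (X u) (X v) (S u) (S v) => *; rinner_ring.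
have symD : real_symmetric D by move=> u v; rewrite /D rinnerDl rinnerDr symX symS.
have posP y : rinner (S y) y <= 0.
  rewrite shiftE rinnerDl rinnerNl rinnerZl rinner_sqr subr_le0.
  apply: le_trans (rinner_le _ _) _; rewrite expr2 mulrA.
  by rewrite ler_wpM2r ?rnorm_ge0.
have DD y : rinner (D (D y)) (D y) = 0.
  have E : X (D y) - S (D y) = 0.
    rewrite /D (real_linearD _ _ linX) (real_linearD _ _ linS) XX commSX.
    by rewrite [X in X - _]addrC subrr.
  have := congr1 (rinner ^~ (D y)) E; rewrite /= rinnerDl rinnerNl rinner0l.
  have := posP (D y); have := posX (D y); rewrite {2}/D rinnerDl; lra.
exact: cube_eq0 linD symD DD x.
Qed.

(** In the limit T (X + S) = 0, so on the range of T the operator S equals -X and is nonpositive,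
    which gives T <= r there. Nothing is learnt off the range of T, whence a bound on [T (T x)] and
    not on [T x]. *)
Lemma visser_poly_small_conv :
  (forall n x, rnorm (visser_poly n x) <= (1 - vbound n) * rnorm x) ->
  forall x, rnorm (T (T x)) <= r * rnorm x.
Proof.
move=> small x; suff Tw w : (exists z, w = T z) -> rnorm (T w) <= r * rnorm w.
  apply: (@le_trans _ _ (r * rnorm (T x))); first by apply: Tw; exists x.
  by rewrite ler_wpM2l // ltW.
have p0 y : T (X y + S y) = 0.
  apply: (@vbound_null _ _ _ (2 * rnorm y)) => n.
  have := rnorm_poly_lim n y; have := small n y.
  have := rnormB (visser_poly n y) (visser_poly n y - T (X y + S y)).
  rewrite opprB addrC subrK; lra.
have Sw u : rinner (S (T u)) (T u) <= 0.
  have := p0 u; rewrite (real_linearD _ _ linT) commTX commTS => /eqP.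
  rewrite addr_eq0 => /eqP E; have := posX (T u); rewrite E rinnerNl; lra.
move=> [z ->] {w}; set w := T z.
pose P y := - S y.
have rP y : r%:C *: y = P y + T y by rewrite /P shiftE opprB subrK.
have TP y : T (P y) = P (T y) by rewrite /P (real_linearN _ linT) commTS.
have symP : real_symmetric P by move=> u v; rewrite /P rinnerNl rinnerNr symS.
have posTT y : 0 <= rinner (T y) y by apply: le_trans (posT y); exact: sqr_ge0.
(* Positivity of a product of commuting operators without square roots: r = P + T splits r <P w, T
   w> into <T (P w), P w> and <P (T w), T w>. *)
have q0 : 0 <= rinner (P w) (T w).
  rewrite -(pmulr_rge0 _ r_gt0) -rinnerZr rP rinnerDr.
  rewrite addr_ge0 //; first by rewrite -TP rinnerC posTT.
  by rewrite -symT TP /P rinnerNl oppr_ge0 Sw.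
have q1 : r * rinner (T w) w - rnorm (T w) ^+ 2 = rinner (P w) (T w).
  by rewrite /P rinnerNl shiftE rinnerDl rinnerNl rinnerZl rinner_sqr (rinnerC w); lra.
have q2 : rinner (T w) w <= r * rnorm w ^+ 2.
  by have := Sw z; rewrite shiftE rinnerDl rinnerNl rinnerZl rinner_sqr; lra.
rewrite -(@ler_pXn2r _ 2) ?nnegrE ?mulr_ge0 ?rnorm_ge0 ?(ltW r_gt0) // exprMn.
apply: (@le_trans _ _ (r * rinner (T w) w)); first by rewrite -subr_ge0 q1.
by rewrite expr2 -mulrA ler_wpM2l // ltW.
Qed.

End PositiveContraction.

(** * Neighbourhoods and compactness in spaces that need not be Hausdorff *)

Lemma open_nbhsP (T : topologicalType) (A : set T) :
  open A <-> forall x, A x -> exists U, [/\ open U, U x & U `<=` A].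
Proof.
split=> [oA x Ax|H]; first by exists A; split.
rewrite openE => x /H[U [oU Ux UA]]; rewrite /interior nbhsE.
by exists U.
Qed.

Lemma open_preimage (S T : topologicalType) (f : S -> T) (A : set T) :
  continuous f -> open A -> open (f @^-1` A).
Proof. by move=> /continuousP; apply. Qed.

Lemma nbhs_openP (T : topologicalType) (x : T) (P : set T) :
  nbhs x P <-> exists U, [/\ open U, U x & U `<=` P].
Proof.
rewrite nbhsE; split=> [[U [oU Ux] UP]|[U [oU Ux UP]]]; first by exists U.
by exists U.
Qed.

(** Separation is asked only between x and the points of K. If every neighbourhood of x met K, the
    traces on K would cluster at a point of K that cannot be separated from x. *)
Lemma compact_avoid (T : topologicalType) (K : set T) (x : T) : compact K ->
  (forall k, K k -> exists U V, [/\ open U, open V, U k, V x & U `&` V = set0]) ->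
  exists V, [/\ open V, V x & V `&` K = set0].
Proof.
move=> cK sep; apply: contrapT => H.
have meets N : nbhs x N -> N `&` K !=set0.
  move=> /nbhs_openP[V [oV Vx VN]]; apply/set0P/negP => /eqP NK.
  apply: H; exists V; split => //; apply/seteqP; split => // y [Vy Ky].
  by have : (N `&` K) y; [split => //; exact: VN|rewrite NK].
pose F := within K (nbhs x).
have PF : ProperFilter F.
  apply: Build_ProperFilter_ex => P FP; have [y [Py Ky]] := meets _ FP.
  by exists y; exact: Py.
have [|k [Kk ck]] := cK F PF.
  exact: withinT.
have [U [V [oU oV Uk Vx UV]]] := sep k Kk.
have [||y [Vy Uy]] := ck V U.
- have : nbhs x V by exact: open_nbhs_nbhs.
  by apply: filterS => y Vy _.
- exact: open_nbhs_nbhs.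
by have : (U `&` V) y by []; rewrite UV.
Qed.

(** * Etale groupoids *)

Section GroupoidAlgebra.
Context {G : topGroupoidType}.
Implicit Types (g h k : G) (U V W : set G).

Lemma unitsP g : units g <-> gsrc g = g.
Proof. by split=> [[h _ <-]|<-]; [exact: gsrc_src|exists g]. Qed.

Lemma units_src g : units (gsrc g). Proof. by exists g. Qed.

Lemma units_rng g : units (grng g). Proof. exact/unitsP/gsrc_rng. Qed.

Lemma src_unit g : units g -> gsrc g = g. Proof. by move/unitsP. Qed.

Lemma rng_unit g : units g -> grng g = g.
Proof. by move=> /unitsP <-; exact: grng_src. Qed.

Lemma ginv_unique g h : gsrc h = grng g -> gmul h g = gsrc g -> h = ginv g.
Proof.
move=> hg E; rewrite -[LHS]gmul_src hg -gmulgV gmulA //; last by rewrite grng_inv.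
by rewrite E -grng_inv gmul_rng.
Qed.

Lemma ginvK g : ginv (ginv g) = g.
Proof. by apply/esym/ginv_unique; rewrite ?grng_inv // gmulgV gsrc_inv. Qed.

Lemma ginv_rng_unit g : units g -> ginv g = g.
Proof.
move=> ug; apply/esym/ginv_unique; first by rewrite src_unit ?rng_unit.
by rewrite -{1}(rng_unit ug) gmul_rng src_unit.
Qed.

Lemma gmulKg g h : gsrc g = grng h -> gmul (ginv g) (gmul g h) = h.
Proof. by move=> gh; rewrite gmulA ?gsrc_inv // gmulVg gh gmul_rng. Qed.

Lemma gmulKVg g h : grng g = grng h -> gmul g (gmul (ginv g) h) = h.
Proof. by move=> gh; rewrite -{1}(ginvK g) gmulKg // gsrc_inv. Qed.

Lemma gmulgK g h : gsrc g = grng h -> gmul (gmul g h) (ginv h) = g.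
Proof. by move=> gh; rewrite -gmulA ?grng_inv // gmulgV -gh gmul_src. Qed.

Lemma gmulgKV g h : gsrc g = gsrc h -> gmul (gmul g (ginv h)) h = g.
Proof. by move=> gh; rewrite -{2}(ginvK h) gmulgK // grng_inv. Qed.

(** Multiplication is continuous within the composable pairs only, so the two factors must remain
    composable near [t]. *)
Lemma gmul_continuous_at (T : topologicalType) (a b : T -> G) t :
  {for t, continuous a} -> {for t, continuous b} ->
  (\forall s \near t, gsrc (a s) = grng (b s)) ->
  {for t, continuous (fun s => gmul (a s) (b s))}.
Proof.
move=> ca cb ab; have := @gmul_continuous G.
move=> /subspace_continuousP /(_ (a t, b t)) /= H.
have abt : gsrc (a t) = grng (b t) by exact: (nbhs_singleton ab).
apply: cvg_trans (H abt) => P [[A B] [/= nA nB] AB] /=.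
have := ca A nA; have := cb B nB => nbB naA.
change (nbhs t [set s | P (gmul (a s) (b s))]).
have nbB' : nbhs t [set s | B (b s)] := nbB.
have naA' : nbhs t [set s | A (a s)] := naA.
apply: filterS3 nbB' naA' ab => s Bs As abs.
exact: (AB (a s, b s)).
Qed.

Lemma src_continuous : continuous (@gsrc G).
Proof.
move=> g; rewrite (_ : @gsrc G = fun h => gmul (ginv h) h); last first.
  by apply/funext => h; rewrite gmulVg.
apply: gmul_continuous_at; [exact: ginv_continuous|exact: cvg_id|].
by apply: nearW => h; rewrite gsrc_inv.
Qed.

Lemma rng_continuous : continuous (@grng G).
Proof.
move=> g; rewrite (_ : @grng G = fun h => gmul h (ginv h)); last first.
  by apply/funext => h; rewrite gmulgV.
apply: gmul_continuous_at; [exact: cvg_id|exact: ginv_continuous|].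
by apply: nearW => h; rewrite grng_inv.
Qed.

Definition inj_on (f : G -> G) U := forall g h, U g -> U h -> f g = f h -> g = h.

Lemma homeo_inj f U : homeo_onto_open f U -> inj_on f U.
Proof. by move=> [_ [k [_ kK _]]] g h Ug Uh E; rewrite -(kK g) // E kK. Qed.

Definition gsec (f : G -> G) U (x : G) : G := xget x [set g | U g /\ f g = x].

Lemma gsecK f U g : inj_on f U -> U g -> gsec f U (f g) = g.
Proof.
by move=> fU Ug; rewrite /gsec; case: xgetP => [h -> [Uh /fU ->] //|/(_ g)[]].
Qed.

Definition gprod U V := [set gmul p.1 p.2 | p in [set p : G * G |
  [/\ U p.1, V p.2 & gsrc p.1 = grng p.2]]].

End GroupoidAlgebra.

Section EtaleGroupoid.
Context {G : topGroupoidType} (het : etale G).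
Implicit Types (g h k : G) (U V W : set G).

Let basisP (P : set G) g : open P -> P g -> exists U, [/\ open_bisection U, U g & U `<=` P].
Proof.
move=> oP Pg; have [_ /(_ g P)] := het.
by case=> [|U [bU Ug] UP]; [exact: open_nbhs_nbhs|exists U].
Qed.

(** If a bisection contains both g and s(g), injectivity of s on it gives g = s(g); such g fill a
    neighbourhood of each unit. *)
Lemma units_open : open (@units G).
Proof.
apply/open_nbhsP => u uu; have [U [bU Uu _]] := basisP openT (I : [set: G] u).
have [oU _ /homeo_inj sU] := bU.
exists (U `&` @gsrc G @^-1` U); split.
- by apply: openI => //; apply: open_preimage oU; exact: src_continuous.
- by split => //=; rewrite src_unit.
- by move=> g [Ug Us]; apply/unitsP/sU => //; exact: gsrc_src.
Qed.

Definition etale_map (f : G -> G) : Prop :=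
  [/\ continuous f, forall g, units (f g) & forall U, open U -> open (f @` U)].

Let open_image (f : G -> G) : (forall U, open_bisection U -> homeo_onto_open f U) ->
  forall U, open U -> open (f @` U).
Proof.
move=> hf U oU; apply/open_nbhsP => _ [g Ug <-].
have [V [bV Vg VU]] := basisP oU Ug.
have [_ [k [_ kK [P oP fV]]]] := hf _ bV.
exists (f @` V); split; [|by exists g|by apply: image_subset].
by rewrite fV; apply: openI => //; exact: units_open.
Qed.

Lemma src_etale : etale_map (@gsrc G).
Proof.
split; [exact: src_continuous|exact: units_src|].
by apply: open_image => U [].
Qed.

Lemma rng_etale : etale_map (@grng G).
Proof.
split; [exact: rng_continuous|exact: units_rng|].
by apply: open_image => U [].
Qed.

Lemma gsec_continuous f U g : etale_map f -> open U -> inj_on f U -> U g ->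
  {for f g, continuous (gsec f U)}.
Proof.
move=> [_ _ fo] oU fU Ug P; rewrite gsecK // => /nbhs_openP[V [oV Vg VP]].
apply/nbhs_openP; exists (f @` (U `&` V)); split; first exact/fo/openI.
  by exists g.
by move=> _ [h [Uh Vh] <-] /=; rewrite gsecK //; exact: VP.
Qed.

(** As r and s are continuous and open, injectivity alone makes them homeomorphisms onto open
    images, with inverse [gsec]. *)
Lemma open_bisectionP U : open_bisection U <->
  [/\ open U, inj_on (@grng G) U & inj_on (@gsrc G) U].
Proof.
split=> [[oU /homeo_inj ? /homeo_inj ?] //|[oU rU sU]].
have homeo f : etale_map f -> inj_on f U -> homeo_onto_open f U.
  move=> ef fU; have [cf uf fo] := ef; split; first exact: continuous_subspaceT.
  exists (gsec f U); split.
  - apply/subspace_continuousP => _ [g Ug <-].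
    by apply: cvg_within_filter; exact: gsec_continuous.
  - by move=> g Ug; exact: gsecK.
  - exists (f @` U); first exact: fo.
    by apply/seteqP; split => [x [g Ug <-]|x []//]; split; [exists g|].
by split => //; apply: homeo => //; [exact: rng_etale|exact: src_etale].
Qed.

Lemma bis_open U : open_bisection U -> open U. Proof. by move/open_bisectionP=> []. Qed.
Lemma bis_rinj U : open_bisection U -> inj_on (@grng G) U.
Proof. by move/open_bisectionP=> []. Qed.
Lemma bis_sinj U : open_bisection U -> inj_on (@gsrc G) U.
Proof. by move/open_bisectionP=> []. Qed.

Lemma bis_sub U V : open_bisection U -> open V -> V `<=` U -> open_bisection V.
Proof.
move=> /open_bisectionP[oU rU sU] oV VU; apply/open_bisectionP; split => //.
  by move=> g h /VU Ug /VU Uh; exact: rU.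
by move=> g h /VU Ug /VU Uh; exact: sU.
Qed.

Lemma bis_units : open_bisection (@units G).
Proof.
apply/open_bisectionP; split; first exact: units_open.
  by move=> g h ug uh; rewrite !rng_unit.
by move=> g h ug uh; rewrite !src_unit.
Qed.

Lemma bis_inv U : open_bisection U -> open_bisection (@ginv G @^-1` U).
Proof.
move=> bU; apply/open_bisectionP; split.
- by apply: open_preimage (bis_open bU); exact: ginv_continuous.
- move=> g h /= Ug Uh E; rewrite -(ginvK g) -(ginvK h); congr ginv.
  by apply: (bis_sinj bU) => //; rewrite !gsrc_inv.
- move=> g h /= Ug Uh E; rewrite -(ginvK g) -(ginvK h); congr ginv.
  by apply: (bis_rinj bU) => //; rewrite !grng_inv.
Qed.

(** For openness at ab: the arrow [s g] of U with the same range as g varies continuously with g, so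
    s(g)^-1 g stays in V near ab. *)
Lemma bis_prod U V : open_bisection U -> open_bisection V -> open_bisection (gprod U V).
Proof.
move=> bU bV; apply/open_bisectionP; split; last 2 first.
- move=> _ _ [[a b] [/= Ua Vb ab] <-] [[c d] [/= Uc Vd cd] <-].
  rewrite !grng_mul // => ac; have {}ac := bis_rinj bU Ua Uc ac; congr gmul => //.
  by apply: (bis_rinj bV) => //; rewrite -ab -cd ac.
- move=> _ _ [[a b] [/= Ua Vb ab] <-] [[c d] [/= Uc Vd cd] <-].
  rewrite !gsrc_mul // => bd; have {}bd := bis_sinj bV Vb Vd bd; congr gmul => //.
  by apply: (bis_sinj bU) => //; rewrite ab cd bd.
rewrite openE => _ [[a b] [/= Ua Vb ab] <-].
pose s g := gsec (@grng G) U (grng g).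
have nU : \forall g \near gmul a b, (@grng G @` U) (grng g).
  apply: rng_continuous; apply: open_nbhs_nbhs; split.
    by have [_ _] := rng_etale; apply; exact: bis_open.
  by rewrite grng_mul //; exists a.
have sE : s (gmul a b) = a by rewrite /s grng_mul // gsecK //; exact: bis_rinj.
have cs : {for gmul a b, continuous s}.
  apply: continuous_comp; first exact: rng_continuous.
  rewrite grng_mul //; apply: gsec_continuous => //.
  - exact: rng_etale.
  - exact: bis_open.
  - exact: bis_rinj.
have rs : \forall g \near gmul a b, U (s g) /\ grng (s g) = grng g.
  by apply: filterS nU => g [h Uh hg]; rewrite /s -hg gsecK //; exact: bis_rinj.
have cb : {for gmul a b, continuous (fun g => gmul (ginv (s g)) g)}.
  apply: gmul_continuous_at; last 2 first.
  - exact: cvg_id.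
  - by apply: filterS rs => g [_]; rewrite gsrc_inv.
  by apply: continuous_comp; [exact: cs|exact: ginv_continuous].
have nV : \forall g \near gmul a b, V (gmul (ginv (s g)) g).
  apply: cb; rewrite sE gmulKg //; apply: open_nbhs_nbhs; split => //.
  exact: bis_open.
rewrite /interior; near=> g.
have [Us rsg] : U (s g) /\ grng (s g) = grng g by near: g.
exists (s g, gmul (ginv (s g)) g) => /=; last by rewrite gmulKVg.
split => //; first by near: g.
by rewrite grng_mul ?gsrc_inv // grng_inv.
Unshelve. all: by end_near. Qed.

End EtaleGroupoid.

(** * Consequences of a Hausdorff unit space *)

Section UnitSpace.
Context {G : topGroupoidType} (het : etale G)
  (hT2 : hausdorff_space (set_type (@units G))).
Implicit Types (g h k : G) (U V W K : set G).

Lemma unit_sep g h : units g -> units h -> g <> h ->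
  exists U V, [/\ open U, open V, U g, V h & U `&` V = set0].
Proof.
move=> ug uh gh; move: hT2; rewrite open_hausdorff.
pose x : set_type (@units G) := SigSub (mem_set ug).
pose y : set_type (@units G) := SigSub (mem_set uh).
have xy : x != y by apply/eqP => /(congr1 val).
move=> /(_ x y xy) [[A B] [/= /set_mem Ax /set_mem By] [[A' oA' EA] [B' oB' EB] AB]].
exists (A' `&` @units G), (B' `&` @units G); split.
- by apply: openI => //; exact: units_open.
- by apply: openI => //; exact: units_open.
- by split => //; have : (set_val @^-1` A') x by rewrite EA.
- by split => //; have : (set_val @^-1` B') y by rewrite EB.
apply/seteqP; split => // z [[A'z uz] [B'z _]].
pose z' : set_type (@units G) := SigSub (mem_set uz).
have : (A `&` B) z' by rewrite -EA -EB.
by rewrite (eqP AB).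
Qed.

(** Distinct arrows of one bisection have distinct sources, which are separated in the unit space.
    No such separation is available between arrows of different bisections. *)
Lemma bis_sep U g h : open_bisection U -> U g -> U h -> g <> h ->
  exists V W, [/\ open V, open W, V g, W h & V `&` W = set0].
Proof.
move=> bU Ug Uh gh.
have [||E|V [W [oV oW Vg Wh VW]]] := @unit_sep (gsrc g) (gsrc h).
- exact: units_src.
- exact: units_src.
- by apply: gh; exact: (bis_sinj het bU).
exists (@gsrc G @^-1` V), (@gsrc G @^-1` W); split => //.
- by apply: open_preimage oV; exact: src_continuous.
- by apply: open_preimage oW; exact: src_continuous.
- by rewrite -preimage_setI VW preimage_set0.
Qed.

Lemma bis_compact_avoid U K g : open_bisection U -> compact K -> K `<=` U ->
  U g -> ~ K g -> exists V, [/\ open V, V g & V `&` K = set0].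
Proof.
move=> bU cK KU Ug nKg; apply: compact_avoid => // k Kk.
have [|V [W [oV oW Vk Wg VW]]] := bis_sep bU (KU _ Kk) Ug.
  by move=> kg; apply: nKg; rewrite -kg.
by exists V, W.
Qed.

Lemma composable_closed : closed [set p : G * G | gsrc p.1 = grng p.2].
Proof.
rewrite -openC openE => -[g h] /= gh.
have [V [W [oV oW Vg Wh VW]]] := unit_sep (units_src g) (units_rng h) gh.
exists (@gsrc G @^-1` V, @grng G @^-1` W) => /=.
  split; apply: open_nbhs_nbhs; split => //.
    by apply: open_preimage oV; exact: src_continuous.
  by apply: open_preimage oW; exact: rng_continuous.
move=> [a b] [/= Va Wb] ab; have : (V `&` W) (gsrc a) by split => //; rewrite ab.
by rewrite VW.
Qed.

Lemma compact_closedI (T : topologicalType) (C D : set T) :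
  compact C -> closed D -> compact (C `&` D).
Proof.
move=> cC cD F PF FCD; have [|x [Cx Fx]] := cC F PF.
  by apply: filterS FCD => y [].
exists x; split => //; split => //; apply: cD => N nN.
by have [y [[_ Dy] Ny]] := Fx _ _ FCD nN; exists y.
Qed.

Lemma compact_gprod U V : compact U -> compact V -> compact (gprod U V).
Proof.
move=> cU cV; pose C := [set p : G * G | gsrc p.1 = grng p.2].
have -> : gprod U V = (fun p => gmul p.1 p.2) @` (U `*` V `&` C).
  by apply/seteqP; split => x [p] => [[? ? ?]|[[? ?] ?]] <-; exists p.
apply: continuous_compact.
  by apply: continuous_subspaceW (@gmul_continuous G); move=> p [].
by apply: compact_closedI; [exact: compact_setX|exact: composable_closed].
Qed.

End UnitSpace.

(** * Bump functions on the unit space *)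

Section Bump.
Context {R : realType} {G : topGroupoidType} (het : etale G)
  (hT2 : hausdorff_space (set_type (@units G))) (hlc : loc_compact G).
Implicit Types (g h k : G) (U V W K : set G).

Let X := set_type (@units G).

Let nbhs_val (x : X) (P : set X) :
  nbhs x P <-> nbhs (val x) [set g | forall y : X, val y = g -> P y].
Proof.
split=> [/nbhs_openP[U [[V oV <-] /= Vx UP]]|/nbhs_openP[V [oV Vx VP]]].
  apply/nbhs_openP; exists V; split => // g Vg y yg; apply: UP => /=.
  by rewrite set_valE /= yg.
apply/nbhs_openP; exists (set_val @^-1` V); split => //; first by exists V.
by move=> y Vy; exact: (VP (val y)).
Qed.

Let compact_val K : compact K -> K `<=` @units G -> compact (set_val @^-1` K : set X).
Proof.
move=> cK Ku F PF FK.
have PF' : ProperFilter (set_val @ F) by exact: fmap_proper_filter.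
have [|p [Kp cp]] := cK (set_val @ F) PF'.
  exact: FK.
exists (SigSub (mem_set (Ku _ Kp))); split => // A B FA nB.
move: nB => /nbhs_val /= nB.
have [|g [[y Ay <-] /= By]] := cp (set_val @` A) _ _ nB.
  have FA' : F [set y | (set_val @` A) (set_val y)] by apply: filterS FA => y Ay; exists y.
  exact: FA'.
by exists y; split => //; exact: By.
Qed.

Let X_locally_compact : locally_compact [set: X].
Proof.
move=> x _; rewrite withinET.
have [K [nK Ku cK]] : exists K, [/\ nbhs (val x) K, K `<=` @units G & compact K].
  apply: hlc; apply: open_nbhs_nbhs; split; first exact: units_open.
  exact: (set_mem (valP x)).
have cK' := compact_val cK Ku.
exists (set_val @^-1` K).
  by apply/nbhs_val; apply: filterS nK => g Kg y yg; rewrite /= set_valE /= yg.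
split => //; exact: compact_closed.
Qed.

(** Complete regularity of the unit space separates u from the complement of a compact neighbourhood
    K inside W. The units need not be closed in G, so the extension by 0 is claimed to be continuous
    at units only. *)
Lemma bump_unit W u : open W -> W `<=` @units G -> W u -> exists phi : G -> R,
  [/\ phi u = 1, forall g, 0 <= phi g <= 1,
      forall g, units g -> {for g, continuous phi} &
      exists K, [/\ compact K, K `<=` W & forall g, ~ K g -> phi g = 0]].
Proof.
move=> oW Wu Wuu; have uu := Wu _ Wuu.
have [K [nK KW cK]] := hlc (open_nbhs_nbhs (conj oW Wuu)).
pose x : X := SigSub (mem_set uu).
pose B : set X := ~` interior (set_val @^-1` K).
have cB : closed B by apply: open_closedC; exact: open_interior.
have nBx : ~ B x.
  move=> /=; apply; apply/nbhs_val.
  by apply: filterS nK => g Kg y yg; rewrite /= set_valE /= yg.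
have /uniform_separatorP :=
  @locally_compact_completely_regular X R X_locally_compact hT2 x B cB nBx.
move=> /(_ R) [f [cf f01 fx fB]].
have f1 (y : X) : ~ K (val y) -> f y = 1.
  move=> nKy; apply: fB; exists y => //= /interior_subset; exact.
pose phi g := if pselect (units g) is left ug then 1 - f (SigSub (mem_set ug)) else 0.
have phiE (y : X) : phi (val y) = 1 - f y.
  rewrite /phi; case: pselect => [uy|]; last by case; exact: (set_mem (valP y)).
  by congr (1 - f _); exact: val_inj.
exists phi; split.
- have -> : u = val x by [].
  by rewrite phiE [f x]fx ?subr0 //; exists x.
- move=> g; rewrite /phi; case: pselect => [ug|_]; last by rewrite lexx ler01.
  set y := SigSub _; have /f01 /= : range f (f y) by exists y.
  by rewrite in_itv /= => /andP[f0 f1y]; rewrite subr_ge0 f1y gerBl.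
- move=> g ug; apply/cvgrPdist_lt => e e0.
  pose y : X := SigSub (mem_set ug).
  have -> : g = val y by []. rewrite phiE.
  have /cvgrPdist_lt/(_ e e0)/nbhs_val := cf y.
  have : nbhs (val y) (@units G) by apply: open_nbhs_nbhs; split => //; exact: units_open.
  apply: filterS2 => h uh H /=.
  have -> : h = val (SigSub (mem_set uh) : X) by [].
  rewrite phiE; have -> : 1 - f y - (1 - f (SigSub (mem_set uh) : X)) =
     - (f y - f (SigSub (mem_set uh) : X)) by ring.
  by rewrite normrN; apply: (H (SigSub (mem_set uh))).
- exists K; split => // g nKg; rewrite /phi; case: pselect => // ug.
  by rewrite f1 ?subrr.
Qed.

End Bump.

(** * Baire category on the unit space *)

Section BaireUnits.
Context {G : topGroupoidType} (het : etale G)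
  (hT2 : hausdorff_space (set_type (@units G))) (hlc : loc_compact G).
Implicit Types (g h k : G) (U V W K : set G).

Definition nowhere_dense_units (N : set G) := forall W, open W -> W `<=` @units G ->
  W !=set0 -> exists V, [/\ open V, V !=set0, V `<=` W & V `&` N = set0].

(** A pair in [P] is an open set inside a compact one. Each step picks, inside the open set of the
    previous pair, a compact neighbourhood missing [N n]; compactness of the first gives a cluster
    point. *)
Lemma baire_units (N : nat -> set G) W : (forall n, nowhere_dense_units (N n)) ->
  open W -> W `<=` @units G -> W !=set0 -> exists2 u, W u & forall n, ~ N n u.
Proof.
move=> nwd oW Wu W0.
pose P (p : set G * set G) := [/\ open p.1, p.1 !=set0, p.1 `<=` p.2, p.2 `<=` W & compact p.2].
have step n V : open V -> V !=set0 -> V `<=` W ->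
    exists p, [/\ P p, p.2 `<=` V & p.2 `&` N n = set0].
  move=> oV V0 VW; have [V' [oV' [x V'x] V'V V'N]] := nwd n V oV (subset_trans VW Wu) V0.
  have [K [nK KV' cK]] := hlc (open_nbhs_nbhs (conj oV' V'x)).
  exists (interior K, K); split => /=; last 2 first.
  - exact: subset_trans V'V.
  - by apply/seteqP; split => // y [Ky Ny]; rewrite -V'N; split => //; exact: KV'.
  split => /=; [exact: open_interior|by exists x|exact: interior_subset| |exact: cK].
  by apply: subset_trans VW; exact: subset_trans V'V.
pose T := {p | P p}.
have next n (t : T) : {t' : T | (sval t').2 `<=` (sval t).1 /\ (sval t').2 `&` N n = set0}.
  apply: cid; case: t => -[V K] [/= oV V0 VK KW cK].
  have [p [Pp pV pN]] := step n V oV V0 (subset_trans VK KW).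
  by exists (exist _ p Pp).
have [p0 [Pp0 _ p0N]] := step 0%N W oW W0 (@subset_refl _ _).
pose s := fix s n : T := if n is m.+1 then sval (next m.+1 (s m)) else exist _ p0 Pp0.
have sN n : (sval (s n)).2 `&` N n = set0 by case: n => //= n; case: (next _ _) => ? [].
have sS n : (sval (s n.+1)).2 `<=` (sval (s n)).1 by rewrite /=; case: (next _ _) => ? [].
have sP n : P (sval (s n)) by exact: (svalP (s n)).
have s12 n : (sval (s n)).1 `<=` (sval (s n)).2 by have [] := sP n.
have sle n m : (n <= m)%N -> (sval (s m)).2 `<=` (sval (s n)).2.
  elim: m => [|m IH]; first by rewrite leqn0 => /eqP ->.
  rewrite leq_eqVlt ltnS => /orP[/eqP -> //|/IH H].
  by apply: subset_trans H; apply: subset_trans (s12 m); exact: sS.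
pose F : set_system G := [set A | exists n, (sval (s n)).2 `<=` A].
have FF : ProperFilter F.
  apply: Build_ProperFilter_ex.
    move=> A [n nA]; have [_ [x Vx] VK _ _] := sP n.
    by exists x; apply/nA/VK.
  split; first by exists 0%N.
  - move=> A B [n nA] [m mB]; exists (maxn n m) => x sx; split.
      by apply: nA; apply: sle sx; exact: leq_maxl.
    by apply: mB; apply: sle sx; exact: leq_maxr.
  - by move=> A B AB [n nA]; exists n; exact: subset_trans AB.
have [_ _ _ KW0 cK0] := sP 0%N.
have [|x [Kx Fx]] := cK0 F FF; first by exists 0%N.
(* The compact sets are closed relative to the Hausdorff unit space, so the cluster point lies in
   all of them. *)
have xK n : (sval (s n)).2 x.
  apply: contrapT => nK; have [_ _ _ KW cK] := sP n.
  have [|V [oV Vx VK]] := bis_compact_avoid het hT2 (bis_units het) cK (subset_trans KW Wu) _ nK.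
    exact/Wu/KW0.
  have [||y [Ky Vy]] := Fx (sval (s n)).2 V; first by exists n.
    exact: open_nbhs_nbhs.
  by have : (V `&` (sval (s n)).2) y by []; rewrite VK.
exists x; first exact: KW0.
by move=> n Nx; have : ((sval (s n)).2 `&` N n) x by []; rewrite sN.
Qed.

End BaireUnits.

(** * The convolution algebra *)

Section ComplexContinuity.
Context {R : realType}.

Definition contC (T : topologicalType) (f : T -> R[i]) (x : T) : Prop :=
  {for x, continuous (f : T -> R[i]^o)}.

Lemma contC_rnorm (T : topologicalType) (f : T -> R[i]) x : contC f x <->
  forall e : R, 0 < e -> \forall y \near x, rnorm (f x - f y) < e.
Proof. exact: (@continuous_rnorm R T R[i]^o f x). Qed.

Lemma contC_cst (T : topologicalType) (c : R[i]) (x : T) : contC (fun _ => c) x.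
Proof. exact: cvg_cst. Qed.

Lemma contCD (T : topologicalType) (f h : T -> R[i]) x :
  contC f x -> contC h x -> contC (fun y => f y + h y) x.
Proof. by move=> cf ch; exact: (@cvgD _ R[i]^o _ _ _ _ _ _ _ cf ch). Qed.

Lemma contCM (T : topologicalType) (f h : T -> R[i]) x :
  contC f x -> contC h x -> contC (fun y => f y * h y) x.
Proof. by move=> cf ch; exact: (@cvgM R[i] _ _ _ _ _ _ _ cf ch). Qed.

Lemma contCV (T : topologicalType) (f : T -> R[i]) x : f x != 0 ->
  contC f x -> contC (fun y => (f y)^-1) x.
Proof. by move=> f0 cf; exact: (@cvgV R[i] _ _ _ _ _ f0 cf). Qed.

Lemma contC_conj (T : topologicalType) (f : T -> R[i]) x :
  contC f x -> contC (fun y => conjc (f y)) x.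
Proof.
move=> /contC_rnorm cf; apply/contC_rnorm => e e0; apply: filterS (cf e e0) => y.
by rewrite -rmorphB rnorm_conj.
Qed.

Lemma contC_comp (S T : topologicalType) (a : S -> T) (f : T -> R[i]) x :
  {for x, continuous a} -> contC f (a x) -> contC (fun y => f (a y)) x.
Proof. by move=> ca cf; exact: (@continuous_comp _ _ R[i]^o a f x ca cf). Qed.

Lemma contC_real (T : topologicalType) (f : T -> R) x :
  {for x, continuous f} -> contC (fun y => (f y)%:C) x.
Proof.
move=> cf; apply/contC_rnorm => e e0.
have /cvgrPdist_lt/(_ e e0) := cf; apply: filterS => y.
by rewrite -rmorphB rnorm_real.
Qed.

Lemma contC_near (T : topologicalType) (f h : T -> R[i]) x :
  (\forall y \near x, f y = h y) -> contC f x -> contC h x.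
Proof.
move=> fh /contC_rnorm cf; apply/contC_rnorm => e e0.
have fhx := nbhs_singleton fh; apply: filterS2 fh (cf e e0) => y <-.
by rewrite fhx.
Qed.

End ComplexContinuity.

(** * Sums over the fibres of the range map *)

Section FiberSums.
Context {R : realType} {G : topGroupoidType}.
Implicit Types (f h k : G -> R[i]) (g x y : G).

Lemma fsum_sub (T : choiceType) (V : nmodType) (A S : set T) (F : T -> V) :
  S `<=` A -> (forall i, A i -> ~ S i -> F i = 0) ->
  \sum_(i \in A) F i = \sum_(i \in S) F i.
Proof. by move=> SA AS; apply/esym/fsbig_widen => // i [Ai nSi]; exact: AS. Qed.

Lemma fun_linE c f h g : (c *: f + h) g = c * f g + h g. Proof. by []. Qed.

(** Convolution and the augmentation representation are both of this form, so their linearity and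
    their values on bisections are obtained together. *)
Definition fiber_sum f k y : R[i] :=
  \sum_(g \in [set g | grng g = y]) f g * k g.

Definition rng_finite f := forall y, finite_set [set g | grng g = y /\ f g <> 0].

Lemma rng_finiteP c f h : rng_finite f -> rng_finite h -> rng_finite (c *: f + h).
Proof.
move=> ff fh y; apply: sub_finite_set (_ : finite_set
  ([set g | grng g = y /\ f g <> 0] `|` [set g | grng g = y /\ h g <> 0])).
  move=> g [/= gy]; have [f0|/eqP f0] := eqVneq (f g) 0; last by left.
  move=> fh0; right; split => // h0; apply: fh0.
  by rewrite fun_linE f0 h0 mulr0 addr0.
by rewrite finite_setU.
Qed.

Lemma fiber_sumPl c f h k y : rng_finite f -> rng_finite h ->
  fiber_sum (c *: f + h) k y = c * fiber_sum f k y + fiber_sum h k y.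
Proof.
move=> ff fh; pose S := [set g | grng g = y /\ f g <> 0] `|` [set g | grng g = y /\ h g <> 0].
have fS : finite_set S by rewrite finite_setU.
have E u : (forall g, grng g = y -> ~ S g -> u g = 0) ->
    fiber_sum u k y = \sum_(g \in S) u g * k g.
  move=> u0; apply: fsum_sub => [g [[]|[]]//|g gy nS].
  by rewrite u0 ?mul0r.
have fS0 g : grng g = y -> ~ S g -> f g = 0.
  by move=> gy nS; apply: contrapT => f0; apply: nS; left.
have hS0 g : grng g = y -> ~ S g -> h g = 0.
  by move=> gy nS; apply: contrapT => h0; apply: nS; right.
rewrite !E //; last first.
  by move=> g gy nS; rewrite fun_linE fS0 // hS0 // mulr0 addr0.
rewrite mulr_fsumr -fsbig_split //=; apply: eq_fsbigr => g _.
by rewrite fun_linE mulrA -mulrDl.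
Qed.

Lemma fiber_sumPr c f h k y : rng_finite f ->
  fiber_sum f (c *: h + k) y = c * fiber_sum f h y + fiber_sum f k y.
Proof.
move=> ff; pose S := [set g | grng g = y /\ f g <> 0].
have E u : fiber_sum f u y = \sum_(g \in S) f g * u g.
  apply: fsum_sub => [g []//|g gy nS].
  have -> : f g = 0 by apply: contrapT => f0; apply: nS.
  by rewrite mul0r.
rewrite !E mulr_fsumr -fsbig_split //=; last exact: ff.
apply: eq_fsbigr => g _.
by rewrite fun_linE mulrDr mulrCA.
Qed.

Lemma fiber_sum_bis (U : set G) f k g y : inj_on (@grng G) U -> (forall x, ~ U x -> f x = 0) ->
  U g -> grng g = y -> fiber_sum f k y = f g * k g.
Proof.
move=> rU fU Ug gy; rewrite /fiber_sum (fsum_sub (S := [set g])) ?fsbig_set1 //.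
  by move=> _ ->.
move=> h hy nhg; rewrite fU ?mul0r // => Uh; apply: nhg => /=.
by apply: rU => //; rewrite hy.
Qed.

Lemma fiber_sum0 (U : set G) f k y : (forall x, ~ U x -> f x = 0) ->
  (forall g, U g -> grng g <> y) -> fiber_sum f k y = 0.
Proof.
move=> fU Uy; rewrite /fiber_sum fsbig1 // => g gy.
by rewrite fU ?mul0r // => Ug; apply: (Uy g).
Qed.

Lemma convE f h g : conv f h g = fiber_sum f (fun e => h (gmul (ginv e) g)) (grng g).
Proof. by []. Qed.

End FiberSums.

Section ConvAlg.
Context {R : realType} {G : topGroupoidType} (het : etale G)
  (hT2 : hausdorff_space (set_type (@units G))) (hlc : loc_compact G).
Implicit Types (f h k : G -> R[i]) (g x y : G) (U V W K : set G).

Lemma CcP U f : open U -> Cc U f <-> (forall x, U x -> contC f x) /\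
  exists K, [/\ compact K, K `<=` U & forall g, ~ K g -> f g = 0].
Proof.
move=> oU; rewrite /Cc continuous_open_subspace //; split=> -[cf K]; split => // x.
  by move=> Ux; apply: cf; rewrite inE.
by rewrite inE; exact: cf.
Qed.

Lemma Cc_off U f g : Cc U f -> ~ U g -> f g = 0.
Proof. by move=> [_ [K [_ KU K0]]] nU; apply: K0 => /KU. Qed.

(** Only continuity at points of V outside U is in question: the compact support is closed relative
    to V, so [f] vanishes near them. *)
Lemma Cc_sub U V f : open U -> open_bisection V -> U `<=` V -> Cc U f -> Cc V f.
Proof.
move=> oU bV UV /(CcP _ oU)[cf [K [cK KU K0]]]; apply/(CcP _ (bis_open het bV)); split.
  move=> x Vx; have [Ux|nUx] := pselect (U x); first exact: cf.
  have [N [oN Nx NK]] := bis_compact_avoid het hT2 bV cK (subset_trans KU UV) Vx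
    (fun Kx => nUx (KU _ Kx)).
  apply: contC_near (@contC_cst R G 0 x).
  have : nbhs x N by exact: open_nbhs_nbhs.
  apply: filterS => y Ny; rewrite K0 // => Ky.
  by have : (N `&` K) y by []; rewrite NK.
by exists K; split => //; exact: subset_trans UV.
Qed.

Lemma convAlg_Cc U f : open_bisection U -> Cc U f -> convAlg f.
Proof.
move=> bU cf; exists 1%N, (fun _ => 1), (fun _ => f); split; first by exists U.
by rewrite big_ord1 scale1r.
Qed.

Lemma convAlg0 : convAlg (0 : G -> R[i]).
Proof.
exists 0%N, (fun _ => 0), (fun _ => 0); split; first by case.
by rewrite big_ord0.
Qed.

Lemma convAlgD f h : convAlg f -> convAlg h -> convAlg (f + h).
Proof.
move=> [n [c [s [sP ->]]]] [m [d [t [tP ->]]]].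
exists (n + m)%N, (fun i => match fintype.split i with inl j => c j | inr j => d j end),
  (fun i => match fintype.split i with inl j => s j | inr j => t j end); split.
  by move=> i; case: (fintype.split i).
rewrite big_split_ord /=; congr (_ + _); apply: eq_bigr => i _.
  by have := @unsplitK n m (inl i); rewrite /unsplit => ->.
by have := @unsplitK n m (inr i); rewrite /unsplit => ->.
Qed.

Lemma convAlgZ c f : convAlg f -> convAlg (c *: f).
Proof.
move=> [n [d [s [sP ->]]]]; exists n, (fun i => c * d i), s; split => //.
by rewrite scaler_sumr; apply: eq_bigr => i _; rewrite scalerA.
Qed.

Lemma convAlgP c f h : convAlg f -> convAlg h -> convAlg (c *: f + h).
Proof. by move=> cf ch; apply: convAlgD => //; exact: convAlgZ. Qed.

Lemma convAlgB f h : convAlg f -> convAlg h -> convAlg (f - h).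
Proof.
by move=> cf ch; rewrite addrC -scaleN1r; apply: convAlgP.
Qed.

Lemma convAlg_ind (P : (G -> R[i]) -> Prop) : P 0 ->
  (forall c f h, convAlg f -> convAlg h -> P f -> P h -> P (c *: f + h)) ->
  (forall U f, open_bisection U -> Cc U f -> P f) ->
  forall f, convAlg f -> P f.
Proof.
move=> P0 PP PC f [n [c [s [sP ->]]]].
suff [] : convAlg (\sum_(i < n) c i *: s i) /\ P (\sum_(i < n) c i *: s i) by [].
apply: (big_rec (fun f => convAlg f /\ P f)) => [|i h _ [ch Ph]].
  by split => //; exact: convAlg0.
have [U bU cU] := sP i; have csi : convAlg (s i) by exact: convAlg_Cc bU cU.
by split; [exact: convAlgP|apply: PP => //; exact: PC bU cU].
Qed.

Lemma convAlg_rng_finite f : convAlg f -> rng_finite f.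
Proof.
elim/convAlg_ind => [|c h k _ _|U h bU ch] y.
- by rewrite (_ : [set _ | _] = set0) //; apply/seteqP; split => // g [].
- by move=> fh fk; exact: rng_finiteP.
have [[g [Ug gy]]|nU] := pselect (exists g, U g /\ grng g = y).
  apply: sub_finite_set (finite_set1 g) => e [ey e0] /=.
  apply: (bis_rinj het bU) => //; last by rewrite ey.
  by apply: contrapT => nUe; apply: e0; exact: Cc_off ch nUe.
rewrite (_ : [set _ | _] = set0) //; apply/seteqP; split => // e [ey e0].
apply: e0; apply: Cc_off ch _ => Ue; apply: nU; by exists e.
Qed.

Lemma conv_starP c f h : conv_star (c *: f + h) = conjc c *: conv_star f + conv_star h.
Proof.
by apply/funext => g; rewrite /conv_star [LHS]rmorphD /= rmorphM.
Qed.

Lemma Cc_star U f : open_bisection U -> Cc U f -> Cc (@ginv G @^-1` U) (conv_star f).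
Proof.
move=> bU; have bU' := bis_inv het bU.
move=> /(CcP _ (bis_open het bU))[cf [K [cK KU K0]]]; apply/(CcP _ (bis_open het bU')); split.
  move=> x /= Ux; apply/contC_conj/contC_comp; last exact: cf.
  exact: ginv_continuous.
exists (@ginv G @` K); split.
- by apply: continuous_compact cK; apply: continuous_subspaceT; exact: ginv_continuous.
- by move=> _ [g Kg <-] /=; rewrite ginvK; exact: KU.
- move=> g nK; rewrite /conv_star K0 ?conjc0 // => Kg; apply: nK.
  by exists (ginv g) => //; rewrite ginvK.
Qed.

Lemma convAlg_star f : convAlg f -> convAlg (conv_star f).
Proof.
elim/convAlg_ind => [|c h k ch ck sh sk|U h bU ch].
- rewrite (_ : conv_star 0 = 0); first exact: convAlg0.
  by apply/funext => g; rewrite /conv_star conjc0.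
- by rewrite conv_starP; exact: convAlgP.
- by apply: convAlg_Cc (bis_inv het bU) _; exact: Cc_star.
Qed.

Lemma conv_bisE U f h g e : open_bisection U -> Cc U f -> U e -> grng e = grng g ->
  conv f h g = f e * h (gmul (ginv e) g).
Proof.
move=> bU cf Ue eg; rewrite convE (fiber_sum_bis _ _ _ Ue) //.
  exact: (bis_rinj het bU).
by move=> x; exact: Cc_off.
Qed.

Lemma conv_bis0 U f h g : Cc U f -> (forall e, U e -> grng e <> grng g) -> conv f h g = 0.
Proof.
by move=> cf H; rewrite convE (fiber_sum0 (U := U)) // => x; exact: Cc_off.
Qed.

Lemma Cc_conv U V f h : open_bisection U -> open_bisection V -> Cc U f -> Cc V h ->
  Cc (gprod U V) (conv f h).
Proof.
move=> bU bV cf ch; have bUV := bis_prod het bU bV.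
have [oU oV] := (bis_open het bU, bis_open het bV).
have /(CcP _ oU)[ff [K [cK KU K0]]] := cf.
have /(CcP _ oV)[fh [L [cL LV L0]]] := ch.
apply/(CcP _ (bis_open het bUV)); split; last first.
  exists (gprod K L); split; first exact: compact_gprod.
    by move=> _ [[a b] [/= Ka Lb ab] <-]; exists (a, b) => //=; split; [exact: KU|exact: LV|].
  move=> g nKL; have [[e [Ue eg]]|nU] := pselect (exists e, U e /\ grng e = grng g).
    rewrite (conv_bisE h bU cf Ue eg).
    have [Ke|nKe] := pselect (K e); last by rewrite K0 // mul0r.
    rewrite L0 ?mulr0 // => Le; apply: nKL.
    exists (e, gmul (ginv e) g) => /=; last by rewrite gmulKVg.
    by split => //; rewrite grng_mul ?gsrc_inv // grng_inv.
  by apply: (conv_bis0 h cf) => e Ue eg; apply: nU; exists e.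
move=> _ [[a b] [/= Ua Vb ab] <-].
(* The factor in U of an arrow of UV depends continuously on its range, and the convolution near ab
   is the single product f(s(g)) h(s(g)^-1 g). *)
pose s g := gsec (@grng G) U (grng g).
have oUV : nbhs (gmul a b) (gprod U V).
  by apply: open_nbhs_nbhs; split; [exact: bis_open|exists (a, b)].
have sK c d : U c -> gsrc c = grng d -> s (gmul c d) = c.
  by move=> Uc cd; rewrite /s grng_mul // gsecK //; exact: bis_rinj.
have cs : {for gmul a b, continuous s}.
  apply: continuous_comp; first exact: rng_continuous.
  rewrite grng_mul //; apply: gsec_continuous => //; [exact: rng_etale|exact: bis_rinj].
apply: contC_near (_ : contC (fun g => f (s g) * h (gmul (ginv (s g)) g)) _).
  apply: filterS oUV => _ [[c d] [/= Uc Vd cd] <-].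
  by rewrite sK // (conv_bisE h bU cf Uc) ?grng_mul.
apply: contCM.
  by apply: (contC_comp cs); rewrite sK //; exact: ff.
apply: (contC_comp (a := fun g => gmul (ginv (s g)) g)); last by rewrite sK // gmulKg //; exact: fh.
apply: gmul_continuous_at; last 2 first.
- exact: cvg_id.
- by apply: filterS oUV => _ [[c d] [/= Uc Vd cd] <-]; rewrite sK // gsrc_inv grng_mul.
by apply: continuous_comp; [exact: cs|exact: ginv_continuous].
Qed.

Lemma convPl c f f' h : convAlg f -> convAlg f' ->
  conv (c *: f + f') h = c *: conv f h + conv f' h.
Proof.
move=> cf cf'; apply/funext => g; rewrite !convE fiber_sumPl //; exact: convAlg_rng_finite.
Qed.

Lemma convPr c f h h' : convAlg f ->
  conv f (c *: h + h') = c *: conv f h + conv f h'.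
Proof.
move=> cf; apply/funext => g; rewrite convE.
rewrite -[LHS]/(fiber_sum f (c *: (fun e => h (gmul (ginv e) g)) +
  (fun e => h' (gmul (ginv e) g))) (grng g)).
by rewrite fiber_sumPr //; exact: convAlg_rng_finite.
Qed.

Lemma conv0l h : conv (0 : G -> R[i]) h = 0.
Proof. by apply/funext => g; rewrite /conv fsbig1 // => e _; rewrite mul0r. Qed.

Lemma conv0r f : conv f (0 : G -> R[i]) = 0.
Proof. by apply/funext => g; rewrite /conv fsbig1 // => e _; rewrite mulr0. Qed.

Lemma convAlg_conv f h : convAlg f -> convAlg h -> convAlg (conv f h).
Proof.
move=> + ch; elim/convAlg_ind => [|c k k' ck ck' IH IH'|U k bU ck].
- by rewrite conv0l; exact: convAlg0.
- by rewrite convPl //; exact: convAlgP.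
have cAk := convAlg_Cc bU ck.
elim/convAlg_ind: ch => [|c l l' cl cl' IH IH'|V l bV cl].
- by rewrite conv0r; exact: convAlg0.
- by rewrite convPr //; exact: convAlgP.
- by apply: convAlg_Cc (bis_prod het bU bV) _; exact: Cc_conv.
Qed.

Lemma Cc_bounded U f : open_bisection U -> Cc U f ->
  exists M : R, [/\ 0 <= M & forall g, rnorm (f g) <= M].
Proof.
move=> bU /(CcP _ (bis_open het bU))[cf [K [cK KU K0]]]; apply: contrapT => nM.
have big (M : R) : 0 <= M -> exists2 g, K g & M < rnorm (f g).
  move=> M0; apply: contrapT => H; apply: nM; exists M; split => // g.
  have [Kg|/K0 ->] := pselect (K g); last by rewrite rnorm0.
  by rewrite leNgt; apply/negP => gM; apply: H; exists g.
pose F : set_system G := [set A | exists2 M : R, 0 <= M & [set g | K g /\ M < rnorm (f g)] `<=` A].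
have FF : ProperFilter F.
  apply: Build_ProperFilter_ex.
    by move=> A [M M0 MA]; have [g Kg gM] := big M M0; exists g; exact: MA.
  split; first by exists 0.
  - move=> A B [M M0 MA] [N N0 NB]; exists (Num.max M N); first by rewrite le_max M0.
    by move=> g [Kg]; rewrite gt_max => /andP[gM gN]; split; [exact: MA|exact: NB].
  - by move=> A B AB [M M0 MA]; exists M => //; exact: subset_trans AB.
have [|p [Kp Fp]] := cK F FF; first by exists 0 => // g [].
have /contC_rnorm/(_ 1 ltr01) near1 := cf _ (KU _ Kp).
have [|y [[Ky yM] /= yp]] := Fp [set g | K g /\ rnorm (f p) + 1 < rnorm (f g)] _ _ near1.
  by exists (rnorm (f p) + 1) => //; rewrite addr_ge0 ?rnorm_ge0.
have := rnorm_tri (f p) (f y) 0; rewrite !subr0 rnormBC; lra.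
Qed.

Lemma Cc_bump_unit W u : open W -> W `<=` @units G -> W u -> exists phi : G -> R,
  [/\ phi u = 1, forall g, 0 <= phi g <= 1, Cc W (fun g => (phi g)%:C) &
     forall g, units g -> {for g, continuous phi}].
Proof.
move=> oW Wu Wuu.
have [phi [p1 p01 cphi [K [cK KW K0]]]] := bump_unit (R := R) het hT2 hlc oW Wu Wuu.
exists phi; split => //; apply/(CcP _ oW); split.
  by move=> x Wx; apply/contC_real/cphi/Wu.
by exists K; split => // g /K0 ->.
Qed.

(** A bump on s(U) pulled back along s; [gsec] carries its compact support back into U. *)
Lemma Cc_bump U g : open_bisection U -> U g -> exists2 f : G -> R[i], Cc U f & f g = 1.
Proof.
move=> bU Ug; have oU := bis_open het bU; pose W := @gsrc G @` U.
have oW : open W by have [_ _] := src_etale het; apply.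
have Wu : W `<=` @units G by move=> _ [h _ <-]; exact: units_src.
have [|phi [p1 p01 cphi [K [cK KW K0]]]] := bump_unit (R := R) het hT2 hlc (u := gsrc g) oW Wu.
  by exists g.
pose f (h : G) : R[i] := if pselect (U h) then (phi (gsrc h))%:C else 0.
have fU (h : G) : U h -> f h = (phi (gsrc h))%:C by rewrite /f; case: pselect.
exists f; last by rewrite fU ?p1.
apply/(CcP _ oU); split.
  move=> x Ux; apply: contC_near (_ : contC (fun h : G => (phi (gsrc h))%:C) x).
    have : nbhs x U by exact: open_nbhs_nbhs.
    by apply: filterS => h Uh; rewrite fU.
  apply: (contC_comp (f := fun h : G => (phi h)%:C)); first exact: src_continuous.
  by apply: contC_real; apply: cphi; exact: units_src.
exists (gsec (@gsrc G) U @` K); split.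
- apply: continuous_compact cK; apply/subspace_continuousP => y Ky.
  have [h Uh hy] := KW _ Ky; apply: cvg_within_filter; rewrite -hy.
  by apply: gsec_continuous => //; [exact: src_etale|exact: bis_sinj].
- move=> _ [y Ky <-]; have [h Uh <-] := KW _ Ky.
  by rewrite gsecK //; exact: bis_sinj.
- move=> h nK; rewrite /f; case: pselect => // Uh; rewrite K0 // => Kh.
  by apply: nK; exists (gsrc h) => //; rewrite gsecK //; exact: bis_sinj.
Qed.

End ConvAlg.

(** * The regular representations *)

Section Ell2Total.
Context {R : realType} {X : choiceType}.
Implicit Types (a b : ell2 R X) (x y : X).

Lemma ell2_coord_rnorm a x : rnorm (a x) <= rnorm a.
Proof.
rewrite -(@ler_pXn2r _ 2) ?nnegrE ?rnorm_ge0 // rnorm_sqr.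
exact: ell2_coord_le.
Qed.

Lemma esum_single (h : X -> \bar R) y : (forall x, 0 <= h x)%E ->
  (forall x, x != y -> h x = 0%E) -> (\esum_(x in [set: X]) h x = h y)%E.
Proof.
move=> h0 hy; rewrite (esumID [set y]) // !setTI esum_set1 // esum1 ?adde0 //.
by move=> x /= /eqP; exact: hy.
Qed.

Lemma rsum_single (h : X -> R) y : (forall x, x != y -> h x = 0) -> rsum h = h y.
Proof.
move=> hy; rewrite /rsum !(@esum_single _ y) /=.
- case: (lerP (h y) 0) => h0; first by rewrite max_l ?oppr_ge0 // sub0r opprK.
  by rewrite max_r ?oppr_le0 ?(ltW h0) // subr0.
- by move=> x; rewrite lee_fin le_max lexx orbT.
- by move=> x /hy ->; rewrite oppr0 maxxx.
- by move=> x; rewrite lee_fin le_max lexx orbT.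
- by move=> x /hy ->; rewrite maxxx.
Qed.

Lemma deltaE y x : delta R y x = if x == y then 1 else 0. Proof. by []. Qed.

Lemma inner_delta a y : inner a (delta R y) = a y.
Proof.
rewrite -[LHS]/(csum (fun x => a x * (delta R y x)^*)) /csum.
have E x : x != y -> a x * (delta R y x)^* = 0.
  by move=> /negbTE xy; rewrite deltaE xy rmorph0 mulr0.
rewrite !(@rsum_single _ y); try by move=> x /E ->.
by rewrite deltaE eqxx rmorph1 mulr1; case: (a y).
Qed.

Lemma rnorm_delta y : rnorm (delta R y) = 1.
Proof.
have := inner_norm (delta R y); rewrite inner_delta deltaE eqxx => /esym E.
have : (rnorm (delta R y) ^+ 2)%:C = 1 :> R[i] by rewrite rmorphXn /= -rnormE.
move=> /complexI /eqP; rewrite sqrf_eq1 => /orP[/eqP //|/eqP N1].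
by have := rnorm_ge0 (delta R y); rewrite N1; lra.
Qed.

Lemma ell2_sumE (I : Type) (r : seq I) (F : I -> ell2 R X) x :
  (\sum_(i <- r) F i) x = \sum_(i <- r) F i x.
Proof. by apply: (big_morph (fun a : ell2 R X => a x)). Qed.

Lemma ell2_approx a (e : R) : 0 < e ->
  exists r : seq X, rnorm (a - \sum_(x <- r) a x *: delta R x) < e.
Proof.
move=> e0; have e2 : 0 < e ^+ 2 by rewrite exprn_gt0.
have [_ [F [finF _] <-]] := ub_ereal_sup_adherent e2 (ell2_fin a).
move=> lt; have {}lt : (sum_normsq a - (e ^+ 2)%:E < \sum_(x \in F) (normsq (a x))%:E)%E := lt.
exists (finmap.enum_fset (fset_set F)); set b := \sum_(x <- _) _.
have bE x : b x = if x \in F then a x else 0.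
  rewrite /b ell2_sumE; case: ifPn => xF.
    rewrite (bigD1_seq x) ?in_fset_set ?finmap.fset_uniq //.
    rewrite big1; first by rewrite ell2Z deltaE eqxx mulr1; exact: addr0.
    move=> y yx; by rewrite ell2Z deltaE eq_sym (negbTE yx) mulr0.
  rewrite big_seq big1 // => y; rewrite in_fset_set // => yF.
  rewrite ell2Z deltaE; case: eqVneq => [xy|]; last by rewrite mulr0.
  by rewrite xy yF in xF.
have : sum_normsq (a - b : ell2 R X) = (\esum_(x in ~` F) (normsq (a x))%:E)%E.
  rewrite /sum_normsq (esumID F); last by move=> x _; rewrite lee_fin normsq_ge0.
  rewrite !setTI esum1 ?add0e; last first.
    move=> x /mem_set Fx; rewrite ell2D ell2N bE Fx subrr /normsq /=.
    by rewrite expr0n addr0.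
  apply: eq_esum => x nFx; rewrite ell2D ell2N bE.
  by rewrite memNset // oppr0 addr0.
have : (sum_normsq a = \sum_(x \in F) (normsq (a x))%:E + \esum_(x in ~` F) (normsq (a x))%:E)%E.
  rewrite {1}/sum_normsq (esumID F); last by move=> x _; rewrite lee_fin normsq_ge0.
  by rewrite !setTI esum_fset // => x _; rewrite lee_fin normsq_ge0.
move: lt; rewrite fsbig_finite // sumEFin -(ell2_rnorm_sqr a) -(ell2_rnorm_sqr (a - b)).
set s := \sum_(i <- _) _; set t := esum _ _.
move=> lt E E'; rewrite -(@ltr_pXn2r _ 2) ?nnegrE ?rnorm_ge0 ?(ltW e0) //.
rewrite -[rnorm _]/(ell2_rnorm (a - b)).
by move: lt; rewrite E -E' -EFinD lte_fin; lra.
Qed.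

(** The target is arbitrary so that the lemma serves both for equalities of operators and for
    identities between scalar forms. *)
Lemma ell2_ext (V : normedModType R[i]) (L : ell2 R X -> V) (C : R) :
  (forall k a b, L (k *: a + b) = k *: L a + L b) ->
  (forall a, rnorm (L a) <= C * rnorm a) ->
  (forall x, L (delta R x) = 0) -> forall a, L a = 0.
Proof.
move=> linL bL L0 a.
have LD b c : L (b + c) = L b + L c by have := linL 1 b c; rewrite !scale1r.
have L00 : L 0 = 0 by apply: (addrI (L 0)); rewrite -LD !addr0.
have LS r : L (\sum_(x <- r) a x *: delta R x) = 0.
  elim: r => [|x r IH]; first by rewrite big_nil.
  by rewrite big_cons linL L0 scaler0 add0r.
apply: rnorm_small => e e0.
have C1 : 0 < `|C| + 1 by rewrite ltr_wpDl.
have [r ar] := @ell2_approx a (e / (`|C| + 1)) (divr_gt0 e0 C1).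
set b := \sum_(x <- r) _ in ar.
have -> : L a = L (a - b).
  by have := LD (a - b) b; rewrite subrK => ->; rewrite (LS r : L b = 0) addr0.
apply: le_lt_trans (bL _) _.
apply: (@le_lt_trans _ _ ((`|C| + 1) * rnorm (a - b))).
  by rewrite ler_wpM2r ?rnorm_ge0 //; have := ler_norm C; lra.
by rewrite -ltr_pdivlMl // mulrC.
Qed.

End Ell2Total.

Section BoundedOperators.
Context {R : realType}.

Lemma bounded_operator_bound (H : normedModType R[i]) (T : H -> H) : bounded_operator T ->
  exists C : R, 0 <= C /\ forall x, rnorm (T x) <= C * rnorm x.
Proof.
move=> [linT cT]; have T0 : T 0 = 0.
  by apply: (addrI (T 0)); have := linT 1 0 0; rewrite !scale1r !addr0.
have TZ k x : T (k *: x) = k *: T x by have := linT k x 0; rewrite !addr0 T0 addr0.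
have [|d d0 dP] := (nbhs_rnorm _ _).1 (cT 0 [set y | rnorm (T 0 - y) < 1] _).
  by apply/nbhs_rnorm; exists 1.
exists (2 / d); split; first by rewrite divr_ge0 // ltW.
move=> x; have [->|x0] := eqVneq x 0; first by rewrite T0 rnorm0 mulr0.
have nx := rnorm_neq0 x0.
have k0 : 0 < d / (2 * rnorm x) by rewrite divr_gt0 // mulr_gt0.
have /dP /= : rnorm (0 - (d / (2 * rnorm x))%:C *: x) < d.
  rewrite sub0r rnormN rnormZr gtr0_norm //.
  have -> : d / (2 * rnorm x) * rnorm x = d / 2 by field; rewrite gt_eqF.
  lra.
rewrite T0 sub0r rnormN TZ rnormZr gtr0_norm // => /ltW h.
rewrite -(ler_pM2l k0); apply: (le_trans h).
by have -> : d / (2 * rnorm x) * (2 / d * rnorm x) = 1 by field; rewrite !gt_eqF.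
Qed.

Lemma bound_bounded_operator (H : normedModType R[i]) (T : H -> H) (C : R) :
  linear T -> (forall x, rnorm (T x) <= C * rnorm x) -> bounded_operator T.
Proof.
move=> linT bT; split => // x; apply/continuous_rnorm => e e0.
have C1 : 0 < `|C| + 1 by rewrite ltr_wpDl.
apply/nbhs_rnorm; exists (e / (`|C| + 1)); first exact: divr_gt0.
move=> y xy; have -> : T x - T y = T (x - y).
  by have := linT (-1) y x; rewrite !scaleN1r ![- _ + _]addrC.
apply: le_lt_trans (bT _) _; apply: (@le_lt_trans _ _ ((`|C| + 1) * rnorm (x - y))).
  by rewrite ler_wpM2r ?rnorm_ge0 //; have := ler_norm C; lra.
by rewrite -ltr_pdivlMl // mulrC.
Qed.

Lemma op_norm_ub (H : normedModType R[i]) (T : H -> H) (C : R) : 0 <= C ->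
  (forall x, rnorm (T x) <= C * rnorm x) -> (op_norm T <= C%:E)%E.
Proof.
move=> C0 bT; apply: ge_ereal_sup => _ [x /= x1 <-]; rewrite lee_fin.
apply: le_trans (bT x) _; rewrite -[leRHS]mulr1 ler_wpM2l //.
by rewrite rnormE -[1]/(1%:C) lecR in x1.
Qed.

Lemma op_norm_le (H : normedModType R[i]) (T : H -> H) (C : R) : linear T ->
  (op_norm T <= C%:E)%E -> forall x, rnorm (T x) <= C * rnorm x.
Proof.
move=> linT nT x; have T0 : T 0 = 0.
  by apply: (addrI (T 0)); have := linT 1 0 0; rewrite !scale1r !addr0.
have TZ k y : T (k *: y) = k *: T y by have := linT k y 0; rewrite !addr0 T0 addr0.
have [->|x0] := eqVneq x 0; first by rewrite T0 rnorm0 mulr0.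
have nx := rnorm_neq0 x0.
have : ((rnorm (T ((rnorm x)^-1%:C *: x)))%:E <= C%:E)%E.
  apply: le_trans nT; apply: ereal_sup_ubound; exists ((rnorm x)^-1%:C *: x) => //=.
  rewrite rnormE rnormZr gtr0_norm ?invr_gt0 // mulVf ?gt_eqF //.
rewrite lee_fin TZ rnormZr gtr0_norm ?invr_gt0 // mulrC ler_pdivrMr //.
Qed.

End BoundedOperators.

Section RegularRepresentation.
Context {R : realType} {G : topGroupoidType} (het : etale G).
Implicit Types (f h : G -> R[i]) (g u : G).

Lemma convAlg_src_finite f : convAlg f -> forall x, finite_set [set g | gsrc g = x /\ f g <> 0].
Proof.
move=> cf x; have := convAlg_rng_finite het (convAlg_star het cf) x.
move=> /(finite_image (@ginv G)); apply: sub_finite_set => g [gx fg].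
exists (ginv g); last by rewrite ginvK.
split; rewrite ?grng_inv // /conv_star ginvK => E; apply: fg.
by apply: rnorm0_eq0; rewrite -rnorm_conj E rnorm0.
Qed.

Lemma fiber_src u (c : fiber u) : gsrc (val c) = u.
Proof. exact: (set_mem (valP c)). Qed.

(** Only a = d c^-1 satisfies a c = d, so a single term of the sum contributes. *)
Lemma regular_coef u f (T : ell2 R (fiber u) -> ell2 R (fiber u)) (c d : fiber u) :
  convAlg f -> is_regular f T -> T (delta R c) d = f (gmul (val d) (ginv (val c))).
Proof.
move=> cf [_ ->]; set A := fiber (grng (val c)).
have dc : gsrc (gmul (val d) (ginv (val c))) = grng (val c).
  by rewrite gsrc_mul ?gsrc_inv // grng_inv !fiber_src.
pose a0 : A := SigSub (mem_set dc).
pose S := [set a : A | f (val a) <> 0].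
have fS : finite_set S.
  have := convAlg_src_finite cf (grng (val c)).
  move=> /(finite_preimage (f := (val : A -> G)) (in2W val_inj)).
  apply: sub_finite_set => a fa; split => //; exact: fiber_src.
rewrite (fsum_sub (S := S)) //; last first.
  by move=> a _ nSa; have -> : f (val a) = 0 by [apply: contrapT]; rewrite scale0r.
rewrite fsbig_finite // ell2_sumE.
have fE (a : A) : (f (val a) *: delta R (fiber_mul a)) d = if a == a0 then f (val a0) else 0.
  rewrite ell2Z deltaE; have -> : (d == fiber_mul a) = (a == a0).
    apply/eqP/eqP => [E|->].
      apply: val_inj => /=; rewrite E /= gmulgK //; exact: fiber_src.
    by apply: val_inj => /=; rewrite gmulgKV // !fiber_src.
  by case: eqP => [->|]; rewrite ?mulr1 ?mulr0.
under eq_bigr do rewrite fE.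
have [Sa0|nSa0] := pselect (S a0).
  rewrite (bigD1_seq a0) ?in_fset_set ?inE ?finmap.fset_uniq // eqxx big1.
    exact: addr0.
  by move=> a /negbTE ->.
have f0 : f (val a0) = 0 by apply: contrapT.
transitivity (f (val a0)) => //; by rewrite f0 big1 // => a _; case: ifP.
Qed.

Lemma regular_unique u f (T S : ell2 R (fiber u) -> ell2 R (fiber u)) :
  is_regular f T -> is_regular f S -> forall x, T x = S x.
Proof.
move=> [bT Td] [bS Sd] x; apply/eqP; rewrite -subr_eq0; apply/eqP.
have [C [C0 TC]] := bounded_operator_bound bT; have [D [D0 SD]] := bounded_operator_bound bS.
have [[linT _] [linS _]] := (bT, bS).
apply: (@ell2_ext _ _ _ (fun x => T x - S x) (C + D)).
- by move=> k a b; rewrite linT linS opprD addrACA scalerBr.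
- by move=> a; have := rnormB (T a) (S a); have := TC a; have := SD a; lra.
- by move=> c; rewrite Td Sd subrr.
Qed.

Variable B : red_cstar R G.
Implicit Types (a b : B).

Lemma red_rep_linear u (hu : units u) k a b x :
  red_rep (u:=u) (k *: a + b) x = k *: red_rep a x + red_rep b x.
Proof. by have [_ H _ _] := red_repP B hu; rewrite H. Qed.

Lemma red_rep_rnorm u (hu : units u) a (x : ell2 R (fiber u)) :
  rnorm (red_rep a x) <= rnorm a * rnorm x.
Proof. by have := red_rep_le hu a x; rewrite !rnormE -rmorphM /= lecR. Qed.

Lemma red_dense b (e : R) : 0 < e -> exists2 f, convAlg f & rnorm (b - red_map B f) < e.
Proof.
move=> e0; have [_ _ dB] := red_mapP B.
by have [_ [f cf <-] bf] := dense_rnorm dB b e0; exists f.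
Qed.

Lemma jmap_coord b g : jmap b g = red_rep b (delta R (in_fiber_src g)) (in_fiber g).
Proof. exact: inner_delta. Qed.

Lemma jmap_red f g : convAlg f -> jmap (red_map B f) g = f g.
Proof.
move=> cf; rewrite jmap_coord (regular_coef _ _ cf (red_rep_map B (units_src g) cf)) /=.
by rewrite ginv_rng_unit ?gmul_src //; exact: units_src.
Qed.

Lemma jmap_linear k a b g : jmap (k *: a + b) g = k * jmap a g + jmap b g.
Proof. by rewrite !jmap_coord red_rep_linear ?ell2D ?ell2Z //; exact: units_src. Qed.

Lemma jmapB a b g : jmap (a - b) g = jmap a g - jmap b g.
Proof.
rewrite addrC -scaleN1r jmap_linear mulN1r addrC //.
Qed.

Lemma jmap_rnorm a g : rnorm (jmap a g) <= rnorm a.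
Proof.
rewrite jmap_coord; apply: le_trans (ell2_coord_rnorm _ _) _.
by apply: le_trans (red_rep_rnorm (units_src g) _ _) _; rewrite rnorm_delta mulr1.
Qed.

(* Right translation identifies the matrix coefficients of all the [L_u] with values of [j]. *)
Lemma red_rep_coef u (hu : units u) b (c d : fiber u) :
  red_rep b (delta R c) d = jmap b (gmul (val d) (ginv (val c))).
Proof.
apply/eqP; rewrite -subr_eq0; apply/eqP; apply: rnorm_small => e e0.
have e2 : 0 < e / 2 by rewrite divr_gt0.
have [f cf bf] := red_dense b e2.
set g := gmul _ _.
have E : red_rep (red_map B f) (delta R c) d = jmap (red_map B f) g.
  by rewrite (regular_coef _ _ cf (red_rep_map B hu cf)) jmap_red.
have -> : red_rep b (delta R c) d - jmap b g =
    red_rep (b - red_map B f) (delta R c) d - jmap (b - red_map B f) g.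
  rewrite jmapB -E; have -> : b - red_map B f = (-1) *: red_map B f + b by rewrite scaleN1r addrC.
  by rewrite red_rep_linear // ell2D ell2Z; ring.
apply: le_lt_trans (rnormB _ _) _.
have := jmap_rnorm (b - red_map B f) g.
have := ell2_coord_rnorm (red_rep (b - red_map B f) (delta R c)) d.
have := red_rep_rnorm hu (b - red_map B f) (delta R c); rewrite rnorm_delta mulr1.
lra.
Qed.

Lemma red_rep_eq0 u (hu : units u) b :
  (forall c d : fiber u, jmap b (gmul (val d) (ginv (val c))) = 0) ->
  forall x, red_rep (u:=u) b x = 0.
Proof.
move=> j0; have [H _ _ _] := red_repP B hu; have [linb _] := H b I.
apply: (@ell2_ext _ _ _ _ (rnorm b)) => [||c].
- exact: linb.
- exact: red_rep_rnorm.
- apply: val_inj; apply/funext => d.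
  by rewrite [LHS](red_rep_coef hu b c d) j0.
Qed.

End RegularRepresentation.

(** * Comparing the full and the reduced algebras *)

Section Cstar.
Context {R : realType} {A : cstarAlgType R}.
Implicit Types a b : A.

Lemma rnorm_amul a b : rnorm (amul a b) <= rnorm a * rnorm b.
Proof. by have := norm_amul a b; rewrite !rnormE -rmorphM lecR. Qed.

Lemma rnorm_astar_amul a : rnorm (amul (astar a) a) = rnorm a ^+ 2.
Proof. by apply: (@complexI R); rewrite rmorphXn /= -!rnormE norm_astar_amul. Qed.

Lemma rnorm_astar a : rnorm (astar a) = rnorm a.
Proof.
suff le b : rnorm b <= rnorm (astar b).
  by apply/le_anti; rewrite le andbT -{2}(astarK a) le.
have [->|/rnorm_neq0 b0] := eqVneq b 0; first by rewrite rnorm0 rnorm_ge0.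
by rewrite -(ler_pM2r b0) -expr2 -rnorm_astar_amul rnorm_amul.
Qed.

Lemma amulDl a b c : amul (a + b) c = amul a c + amul b c.
Proof. by have := amul_linearl c 1 a b; rewrite !scale1r. Qed.

Lemma amulDr a b c : amul c (a + b) = amul c a + amul c b.
Proof. by have := amul_linearr c 1 a b; rewrite !scale1r. Qed.

Lemma amul0l a : amul 0 a = 0.
Proof. by apply: (addrI (amul 0 a)); rewrite -amulDl !addr0. Qed.

Lemma amul0r a : amul a 0 = 0.
Proof. by apply: (addrI (amul a 0)); rewrite -amulDr !addr0. Qed.

Lemma amulZl k a b : amul (k *: a) b = k *: amul a b.
Proof. by have := amul_linearl b k a 0; rewrite !addr0 amul0l addr0. Qed.

Lemma amulZr k a b : amul a (k *: b) = k *: amul a b.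
Proof. by have := amul_linearr a k b 0; rewrite !addr0 amul0r addr0. Qed.

Lemma amulNl a b : amul (- a) b = - amul a b.
Proof. by rewrite -scaleN1r amulZl scaleN1r. Qed.

Lemma amulNr a b : amul a (- b) = - amul a b.
Proof. by rewrite -scaleN1r amulZr scaleN1r. Qed.

Lemma amulBl a b c : amul (a - b) c = amul a c - amul b c.
Proof. by rewrite amulDl amulNl. Qed.

Lemma amulBr a b c : amul c (a - b) = amul c a - amul c b.
Proof. by rewrite amulDr amulNr. Qed.

End Cstar.

Section Completion.
Context {R : realType} {G : topGroupoidType} {nrm : (G -> R[i]) -> \bar R}
  {A : cstarAlgType R} {iota : (G -> R[i]) -> A} (iotaP : is_completion nrm iota).
Implicit Types (f h : G -> R[i]).

Lemma completion_linear k f h : convAlg f -> convAlg h ->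
  iota (k *: f + h) = k *: iota f + iota h.
Proof. by move=> cf ch; have [[H _ _] _ _] := iotaP; exact: H. Qed.

Lemma completion_mul f h : convAlg f -> convAlg h ->
  iota (conv f h) = amul (iota f) (iota h).
Proof. by move=> cf ch; have [[_ H _] _ _] := iotaP; exact: H. Qed.

Lemma completion_star f : convAlg f -> iota (conv_star f) = astar (iota f).
Proof. by move=> cf; have [[_ _ H] _ _] := iotaP; exact: H. Qed.

Lemma completion0 : iota 0 = 0.
Proof.
have := completion_linear 1 (convAlg0 (R := R) (G := G)) (convAlg0 (R := R) (G := G)).
by rewrite scale1r !addr0 scale1r => /eqP; rewrite -subr_eq0 opprD addNKr oppr_eq0 => /eqP.
Qed.

Lemma completionZ k f : convAlg f -> iota (k *: f) = k *: iota f.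
Proof.
by move=> cf; have := completion_linear k cf (convAlg0 (R := R) (G := G));
  rewrite !addr0 completion0 addr0.
Qed.

Lemma completionD f h : convAlg f -> convAlg h -> iota (f + h) = iota f + iota h.
Proof. by move=> cf ch; have := completion_linear 1 cf ch; rewrite !scale1r. Qed.

Lemma completionB f h : convAlg f -> convAlg h -> iota (f - h) = iota f - iota h.
Proof.
by move=> cf ch; rewrite addrC -scaleN1r completion_linear // scaleN1r addrC.
Qed.

Lemma completion_norm f : convAlg f -> (rnorm (iota f))%:E = nrm f.
Proof. by move=> cf; have [_ H _] := iotaP; exact: H. Qed.

Lemma completion_dense (a : A) (e : R) : 0 < e -> exists2 f, convAlg f & rnorm (iota f - a) < e.
Proof.
move=> e0; have [_ _ dA] := iotaP.
by have [_ [f cf <-] af] := dense_rnorm dA a e0; exists f => //; rewrite rnormBC.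
Qed.

End Completion.

Section StarRep.
Context {R : realType} {G : topGroupoidType} {H : hilbertType R}
  {rho : (G -> R[i]) -> H -> H} (rhoP : star_rep (@conv R G) (@conv_star R G) (@convAlg R G) rho).
Implicit Types (f h : G -> R[i]) (x y : H).

Lemma rep_linear k f h x : convAlg f -> convAlg h ->
  rho (k *: f + h) x = k *: rho f x + rho h x.
Proof. by move=> cf ch; have [_ E _ _] := rhoP; rewrite E. Qed.

Lemma rep0 x : rho 0 x = 0.
Proof.
have := rep_linear 1 x (convAlg0 (R := R) (G := G)) (convAlg0 (R := R) (G := G)).
by rewrite scale1r !addr0 scale1r => /eqP; rewrite -subr_eq0 opprD addNKr oppr_eq0 => /eqP.
Qed.

Lemma repZ k f x : convAlg f -> rho (k *: f) x = k *: rho f x.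
Proof.
by move=> cf; have := rep_linear k x cf (convAlg0 (R := R) (G := G));
  rewrite !addr0 rep0 addr0.
Qed.

Lemma repB f h x : convAlg f -> convAlg h -> rho (f - h) x = rho f x - rho h x.
Proof.
by move=> cf ch; rewrite addrC -scaleN1r rep_linear // scaleN1r addrC.
Qed.

Lemma rep_conv f h x : convAlg f -> convAlg h -> rho (conv f h) x = rho f (rho h x).
Proof. by move=> cf ch; have [_ _ E _] := rhoP; rewrite E. Qed.

Lemma rep_star f x y : convAlg f -> inner (rho (conv_star f) x) y = inner x (rho f y).
Proof. by move=> cf; have [_ _ _ E] := rhoP; rewrite E. Qed.

Lemma rep_lin f : convAlg f -> linear (rho f).
Proof. by move=> cf; have [E _ _ _] := rhoP; have [] := E f cf. Qed.

End StarRep.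

Section FullReduced.
Context {R : realType} {G : topGroupoidType} (het : etale G)
  (hT2 : hausdorff_space (set_type (@units G))).
Variables (A : full_cstar R G) (B : red_cstar R G).
Implicit Types (f h : G -> R[i]).
Let full := full_map A.
Let red := red_map B.

Lemma rep_le_full f (H : hilbertType R) (rho : (G -> R[i]) -> H -> H) x :
  star_rep (@conv R G) (@conv_star R G) (@convAlg R G) rho -> convAlg f ->
  rnorm (rho f x) <= rnorm (full f) * rnorm x.
Proof.
move=> rhoP cf; apply: op_norm_le; first exact: (rep_lin rhoP).
rewrite (completion_norm (full_mapP A) cf).
by apply: ereal_sup_ubound; exists H, rho.
Qed.

Lemma full_le f (C : R) : convAlg f -> 0 <= C ->
  (forall (H : hilbertType R) (rho : (G -> R[i]) -> H -> H),
    star_rep (@conv R G) (@conv_star R G) (@convAlg R G) rho ->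
    forall x, rnorm (rho f x) <= C * rnorm x) -> rnorm (full f) <= C.
Proof.
move=> cf C0 Cb; rewrite -lee_fin (completion_norm (full_mapP A) cf).
apply: ge_ereal_sup => _ [H [rho [rhoP ->]]].
by apply: op_norm_ub => // x; exact: Cb.
Qed.

Lemma red_le f (C : R) : convAlg f -> 0 <= C ->
  (forall u, units u -> forall x : ell2 R (fiber u), rnorm (red_rep (red f) x) <= C * rnorm x) ->
  rnorm (red f) <= C.
Proof.
move=> cf C0 Cb; rewrite -lee_fin (completion_norm (red_mapP B) cf).
apply: ge_ereal_sup => _ [->|[u [T [hu Treg ->]]]]; first by rewrite lee_fin.
apply: op_norm_ub => // x.
by rewrite (regular_unique Treg (red_rep_map B hu cf)); exact: Cb.
Qed.

Lemma red_rep_star_rep u : units u -> star_rep (@conv R G) (@conv_star R G) (@convAlg R G)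
  (fun f => @red_rep R G B u (red f)).
Proof.
move=> hu; have [r1 r2 r3 r4] := red_repP B hu; have rP := red_mapP B; split.
- by move=> f cf; exact: r1.
- by move=> k f h cf ch; rewrite /red (completion_linear rP) // r2.
- by move=> f h cf ch; rewrite /red (completion_mul rP) // r3.
- by move=> f cf x y; rewrite /red (completion_star rP) // r4.
Qed.

Lemma red_le_full f : convAlg f -> rnorm (red f) <= rnorm (full f).
Proof.
move=> cf; apply: red_le => //; first exact: rnorm_ge0.
by move=> u hu x; exact: (rep_le_full x (red_rep_star_rep hu) cf).
Qed.

(** The map [jmap] recovers [f] as a function from its image in the reduced algebra. *)
Lemma red_inj f : convAlg f -> red f = 0 -> f = 0.
Proof.
move=> cf f0; apply/funext => g; rewrite -(jmap_red het B g cf) -/red f0.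
by have := jmapB (0 : B) 0 g; rewrite !subrr.
Qed.

Section Isometry.
Variables (f : G -> R[i]) (r : R) (cf : convAlg f).

(* The pair [(k, h)] stands for [k I + f'], with [f'] the image of [h], as the algebra of
   functions has no unit in general. *)
Fixpoint visser_fun n : R * (G -> R[i]) := if n is m.+1 then
  let: (k, h) := visser_fun m in
  ((1 - r ^+ 2 + k ^+ 2) / 2,
   2^-1%:C *: ((2 * r)%:C *: f + ((-1) *: conv f f + ((2 * k)%:C *: h + conv h h))))
  else (0, 0).

Let kap n := (visser_fun n).1.
Let vis n := (visser_fun n).2.

(** With Y = k I + f', the product T (I - Y) is (1 - k) T - T f': the scalar part is absorbed and an
    element of C(G) remains. *)
Definition visser_elt n := (1 - kap n - r)%:C *: f + ((-1) *: conv f (vis n) + conv f f).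

Let vis_conv n : convAlg (vis n).
Proof.
elim: n => [|n]; first exact: convAlg0.
rewrite /vis /=; case: (visser_fun n) => k h /= ch.
have cc := convAlg_conv het hT2.
by apply: convAlgZ; do ![apply: convAlgP|apply: cc].
Qed.

Lemma convAlg_visser_elt n : convAlg (visser_elt n).
Proof.
have cc := convAlg_conv het hT2.
by do ![apply: convAlgP|apply: cc] => //; exact: vis_conv.
Qed.

Lemma rep_visser_elt (H : hilbertType R) (rho : (G -> R[i]) -> H -> H) n x :
  star_rep (@conv R G) (@conv_star R G) (@convAlg R G) rho ->
  rho (visser_elt n) x = visser_poly (rho f) r n x.
Proof.
move=> rhoP; have cc := convAlg_conv het hT2.
have linf : real_linear (rho f) by move=> k y z; exact: (rep_lin rhoP cf).
have E m y : visser (rho f) r m y = (kap m)%:C *: y + rho (vis m) y.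
  elim: m y => [|m IH] y; first by rewrite /kap /vis /= scale0r (rep0 rhoP) addr0.
  rewrite visserE !IH.
  have linv : real_linear (rho (vis m)) by move=> k u v; exact: (rep_lin rhoP (vis_conv m)).
  have -> : rho (vis m.+1) y = 2^-1%:C *: ((2 * r)%:C *: rho f y + ((-1) *: rho f (rho f y) +
     ((2 * kap m)%:C *: rho (vis m) y + rho (vis m) (rho (vis m) y)))).
    have := vis_conv m; rewrite /vis /kap /=; case: (visser_fun m) => k h /= ch.
    by rewrite (repZ rhoP) ?(rep_linear rhoP) ?(rep_conv rhoP) //; do ![apply: convAlgP|apply: cc].
  have -> : kap m.+1 = (1 - r ^+ 2 + kap m ^+ 2) / 2.
    by rewrite /kap /=; case: (visser_fun m).
  rewrite (real_linearB _ _ linf) (real_linearZ _ _ linf).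
  rewrite (real_linearD _ _ linv) (real_linearZ _ _ linv).
  rewrite scaleN1r.
  move: (rho f (rho f y)) (rho f y) (rho (vis m) (rho (vis m) y)) (rho (vis m) y) => a b c d.
  by apply: rinner_ext => z; rewrite !rinnerE; field.
rewrite /visser_elt /visser_poly E !(rep_linear rhoP) ?(rep_conv rhoP) //;
  try by do ![apply: convAlgP|apply: cc|apply: vis_conv].
rewrite (real_linearB _ _ linf) (real_linearD _ _ linf) (real_linearZ _ _ linf).
rewrite scaleN1r.
move: (rho f (rho f x)) (rho f x) (rho f (rho (vis n) x)) => a b c.
by apply: rinner_ext => z; rewrite !rinnerE; ring.
Qed.

End Isometry.

(* The hypothesis says that the kernel of [A -> B] vanishes, before that map is constructed. If
   [red f < r < 1 = full f], the limit of the elements [visser_elt] would lie in the kernel. *)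
Lemma full_norm_eq_red :
  (forall a : A, (forall e : R, 0 < e -> exists f, [/\ convAlg f, rnorm (full f - a) < e &
     rnorm (red f) < e]) -> a = 0) ->
  forall f, convAlg f -> rnorm (full f) = rnorm (red f).
Proof.
move=> inj g cg; have cc := convAlg_conv het hT2.
apply/le_anti; rewrite red_le_full // andbT leNgt; apply/negP => lt.
have M0 : 0 < rnorm (full g) by apply: le_lt_trans lt; exact: rnorm_ge0.
pose g1 := (rnorm (full g))^-1%:C *: g.
have cg1 : convAlg g1 by exact: convAlgZ.
have fg1 : rnorm (full g1) = 1.
  rewrite /full (completionZ (full_mapP A)) // rnormZr gtr0_norm ?invr_gt0 //.
  by rewrite mulVf ?gt_eqF.
have rg1 : rnorm (red g1) < 1.
  rewrite /red (completionZ (red_mapP B)) // rnormZr gtr0_norm ?invr_gt0 //.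
  by rewrite ltr_pdivrMl // mulr1.
have cs1 := convAlg_star het cg1.
pose f := conv (conv_star g1) g1; have cf : convAlg f by exact: cc.
have fullf : full f = amul (astar (full g1)) (full g1).
  by rewrite /full (completion_mul (full_mapP A)) // (completion_star (full_mapP A)).
have redf : rnorm (red f) = rnorm (red g1) ^+ 2.
  rewrite /red (completion_mul (red_mapP B)) // (completion_star (red_mapP B)) //.
  by rewrite rnorm_astar_amul.
(* [visser_poly_small_conv] bounds only the square of the operator, so the contradiction is sought
   at [conv f f], which still has norm 1. *)
have ff1 : rnorm (full (conv f f)) = 1.
  have -> : full (conv f f) = amul (astar (full f)) (full f).
    rewrite /full (completion_mul (full_mapP A)) // -/full; congr amul.
    by rewrite fullf astarM astarK.
  by rewrite rnorm_astar_amul fullf rnorm_astar_amul fg1 !expr1n.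
(* The midpoint between the reduced norm of [f] and its full norm 1. *)
pose r := (rnorm (red g1) ^+ 2 + 1) / 2.
have rr : rnorm (red g1) ^+ 2 < 1 by rewrite expr_lt1 ?rnorm_ge0.
have rr0 := sqr_ge0 (rnorm (red g1)).
have r0 : 0 < r by rewrite /r; lra.
have r1 : r <= 1 by rewrite /r; lra.
have rl1 : r < 1 by rewrite /r; lra.
have redr : rnorm (red f) <= r by rewrite redf /r; lra.
have linf (H : hilbertType R) (rho : (G -> R[i]) -> H -> H) :
    star_rep (@conv R G) (@conv_star R G) (@convAlg R G) rho -> real_linear (rho f).
  by move=> rhoP k x y; exact: (rep_lin rhoP cf).
have rf (H : hilbertType R) (rho : (G -> R[i]) -> H -> H) :
    star_rep (@conv R G) (@conv_star R G) (@convAlg R G) rho ->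
    real_symmetric (rho f) /\ forall x, rnorm (rho f x) ^+ 2 <= rinner (rho f x) x.
  move=> rhoP; have E x y : rinner (rho f x) y = rinner (rho g1 x) (rho g1 y).
    by rewrite /f (rep_conv rhoP) // /rinner (rep_star rhoP).
  split=> [x y|x]; first by rewrite E rinnerC -E rinnerC.
  rewrite E rinner_sqr lerXn2r ?nnegrE ?rnorm_ge0 // /f (rep_conv rhoP) //.
  apply: le_trans (rep_le_full _ rhoP cs1) _.
  by rewrite /full (completion_star (full_mapP A)) // rnorm_astar fg1 mul1r.
pose P := visser_elt f r; have cP n : convAlg (P n) by exact: convAlg_visser_elt.
have PB n m : (n <= m)%N -> rnorm (full (P m) - full (P n)) <= (1 - vbound n) * 1.
  move=> nm; rewrite /full -(completionB (full_mapP A)) // mulr1.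
  apply: full_le; [exact: convAlgB|by rewrite subr_ge0 vbound_le1|].
  move=> H rho rhoP x; have [sf pf] := rf _ _ rhoP.
  rewrite (repB rhoP) // !(rep_visser_elt r cf _ _ rhoP).
  exact: (rnorm_visser_polyB (linf _ _ rhoP) sf pf r0 r1 x nm).
have redP n : rnorm (red (P n)) <= 1 - vbound n.
  apply: red_le => //; first by rewrite subr_ge0 vbound_le1.
  move=> u hu x; have rhoP := red_rep_star_rep hu; have [sf pf] := rf _ _ rhoP.
  rewrite (rep_visser_elt r cf _ _ rhoP).
  apply: visser_poly_small (linf _ _ rhoP) sf pf r0 r1 _ _ _ => y.
  by apply: le_trans (red_rep_rnorm hu _ _) _; rewrite ler_wpM2r ?rnorm_ge0.
have [a aP] := rnorm_complete PB (vbound_cvg 1).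
have a0 : a = 0.
  apply: inj => e e0; have [n] := @vbound_small R 1 e e0; rewrite mul1r => ne.
  exists (P n); split => //; last exact: le_lt_trans (redP n) ne.
  by rewrite rnormBC; apply: le_lt_trans (aP n) _; rewrite mulr1.
have : rnorm (full (conv f f)) <= r.
  apply: full_le => //; [exact: cc|exact: ltW|] => H rho rhoP x.
  have [sf pf] := rf _ _ rhoP; rewrite (rep_conv rhoP) //.
  apply: visser_poly_small_conv (linf _ _ rhoP) sf pf r0 r1 _ _ => n y.
  rewrite -(rep_visser_elt r cf _ _ rhoP).
  apply: le_trans (rep_le_full _ rhoP (cP n)) _; rewrite ler_wpM2r ?rnorm_ge0 //.
  by have := aP n; rewrite a0 sub0r rnormN mulr1.
by rewrite ff1 leNgt rl1.
Qed.

End FullReduced.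

Section StarHom.
Context {R : realType} {A1 A2 : cstarAlgType R} (q : A1 -> A2)
  (hq : star_hom (@amul R A1) (@astar R A1) [set: A1] q).

Lemma star_hom0 : q 0 = 0.
Proof.
have [E _ _] := hq; have := E 1 0 0 I I.
by rewrite scale1r !addr0 scale1r => /eqP; rewrite -subr_eq0 opprD addNKr oppr_eq0 => /eqP.
Qed.

Lemma star_hom_preimage (J : set A2) : continuous q -> closed_ideal J ->
  closed_ideal (q @^-1` J).
Proof.
move=> cq [cJ J0 JL Jl Jr]; have [Elin Emul _] := hq; split => /=.
- by apply: preimage_closed => // x _; exact: cq.
- by rewrite /= star_hom0.
- by move=> k a b Ja Jb /=; rewrite Elin //; exact: JL.
- by move=> a b Jb /=; rewrite Emul //; exact: Jl.
- by move=> a b Ja /=; rewrite Emul //; exact: Jr.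
Qed.

Lemma simple_image : continuous q -> (forall b, exists a, q a = b) ->
  simple_cstar A1 -> simple_cstar A2.
Proof.
move=> cq sq sA J cJ; have [E|E] := sA _ (star_hom_preimage cq cJ).
  left; apply/seteqP; split => [b Jb|_ ->]; last by have [] := cJ.
  have [a qa] := sq b; have : (q @^-1` J) a by rewrite /= qa.
  by rewrite E /= => a0; rewrite -qa a0 star_hom0.
right; apply/seteqP; split => // b _; have [a <-] := sq b.
by have : (q @^-1` J) a by rewrite E.
Qed.

Lemma closed_ideal_set0 : closed_ideal [set 0 : A2].
Proof.
split => //.
- apply/closed_rnorm => x H; apply: rnorm_small => e /H[_ ->]; by rewrite subr0.
- by move=> k a b -> ->; rewrite scaler0 addr0.
- by move=> a b ->; rewrite amul0r.
- by move=> a b ->; rewrite amul0l.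
Qed.

End StarHom.

(** * Maps between completions of C(G) *)

Section CompletionMap.
Context {R : realType} {G : topGroupoidType} (het : etale G)
  (hT2 : hausdorff_space (set_type (@units G))).
Variables (n1 n2 : (G -> R[i]) -> \bar R) (A1 A2 : cstarAlgType R).
Variables (i1 : (G -> R[i]) -> A1) (i2 : (G -> R[i]) -> A2).
Hypotheses (i1P : is_completion n1 i1) (i2P : is_completion n2 i2).
Implicit Types (f h : G -> R[i]).

(** The closure of the graph of [i1 f |-> i2 f]. The algebraic laws pass to it by approximation, and
    the norm inequality [i12] makes it the graph of a map. *)
Definition comp_rel (a : A1) (b : A2) := forall e : R, 0 < e ->
  exists f, [/\ convAlg f, rnorm (i1 f - a) < e & rnorm (i2 f - b) < e].

Lemma comp_rel_map f : convAlg f -> comp_rel (i1 f) (i2 f).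
Proof. by move=> cf e e0; exists f; rewrite !subrr !rnorm0. Qed.

Let rnorm_lin (V : normedModType R[i]) (k : R[i]) (a b c d : V) :
  rnorm (k *: a + b - (k *: c + d)) <= rnorm k * rnorm (a - c) + rnorm (b - d).
Proof.
by rewrite opprD addrACA -scalerBr; apply: le_trans (rnormD _ _) _; rewrite rnormZ.
Qed.

Lemma comp_rel_linear k a b c d : comp_rel a b -> comp_rel c d ->
  comp_rel (k *: a + c) (k *: b + d).
Proof.
move=> ab cd e e0; have k0 := rnorm_ge0 k; have k1 : 0 < rnorm k + 1 by rewrite ltr_wpDl.
have e1 : 0 < e / 2 / (rnorm k + 1) by rewrite !divr_gt0.
have e2 : 0 < e / 2 by rewrite divr_gt0.
have small x : x < e / 2 / (rnorm k + 1) -> 0 <= x -> rnorm k * x < e / 2.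
  move=> xe x0; rewrite ltr_pdivlMr // in xe; apply: le_lt_trans xe.
  by rewrite mulrC ler_wpM2l // lerDl.
have [f [cf fa fb]] := ab _ e1; have [h [ch hc hd]] := cd _ e2.
exists (k *: f + h); split; first exact: convAlgP.
  rewrite (completion_linear i1P) //; apply: le_lt_trans (rnorm_lin _ _ _ _ _) _.
  by have := small _ fa (rnorm_ge0 _); lra.
rewrite (completion_linear i2P) //; apply: le_lt_trans (rnorm_lin _ _ _ _ _) _.
by have := small _ fb (rnorm_ge0 _); lra.
Qed.

Let rnorm_mul (A : cstarAlgType R) (x y a b : A) (e C : R) : 0 < e -> e <= 1 ->
  rnorm a <= C -> rnorm b <= C ->
  rnorm (x - a) < e -> rnorm (y - b) < e -> rnorm (amul x y - amul a b) <= e * (2 * C + 1).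
Proof.
move=> e0 e1 aC bC xa yb.
have -> : amul x y - amul a b = amul (x - a) (y - b) + (amul (x - a) b + amul a (y - b)).
  rewrite !amulBl !amulBr; move: (amul _ _) (amul x b) (amul a y) (amul a b) => p s t u.
  by rewrite [s - u + _]addrC addrA subrK addrA subrK.
apply: le_trans (rnormD _ _) _; apply: le_trans (lerD (lexx _) (rnormD _ _)) _.
have h1 := rnorm_amul (x - a) (y - b); have h2 := rnorm_amul (x - a) b.
have h3 := rnorm_amul a (y - b).
have p1 : rnorm (x - a) * rnorm (y - b) <= e * 1.
  by apply: ler_pM; rewrite ?rnorm_ge0 ?ltW // (lt_le_trans yb).
have p2 : rnorm (x - a) * rnorm b <= e * C by apply: ler_pM; rewrite ?rnorm_ge0 ?(ltW xa).
have p3 : rnorm a * rnorm (y - b) <= C * e by apply: ler_pM; rewrite ?rnorm_ge0 ?(ltW yb).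
lra.
Qed.

Lemma comp_rel_mul a b c d : comp_rel a b -> comp_rel c d -> comp_rel (amul a c) (amul b d).
Proof.
move=> ab cd e e0.
pose C := rnorm a + rnorm b + rnorm c + rnorm d.
have [a0 b0 c0 d0] : [/\ 0 <= rnorm a, 0 <= rnorm b, 0 <= rnorm c & 0 <= rnorm d].
  by rewrite !rnorm_ge0.
have C0 : 0 <= C by rewrite !addr_ge0.
have [Ca [Cb [Cc Cd]]] : rnorm a <= C /\ rnorm b <= C /\ rnorm c <= C /\ rnorm d <= C.
  by rewrite /C; do ![split]; lra.
pose e' := Num.min 1 (e / (2 * C + 2)).
have C2 : 0 < 2 * C + 2 by lra.
have e'0 : 0 < e' by rewrite lt_min ltr01 divr_gt0.
have e'1 : e' <= 1 by rewrite ge_min lexx.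
have e'e : e' * (2 * C + 1) < e.
  have : e' <= e / (2 * C + 2) by rewrite ge_min lexx orbT.
  rewrite ler_pdivlMr //; lra.
have [f [cf fa fb]] := ab _ e'0; have [h [ch hc hd]] := cd _ e'0.
exists (conv f h); split; first exact: convAlg_conv.
  by rewrite (completion_mul i1P) //; apply: le_lt_trans (rnorm_mul e'0 e'1 Ca Cc fa hc) e'e.
by rewrite (completion_mul i2P) //; apply: le_lt_trans (rnorm_mul e'0 e'1 Cb Cd fb hd) e'e.
Qed.

Lemma comp_rel_star a b : comp_rel a b -> comp_rel (astar a) (astar b).
Proof.
have astarB (A : cstarAlgType R) (x y : A) : astar x - astar y = astar (x - y).
  have := astar_semilinear (-1) y x; rewrite rmorphN1 !scaleN1r => E.
  by rewrite addrC -E addrC.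
move=> ab e /ab[f [cf fa fb]]; exists (conv_star f); split.
- exact: convAlg_star.
- by rewrite (completion_star i1P) // astarB rnorm_astar.
- by rewrite (completion_star i2P) // astarB rnorm_astar.
Qed.

Hypothesis i12 : forall f, convAlg f -> rnorm (i2 f) <= rnorm (i1 f).

Lemma comp_rel_norm a b : comp_rel a b -> rnorm b <= rnorm a.
Proof.
move=> ab; rewrite leNgt; apply/negP => lt.
have e0 : 0 < (rnorm b - rnorm a) / 2 by rewrite divr_gt0 // subr_gt0.
have [f [cf fa fb]] := ab _ e0; have := i12 cf.
have := rnorm_tri (i2 f) b 0; have := rnorm_tri a (i1 f) 0.
rewrite !subr0 [rnorm (b - _)]rnormBC; lra.
Qed.

Lemma comp_rel_total a : exists b, comp_rel a b.
Proof.
have pos n : 0 < n.+1%:R^-1 :> R by rewrite invr_gt0 ltr0n.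
have ex n : {f | convAlg f /\ rnorm (i1 f - a) < n.+1%:R^-1}.
  by apply: cid; have [f cf fa] := completion_dense i1P a (pos n); exists f.
pose s n := sval (ex n); have sP n : convAlg (s n) /\ rnorm (i1 (s n) - a) < n.+1%:R^-1.
  exact: (svalP (ex n)).
(* For m >= n the terms differ by at most 1/(m+1) + 1/(n+1), whence the factor 2. *)
have [||b bP] := @rnorm_complete R A2 (fun n => i2 (s n)) (fun n => 2 * n.+1%:R^-1).
- move=> n m nm; have [[cn na] [cm ma]] := (sP n, sP m).
  rewrite -(completionB i2P) //; apply: le_trans (i12 _) _; first exact: convAlgB.
  rewrite (completionB i1P) //; apply: le_trans (rnorm_tri a _ _) _.
  have : m.+1%:R^-1 <= n.+1%:R^-1 :> R by rewrite lef_pV2 ?posrE ?ltr0n // ler_nat.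
  move: na ma; rewrite [rnorm (a - _)]rnormBC.
  move: (m.+1%:R^-1 : R) (n.+1%:R^-1 : R) => u v; lra.
- rewrite -(mulr0 2); apply: cvgM; first exact: cvg_cst.
  exact: cvg_harmonic.
exists b => e e0.
pose n := Num.bound (2 / e); have ne : 2 * n.+1%:R^-1 < e.
  rewrite ltr_pdivrMr ?ltr0n // mulrC -ltr_pdivrMr //.
  apply: (@lt_trans _ _ n%:R); last by rewrite ltr_nat.
  by apply: archi_boundP; rewrite divr_ge0 // ltW.
have [cn na] := sP n; exists (s n); split => //.
  apply: (lt_trans na); apply: le_lt_trans ne.
  by rewrite ler_peMl ?ler1n // ltW // pos.
by rewrite rnormBC; apply: le_lt_trans (bP n) ne.
Qed.

Lemma comp_rel_unique a b b' : comp_rel a b -> comp_rel a b' -> b = b'.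
Proof.
move=> ab ab'; have := comp_rel_norm (comp_rel_linear (-1) ab' ab).
rewrite !scaleN1r addNr rnorm0 => le0; apply/eqP; rewrite -subr_eq0; apply/eqP.
apply: rnorm0_eq0; apply/le_anti; rewrite rnorm_ge0 andbT.
by rewrite addrC in le0.
Qed.

Lemma completion_map : exists q : A1 -> A2,
  [/\ star_hom (@amul R A1) (@astar R A1) [set: A1] q, continuous q,
      forall f, convAlg f -> q (i1 f) = i2 f &
      forall a b, comp_rel a b <-> q a = b].
Proof.
pose q a := sval (cid (comp_rel_total a)).
have qP a : comp_rel a (q a) by exact: (svalP (cid (comp_rel_total a))).
have qE a b : comp_rel a b -> q a = b by apply: comp_rel_unique.
exists q; split.
- split.
  + by move=> k a b _ _; apply: qE; exact: comp_rel_linear.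
  + by move=> a b _ _; apply: qE; exact: comp_rel_mul.
  + by move=> a _; apply: qE; exact: comp_rel_star.
- move=> a; apply/continuous_rnorm => e e0; apply/nbhs_rnorm; exists e => // y ay.
  apply: le_lt_trans ay; apply: comp_rel_norm.
  by have := comp_rel_linear (-1) (qP y) (qP a); rewrite !scaleN1r ![- _ + _]addrC.
- by move=> f cf; apply: qE; exact: comp_rel_map.
- by move=> a b; split=> [/qE //|<-].
Qed.

(* A continuous extension of [i1 f |-> i2 f] is the graph of [comp_rel]. *)
Lemma comp_rel_canonical (q : A1 -> A2) a b : continuous q ->
  (forall f, convAlg f -> q (i1 f) = i2 f) -> comp_rel a b -> q a = b.
Proof.
move=> cq qi ab; apply/eqP; rewrite -subr_eq0; apply/eqP/rnorm_small => e e0.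
have e2 : 0 < e / 2 by rewrite divr_gt0.
have /continuous_rnorm/(_ _ e2)/nbhs_rnorm[d d0 dP] := cq a.
have m0 : 0 < Num.min d (e / 2) by rewrite lt_min d0.
have [f [cf]] := ab _ m0; rewrite !lt_min => /andP[fa _] /andP[_ fb].
have := dP (i1 f); rewrite rnormBC => /(_ fa) /=; rewrite qi // => qf.
have := rnorm_tri (i2 f) (q a) b; lra.
Qed.

End CompletionMap.

Section FullEqReduced.
Context {R : realType} {G : topGroupoidType} (het : etale G)
  (hT2 : hausdorff_space (set_type (@units G))).
Variables (A : full_cstar R G) (B : red_cstar R G).

Lemma kernel_full_norm (q : A -> B) : canonical_map q -> (forall a, q a = 0 -> a = 0) ->
  forall f, convAlg f -> rnorm (full_map A f) = rnorm (red_map B f).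
Proof.
move=> [qh cq qi] q0; apply: full_norm_eq_red => // a small; apply: q0.
apply: (comp_rel_canonical (i1 := full_map A) (i2 := red_map B) cq qi) => e /small[f [cf fa fb]].
by exists f; rewrite subr0.
Qed.

(** With equal norms the approximation relation defines maps in both directions. It is symmetric in
    the two completions, so these maps are mutually inverse. *)
Lemma norm_full_eq_reduced :
  (forall f, convAlg f -> rnorm (full_map A f) = rnorm (red_map B f)) ->
  exists2 q : A -> B, canonical_map q & exists q' : B -> A,
    [/\ star_hom (@amul R B) (@astar R B) [set: B] q', continuous q', cancel q q' & cancel q' q].
Proof.
move=> iso.
have [|q [qh cq qi qE]] := completion_map het hT2 (full_mapP A) (red_mapP B).
  by move=> f cf; rewrite iso.
have [|q' [qh' cq' qi' qE']] := completion_map het hT2 (red_mapP B) (full_mapP A).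
  by move=> f cf; rewrite iso.
exists q => //; exists q'; split => //.
- move=> a; apply/qE' => e e0; have [f [cf fa fb]] := (qE a (q a)).2 erefl e e0.
  by exists f.
- move=> b; apply/qE => e e0; have [f [cf fa fb]] := (qE' b (q' b)).2 erefl e e0.
  by exists f.
Qed.

(** The kernel of A -> B is 0 or A. In the second case every [f] in C(G) has zero image in B and
    hence is zero, so A = 0 by density and the kernel is trivial all the same. *)
Lemma simple_full_norm : simple_cstar A ->
  forall f, convAlg f -> rnorm (full_map A f) = rnorm (red_map B f).
Proof.
move=> sA; have [|q [qh cq qi qE]] := completion_map het hT2 (full_mapP A) (red_mapP B).
  by move=> f cf; exact: red_le_full.
apply: (kernel_full_norm (q := q)) => // a qa.
have [E|E] := sA _ (star_hom_preimage qh cq (closed_ideal_set0 (A2 := B))).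
  by have : (q @^-1` [set 0]) a by []; rewrite E.
have fz f : convAlg f -> full_map A f = 0.
  move=> cf; rewrite (red_inj het cf (B := B)); first exact: (completion0 (full_mapP A)).
  by have : (q @^-1` [set 0]) (full_map A f) by [rewrite E]; rewrite /= qi.
apply: rnorm_small => e e0; have [f cf] := completion_dense (full_mapP A) a e0.
by rewrite fz // sub0r rnormN.
Qed.

Lemma simple_full_red :
  (forall f, convAlg f -> rnorm (full_map A f) = rnorm (red_map B f)) ->
  simple_cstar A <-> simple_cstar B.
Proof.
move=> /norm_full_eq_reduced[q [qh cq _] [q' [qh' cq' qK q'K]]]; split.
  by apply: (simple_image qh cq) => b; exists (q' b).
by apply: (simple_image qh' cq') => a; exists (q a).
Qed.

End FullEqReduced.

(** * The augmentation representation and effectiveness *)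

Section InnerBound.
Context {R : realType} {H : hilbertType R}.
Implicit Types x y : H.

Lemma inner_linearB x y z : inner (x - y) z = inner x z - inner y z.
Proof.
have := inner_linearl z (-1) y x; rewrite scaleN1r [- y + x]addrC => ->.
by rewrite mulN1r addrC.
Qed.

(** The real and imaginary parts are bounded separately. The constant 2 is not sharp, but only
    boundedness matters for extending identities from basis vectors. *)
Lemma rnorm_inner x y : rnorm (inner x y) <= 2 * (rnorm x * rnorm y).
Proof.
have re u : `|rinner u y| <= rnorm u * rnorm y.
  rewrite ler_norml rinner_le andbT lerNl -rinnerNl.
  by apply: le_trans (rinner_le _ _) _; rewrite rnormN.
have re1 : `|complex.Re (inner x y)| <= rnorm x * rnorm y := re x.
have im1 : `|complex.Im (inner x y)| <= rnorm x * rnorm y.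
  have -> : complex.Im (inner x y) = rinner ((0 +i* (-1)) *: x) y.
    have := inner_linearl y (0 +i* (-1)) x 0; rewrite addr0 /rinner => ->.
    have -> : inner 0 y = 0 by have := inner_linearB 0 0 y; rewrite !subrr.
    by rewrite addr0; case: (inner x y) => a b /=; ring.
  apply: le_trans (re _) _; rewrite rnormZ.
  have -> : rnorm ((0 : R) +i* (-1)) = 1; last by rewrite mul1r.
  by rewrite /rnorm normc_def /= expr0n add0r sqrrN expr1n sqrtr1.
rewrite -(@ler_pXn2r _ 2) ?nnegrE ?mulr_ge0 ?rnorm_ge0 // rnorm_sqr /normsq.
have p0 : 0 <= rnorm x * rnorm y by rewrite mulr_ge0 ?rnorm_ge0.
move: re1 im1 p0; set a := complex.Re _; set b := complex.Im _; set c := rnorm x * _.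
move=> ac bc c0; have : `|a| ^+ 2 <= c ^+ 2 by rewrite lerXn2r ?nnegrE.
have : `|b| ^+ 2 <= c ^+ 2 by rewrite lerXn2r ?nnegrE.
rewrite !real_normK ?num_real // => hb ha; apply: le_trans (lerD ha hb) _.
have -> : (2 * c) ^+ 2 = c ^+ 2 + c ^+ 2 + 2 * c ^+ 2 by ring.
by rewrite lerDl mulr_ge0 ?sqr_ge0.
Qed.

End InnerBound.

Section Augmentation.
Context {R : realType} {G : topGroupoidType} (het : etale G)
  (hT2 : hausdorff_space (set_type (@units G))).
Implicit Types (f h : G -> R[i]) (g u : G) (x y : ell2 R G).

Definition aug_fun f (x : G -> R[i]) : G -> R[i] := fiber_sum f (fun g => x (gsrc g)).

(** The Hilbert space is that of all arrows; basis vectors at arrows that are not units are sent to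
    0. The default 0 of [insubd] never occurs for [f] in C(G), by [augE]. *)
Definition aug f x : ell2 R G := insubd (0 : ell2 R G) (aug_fun f x).

(** A function on a bisection acts as a weighted bijection from sources to ranges, so a bound for
    |f| bounds its norm. Both sums are reindexed over U. *)
Let aug_bis U f : open_bisection U -> Cc U f -> exists M : R, 0 <= M /\
  forall x, (sum_normsq (aug_fun f x) <= (M ^+ 2)%:E * sum_normsq x)%E.
Proof.
move=> bU cf; have [M [M0 fM]] := Cc_bounded het bU cf.
have [rU sU] := (bis_rinj het bU, bis_sinj het bU).
exists M; split => // x; rewrite /sum_normsq (esumID (@grng G @` U)); last first.
  by move=> y _; rewrite lee_fin normsq_ge0.
rewrite !setTI [X in (_ + X)%E]esum1 ?adde0; last first.
  move=> y /= nU; rewrite /aug_fun (fiber_sum0 (U := U)) ?normsq0 //.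
    by move=> g; exact: Cc_off.
  by move=> g Ug gy; apply: nU; exists g.
rewrite -esumZl ?sqr_ge0 //; last by move=> y; exact: normsq_ge0.
rewrite [leRHS](esumID (@gsrc G @` U)); last first.
  by move=> y _; rewrite lee_fin mulr_ge0 ?sqr_ge0 ?normsq_ge0.
apply: (@le_trans _ _ (\esum_(y in @gsrc G @` U) (M ^+ 2 * normsq (x y))%:E)%E); last first.
  by rewrite setTI leeDl // esum_ge0 // => y _; rewrite lee_fin mulr_ge0 ?sqr_ge0 ?normsq_ge0.
rewrite (reindex_esum U (@grng G @` U) (@grng G)); last first.
  split => [g Ug|g h /set_mem Ug /set_mem Uh|y [g Ug <-]]; [by exists g|exact: rU|by exists g].
rewrite (reindex_esum U (@gsrc G @` U) (@gsrc G)); last first.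
  split => [g Ug|g h /set_mem Ug /set_mem Uh|y [g Ug <-]]; [by exists g|exact: sU|by exists g].
apply: le_esum => g Ug; rewrite lee_fin /aug_fun.
rewrite (fiber_sum_bis _ rU _ Ug) //; last by move=> k; exact: Cc_off.
rewrite normsqM ler_wpM2r ?normsq_ge0 // -rnorm_sqr.
by rewrite lerXn2r ?nnegrE ?rnorm_ge0.
Qed.

Lemma aug_bound f : convAlg f -> exists C : R, 0 <= C /\
  forall x, exists y, ell2_fun y = aug_fun f x /\ rnorm y <= C * rnorm x.
Proof.
elim/(@convAlg_ind R G) => [|c h k ch ck [C [C0 hC]] [D [D0 kD]]|U h bU ch].
- exists 0; split => // x; exists 0; rewrite rnorm0 mul0r; split => //.
  by apply/funext => y; rewrite /aug_fun /fiber_sum fsbig1 // => g _; rewrite mul0r.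
- exists (rnorm c * C + D); split; first by rewrite addr_ge0 ?mulr_ge0 ?rnorm_ge0.
  move=> x; have [y [yE yn]] := hC x; have [z [zE zn]] := kD x.
  exists (c *: y + z); split.
    apply/funext => g; rewrite /aug_fun fiber_sumPl; last 2 first.
    + exact: convAlg_rng_finite.
    + exact: convAlg_rng_finite.
    by rewrite -[LHS]/(c * ell2_fun y g + ell2_fun z g) yE zE.
  apply: le_trans (rnormD _ _) _; rewrite rnormZ mulrDl -mulrA lerD //.
  by rewrite ler_wpM2l ?rnorm_ge0.
have [M [M0 hM]] := aug_bis bU ch; exists M; split => // x.
have in2 : aug_fun h x \in @ell2_pred R G.
  apply/ell2P; apply: le_lt_trans (hM x) _.
  by rewrite lte_mul_pinfty ?lee_fin ?sqr_ge0 ?ell2_lt.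
exists (Ell2 in2); split => //.
rewrite -(@ler_pXn2r _ 2) ?nnegrE ?mulr_ge0 ?rnorm_ge0 // exprMn.
change (ell2_rnorm (Ell2 in2) ^+ 2 <= M ^+ 2 * ell2_rnorm x ^+ 2).
have := hM x; have -> : sum_normsq (aug_fun h x) = sum_normsq (Ell2 in2) by [].
by rewrite -!ell2_rnorm_sqr -EFinM lee_fin.
Qed.

Lemma augE f x : convAlg f -> ell2_fun (aug f x) = aug_fun f x.
Proof.
move=> cf; have [C [_ H]] := aug_bound cf; have [y [yE _]] := H x.
by rewrite /aug -[LHS]/(val (insubd _ _)) insubdK // -yE; exact: (valP y).
Qed.

Lemma aug_rnorm f : convAlg f -> exists C : R, 0 <= C /\
  forall x, rnorm (aug f x) <= C * rnorm x.
Proof.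
move=> cf; have [C [C0 H]] := aug_bound cf; exists C; split => // x.
have [y [yE yC]] := H x; suff -> : aug f x = y by [].
by apply: val_inj; rewrite /= augE.
Qed.

Lemma aug_linear f : convAlg f -> linear (aug f).
Proof.
move=> cf k x y; apply: val_inj; rewrite /= augE //; apply/funext => g.
rewrite -[RHS]/(k * ell2_fun (aug f x) g + ell2_fun (aug f y) g) !augE //.
rewrite -fiber_sumPr //; exact: convAlg_rng_finite.
Qed.

(** For [f] on a bisection and e its arrow with range y, left translation by e is a bijection from
    the fibre over s(e) to the fibre over y. *)
Lemma aug_fun_conv f h (x : G -> R[i]) : convAlg f -> convAlg h ->
  aug_fun (conv f h) x = aug_fun f (aug_fun h x).
Proof.
move=> + ch; elim/(@convAlg_ind R G) => [|c k l ck cl IHk IHl|U k bU ck].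
- rewrite conv0l; apply/funext => y; rewrite /aug_fun /fiber_sum !fsbig1 // => g _;
  by rewrite mul0r.
- rewrite convPl //; apply/funext => y; rewrite /aug_fun !fiber_sumPl;
    try by apply: convAlg_rng_finite => //; exact: convAlg_conv.
  have /(congr1 (fun z => z y)) := IHk; have /(congr1 (fun z => z y)) := IHl.
  by rewrite /aug_fun => -> ->.
apply/funext => y; rewrite /aug_fun.
have [[e [Ue ey]]|nU] := pselect (exists e, U e /\ grng e = y); last first.
  have H e : U e -> grng e <> y by move=> Ue ey; apply: nU; exists e.
  rewrite [RHS](fiber_sum0 (U := U)) //; last by move=> g; exact: Cc_off.
  rewrite /fiber_sum fsbig1 // => g /= gy.
  by rewrite (conv_bis0 h ck) ?mul0r // => e Ue; rewrite gy; exact: H.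
rewrite [RHS](fiber_sum_bis _ (bis_rinj het bU) _ Ue) //; last by move=> g; exact: Cc_off.
rewrite /fiber_sum mulr_fsumr.
rewrite (reindex_fsbig (gmul e) [set g | grng g = gsrc e]); last first.
  split.
  - by move=> g /= ge; rewrite grng_mul // ge.
  - move=> g h' /set_mem /= ge /set_mem /= he E.
    by rewrite -(gmulKg (esym ge)) E gmulKg.
  - move=> g /= gy; exists (gmul (ginv e) g); last by rewrite gmulKVg // ey.
    by rewrite /= grng_mul ?grng_inv // gsrc_inv ey.
apply: eq_fsbigr => g /set_mem /= ge.
rewrite (conv_bisE het h bU ck Ue) ?grng_mul ?ge //.
by rewrite gmulKg ?ge // gsrc_mul ?ge // mulrA.
Qed.

Lemma aug_delta f u v : convAlg f -> ell2_fun (aug f (delta R u)) v =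
  \sum_(g \in [set g | [/\ grng g = v, gsrc g = u & f g <> 0]]) f g.
Proof.
move=> cf; rewrite augE // /aug_fun /fiber_sum.
rewrite (fsum_sub (S := [set g | [/\ grng g = v, gsrc g = u & f g <> 0]])) //; last 2 first.
- by move=> g [].
- move=> g gv nS; rewrite deltaE; case: eqP => [gu|]; last by rewrite mulr0.
  by rewrite mulr1; apply: contrapT => f0; apply: nS.
by apply: eq_fsbigr => g /set_mem [_ gu _]; rewrite deltaE gu eqxx mulr1.
Qed.

Let aug_star_delta f u v : convAlg f ->
  ell2_fun (aug (conv_star f) (delta R u)) v = conjc (ell2_fun (aug f (delta R v)) u).
Proof.
move=> cf; rewrite !aug_delta //; last exact: convAlg_star.
set S := [set g | [/\ grng g = u, gsrc g = v & f g <> 0]].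
have fS : finite_set S.
  by apply: sub_finite_set (convAlg_rng_finite het cf u) => g [].
rewrite (reindex_fsbig (@ginv G) S); last first.
  split.
  - move=> g [gu gv f0] /=; rewrite grng_inv gsrc_inv; split => //.
    rewrite /conv_star ginvK => E; apply: f0; apply: rnorm0_eq0.
    by rewrite -rnorm_conj E rnorm0.
  - by move=> g h _ _ E; rewrite -(ginvK g) E ginvK.
  - move=> g [gv gu f0]; exists (ginv g); last exact: ginvK.
    rewrite /S /= grng_inv gsrc_inv; split => // E; apply: f0.
    by rewrite /conv_star E conjc0.
rewrite !fsbig_finite // [in RHS]raddf_sum /=.
by apply: eq_bigr => g _; rewrite /conv_star ginvK.
Qed.

(** On basis vectors this is the reindexing by inversion of [aug_star_delta]. Boundedness extends it
    by [ell2_ext], to the second variable and then to the first. *)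
Lemma aug_star f x y : convAlg f ->
  inner (aug (conv_star f) x) y = inner x (aug f y).
Proof.
move=> cf; have cs := convAlg_star het cf.
have [C [C0 fC]] := aug_rnorm cf; have [D [D0 sD]] := aug_rnorm cs.
have conj_inner (z w : ell2 R G) : inner z w = conjc (inner w z) by exact: inner_conj.
have bd (F : ell2 R G -> ell2 R G) (K : R) (z w : ell2 R G) : 0 <= K ->
    (forall a, rnorm (F a) <= K * rnorm a) ->
    rnorm (inner (F z) w) <= 2 * K * rnorm w * rnorm z.
  move=> K0 FK; apply: le_trans (rnorm_inner _ _) _.
  have := ler_wpM2r (rnorm_ge0 w) (FK z); lra.
have dl u v : inner (aug (conv_star f) (delta R u)) v = inner (delta R u) (aug f v).
  suff E : inner v (aug (conv_star f) (delta R u)) - inner (aug f v) (delta R u) = 0.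
    by move/eqP: E; rewrite subr_eq0 => /eqP E; rewrite conj_inner E -conj_inner.
  apply: (@ell2_ext R G R[i]^o (fun v =>
      inner v (aug (conv_star f) (delta R u)) - inner (aug f v) (delta R u))
    (2 * 1 * rnorm (aug (conv_star f) (delta R u)) + 2 * C * rnorm (delta R u))) => [k a b|a|w].
  - by rewrite aug_linear // !inner_linearl opprD addrACA -mulrBr.
  - apply: le_trans (rnormB _ _) _; rewrite mulrDl; apply: lerD.
      by apply: (bd id) => // z; rewrite mul1r.
    exact: bd.
  - rewrite inner_delta conj_inner inner_delta aug_star_delta // conjcK.
    by rewrite subrr.
apply/eqP; rewrite -subr_eq0; apply/eqP.
apply: (@ell2_ext R G R[i]^o (fun x => inner (aug (conv_star f) x) y - inner x (aug f y))
    (2 * D * rnorm y + 2 * 1 * rnorm (aug f y))) => [k a b|a|w].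
- by rewrite aug_linear // !inner_linearl opprD addrACA -mulrBr.
- apply: le_trans (rnormB _ _) _; rewrite mulrDl; apply: lerD; first exact: bd.
  by apply: (bd id) => // z; rewrite mul1r.
- by rewrite dl subrr.
Qed.

Lemma aug_star_rep : star_rep (@conv R G) (@conv_star R G) (@convAlg R G) aug.
Proof.
split.
- move=> f cf; have [C [C0 fC]] := aug_rnorm cf.
  exact: bound_bounded_operator (aug_linear cf) fC.
- move=> k f h cf ch; apply/funext => x; apply: val_inj.
  rewrite /= augE; last exact: convAlgP.
  apply/funext => g; rewrite /aug_fun fiber_sumPl; try exact: convAlg_rng_finite.
  by rewrite -[RHS]/(k * ell2_fun (aug f x) g + ell2_fun (aug h x) g) !augE.
- move=> f h cf ch; apply/funext => x; apply: val_inj.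
  by rewrite /= !augE ?aug_fun_conv //; exact: convAlg_conv.
- by move=> f cf x y; exact: aug_star.
Qed.

End Augmentation.

Section Effective.
Context {R : realType} {G : topGroupoidType} (het : etale G)
  (hT2 : hausdorff_space (set_type (@units G))) (hlc : loc_compact G).
Variables (A : full_cstar R G) (B : red_cstar R G).
Implicit Types (f h : G -> R[i]) (g u : G) (U V W K : set G).

(* The function [f] transported from a bisection of isotropy elements to their sources has the
   same image as [f] under the augmentation representation. *)
Lemma aug_isotropy U f g : open_bisection U -> U `<=` isotropy (G:=G) -> Cc U f ->
  U g -> ~ units g -> exists f', [/\ convAlg f', f' g = 0 &
    forall x : ell2 R G, aug f x = aug f' x].
Proof.
move=> bU Uiso cf Ug nug; pose V := @gsrc G @` U.
have oU := bis_open het bU; have sU := bis_sinj het bU; have rU := bis_rinj het bU.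
have oV : open V by have [_ _] := src_etale het; apply.
have Vu : V `<=` @units G by move=> _ [h _ <-]; exact: units_src.
have bV : open_bisection V := bis_sub het (bis_units het) oV Vu.
pose f' (h : G) : R[i] := if pselect (V h) then f (gsec (@gsrc G) U h) else 0.
have f'E (e : G) : U e -> f' (gsrc e) = f e.
  move=> Ue; rewrite /f'; case: pselect => [Ve|]; first by rewrite gsecK.
  by case; exists e.
have f'0 (h : G) : ~ V h -> f' h = 0 by rewrite /f'; case: pselect.
have cf' : Cc V f'.
  have /(CcP _ oU)[ff [K [cK KU K0]]] := cf; apply/(CcP _ oV); split.
    move=> _ [e Ue <-].
    apply: contC_near (_ : contC (fun h : G => f (gsec (@gsrc G) U h)) (gsrc e)).
      have : nbhs (gsrc e) V by apply: open_nbhs_nbhs; split => //; exists e.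
      by apply: filterS => h Vh; rewrite /f'; case: pselect.
    apply: (contC_comp (a := gsec (@gsrc G) U)); last by rewrite gsecK //; exact: ff.
    by apply: gsec_continuous => //; exact: src_etale.
  exists (@gsrc G @` K); split.
  - apply: continuous_compact cK; apply: continuous_subspaceT; exact: src_continuous.
  - by move=> _ [e Ke <-]; exists e => //; exact: KU.
  - move=> h nK; have [[e Ue eh]|nV] := pselect (V h); last exact: f'0.
    rewrite -eh f'E // K0 // => Ke; apply: nK; by exists e.
have cAf := convAlg_Cc bU cf; have cAf' := convAlg_Cc bV cf'.
exists f'; split => //; first by apply: f'0 => /Vu.
move=> x; apply: val_inj; rewrite /= !augE //; apply/funext => y; rewrite /aug_fun.
have [[e [Ue ey]]|nU] := pselect (exists e, U e /\ grng e = y).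
  have ry : gsrc e = y by rewrite -ey; exact/esym/Uiso.
  rewrite (fiber_sum_bis _ rU _ Ue) //; last by move=> h; exact: Cc_off.
  rewrite -ry (fiber_sum_bis (U := V) _ _ f'0 (g := gsrc e)) ?f'E ?gsrc_src ?grng_src //.
    exact: (bis_rinj het bV).
  by exists e.
rewrite (fiber_sum0 (U := U)); last 2 first.
- by move=> h; exact: Cc_off.
- by move=> e Ue ey; apply: nU; exists e.
rewrite (fiber_sum0 (U := V)) // => _ [e Ue <-]; rewrite grng_src => ey.
by apply: nU; exists e; split => //; rewrite -ey; exact: Uiso.
Qed.

(** This is the closure in A of the functions killed by [aug], which spares extending [aug] to A. An
    arbitrary factor of a product is approximated from C(G). *)
Lemma aug_kernel_ideal : closed_ideal [set a : A | forall e : R, 0 < e -> exists k,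
  [/\ convAlg k, forall x : ell2 R G, aug k x = 0 & rnorm (full_map A k - a) < e]].
Proof.
have fP := full_mapP A; have aP := aug_star_rep het hT2 (R := R).
have cc := convAlg_conv het hT2 (R := R).
have approx (a b : A) (e : R) : 0 < e -> exists2 d : R, 0 < d & forall x y : A,
    rnorm (x - a) < d -> rnorm (y - b) < d -> rnorm (amul x y - amul a b) < e.
  (* One unit of the 2 allows for the norm of y being at most 1 more than that of b; the other
     leaves a margin e / C for strictness. *)
  move=> e0; pose C := rnorm a + rnorm b + 2.
  have C0 : 0 < C by rewrite ltr_wpDl ?addr_ge0 ?rnorm_ge0.
  exists (Num.min 1 (e / C)); first by rewrite lt_min ltr01 divr_gt0.
  move=> x y; rewrite !lt_min => /andP[xa1 xa] /andP[yb1 yb].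
  have -> : amul x y - amul a b = amul (x - a) y + amul a (y - b).
    by rewrite amulBl amulBr addrA subrK.
  apply: le_lt_trans (rnormD _ _) _.
  have yn : rnorm y <= rnorm b + 1.
    by have := rnorm_tri b y 0; rewrite !subr0; lra.
  have h1 : rnorm (amul (x - a) y) <= e / C * (rnorm b + 1).
    apply: le_trans (rnorm_amul _ _) _; apply: ler_pM; rewrite ?rnorm_ge0 // ltW //.
  have h2 : rnorm (amul a (y - b)) <= rnorm a * (e / C).
    apply: le_trans (rnorm_amul _ _) _; apply: ler_pM; rewrite ?rnorm_ge0 // ltW //.
  have -> : e = e / C * (rnorm b + 1) + rnorm a * (e / C) + e / C.
    by rewrite [rnorm a * _]mulrC -mulrDr -[X in _ + X]mulr1 -mulrDr /C; field; rewrite gt_eqF.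
  have : 0 < e / C by rewrite divr_gt0.
  lra.
split.
- apply/closed_rnorm => a H e e0; have e2 : 0 < e / 2 by rewrite divr_gt0.
  have [b Jb ab] := H _ e2; have [k [ck k0 kb]] := Jb _ e2.
  exists k; split => //; have := rnorm_tri b (full_map A k) a.
  by rewrite [rnorm (b - a)]rnormBC; lra.
- move=> e e0; exists 0; split; first exact: convAlg0.
    by move=> x; rewrite (rep0 aP).
  by rewrite (completion0 fP) subrr rnorm0.
- move=> k a b Ja Jb e e0; have k0 := rnorm_ge0 k; have k1 : 0 < rnorm k + 1 by rewrite ltr_wpDl.
  have e2 : 0 < e / 2 by rewrite divr_gt0.
  have e1 : 0 < e / 2 / (rnorm k + 1) by rewrite divr_gt0.
  have [f [cf f0 fa]] := Ja _ e1; have [h [ch h0 hb]] := Jb _ e2.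
  exists (k *: f + h); split; first exact: convAlgP.
    by move=> x; rewrite (rep_linear aP) // f0 h0 scaler0 addr0.
  rewrite (completion_linear fP) // opprD addrACA -scalerBr.
  apply: le_lt_trans (rnormD _ _) _; rewrite rnormZ.
  have : rnorm k * rnorm (full_map A f - a) < e / 2.
    rewrite ltr_pdivlMr // in fa; apply: le_lt_trans fa.
    by rewrite mulrC ler_wpM2l ?rnorm_ge0 // lerDl.
  lra.
- move=> a b Jb e e0; have [d d0 dP] := approx a b e e0.
  have [f cf fa] := completion_dense fP a d0; have [k [ck k0 kb]] := Jb _ d0.
  exists (conv f k); split; first exact: cc.
    move=> x; rewrite (rep_conv aP) // k0.
    by have := rep_lin aP cf (-1) 0 0; rewrite scaler0 addr0 scaleN1r addNr.
  by rewrite (completion_mul fP) //; exact: dP.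
- move=> a b Ja e e0; have [d d0 dP] := approx a b e e0.
  have [f cf fb] := completion_dense fP b d0; have [k [ck k0 ka]] := Ja _ d0.
  exists (conv k f); split; first exact: cc.
    by move=> x; rewrite (rep_conv aP) // k0.
  by rewrite (completion_mul fP) //; exact: dP.
Qed.

Lemma simple_effective : simple_cstar A -> effective G.
Proof.
move=> sA; apply/seteqP; split; last first.
  move=> u uu; apply/nbhs_openP; exists (@units G); split => //; first exact: units_open.
  by move=> h uh; rewrite /isotropy /= rng_unit // src_unit.
move=> g /nbhs_openP[P [oP Pg Piso]]; apply: contrapT => nug.
have [_ /(_ g P (open_nbhs_nbhs (conj oP Pg)))] := het; move=> [U [bU Ug] UP].
have [f cf fg] := Cc_bump (R := R) het hT2 hlc bU Ug.
have cAf := convAlg_Cc bU cf.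
have [f' [cf' f'g E]] := aug_isotropy bU (subset_trans UP Piso) cf Ug nug.
have aP := aug_star_rep het hT2 (R := R); have fP := full_mapP A.
have cB := convAlgB cAf cf'.
have [J0|JT] := sA _ aug_kernel_ideal.
  have : [set 0 : A] (full_map A (f - f')).
    rewrite -J0 => e e0; exists (f - f'); split => //; last by rewrite subrr rnorm0.
    by move=> x; rewrite (repB aP) // E subrr.
  move=> /= F0; have : red_map B (f - f') = 0.
    apply: rnorm0_eq0; apply/le_anti; rewrite rnorm_ge0 andbT.
    by have := red_le_full A B cB; rewrite F0 rnorm0.
  move=> /(red_inj het cB)/(congr1 (fun h => h g)).
  rewrite -[LHS]/(f g - f' g) fg f'g subr0 => /eqP.
  by rewrite oner_eq0.
(* It remains to exclude that the ideal is all of A. It would then contain the image of a bump [h]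
   at s(g), within 1/2 of some [k] killed by [aug], although a matrix entry of [aug h] equals 1. *)
have us := units_src g.
have [h ch hg] := Cc_bump (R := R) het hT2 hlc (bis_units het) us.
have cAh := convAlg_Cc (bis_units het) ch.
have e2 : 0 < 2^-1 :> R by rewrite invr_gt0.
have : [set: A] (full_map A h) by []. rewrite -JT => /(_ _ e2)[k [ck k0 kh]].
have := rep_le_full A (delta R (gsrc g)) aP (convAlgB ck cAh).
rewrite (repB aP) // k0 sub0r rnormN rnorm_delta mulr1 (completionB fP) // => H.
have : rnorm (aug h (delta R (gsrc g)) (gsrc g)) < 2^-1.
  by apply: le_lt_trans (ell2_coord_rnorm _ _) _; exact: le_lt_trans H kh.
rewrite augE // /aug_fun (fiber_sum_bis (U := @units G) _ _ _ us).
- rewrite hg deltaE gsrc_src eqxx mulr1 rnorm_real normr1; lra.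
- exact: (bis_rinj het (bis_units het)).
- by move=> x; exact: Cc_off.
- exact: grng_src.
Qed.

End Effective.

(** * Minimality and supports *)

Section SimpleReduced.
Context {R : realType} {G : topGroupoidType} (het : etale G)
  (hT2 : hausdorff_space (set_type (@units G))) (hlc : loc_compact G).
Variables (B : red_cstar R G).
Implicit Types (f h : G -> R[i]) (g u : G) (U V W K O : set G).

Lemma red_rep_kernel_ideal u : units u ->
  closed_ideal [set b : B | forall x, red_rep (u := u) b x = 0].
Proof.
move=> hu; have [rbd rl rm rs] := red_repP B hu.
have r0 x : red_rep (u := u) (0 : B) x = 0.
  apply/rnorm0_eq0/le_anti; rewrite rnorm_ge0 andbT.
  by have := red_rep_rnorm hu (0 : B) x; rewrite rnorm0 mul0r.
split.
- apply/closed_rnorm => b H x; apply: rnorm_small => e e0.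
  have n0 : 0 < rnorm x + 1 by rewrite ltr_wpDl ?rnorm_ge0.
  have [c cJ bc] := H _ (divr_gt0 e0 n0).
  have -> : red_rep b x = red_rep (b - c) x.
    have -> : b - c = (-1) *: c + b by rewrite scaleN1r addrC.
    by rewrite (red_rep_linear hu) cJ scaler0 add0r.
  apply: le_lt_trans (red_rep_rnorm hu _ _) _.
  rewrite ltr_pdivlMr // in bc; apply: le_lt_trans bc.
  by rewrite ler_wpM2l ?rnorm_ge0 // lerDl.
- exact: r0.
- by move=> k a b ka kb x; rewrite (red_rep_linear hu) ka kb scaler0 addr0.
- move=> a b kb x; rewrite rm //= kb; have [linb _] := rbd a I.
  by have := linb (-1) 0 0; rewrite scaler0 addr0 scaleN1r addNr.
- by move=> a b ka x; rewrite rm //= ka.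
Qed.

Lemma red_rep_kernel_proper u : units u ->
  [set b : B | forall x, red_rep (u := u) b x = 0] <> [set: B].
Proof.
move=> hu E; have [h ch hu1] := Cc_bump (R := R) het hT2 hlc (bis_units het) hu.
have cAh := convAlg_Cc (bis_units het) ch.
have : [set: B] (red_map B h) by []. rewrite -E /= => H.
have fu : u \in [set g | gsrc g = u] by rewrite inE; exact: src_unit.
pose c : fiber u := SigSub fu.
have := red_rep_coef het hu (red_map B h) c c; rewrite H jmap_red //= .
by rewrite gmulgV rng_unit // hu1 => /eqP; rewrite eq_sym oner_eq0.
Qed.

Lemma simple_red_kernel u (b : B) : simple_cstar B -> units u ->
  (forall c d : fiber u, jmap b (gmul (val d) (ginv (val c))) = 0) -> b = 0.
Proof.
move=> sB hu j0; have [E|/red_rep_kernel_proper] := sB _ (red_rep_kernel_ideal hu); last by [].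
have : [set b : B | forall x, red_rep (u := u) b x = 0] b by exact: red_rep_eq0.
by rewrite E.
Qed.

Lemma simple_minimal : simple_cstar B -> minimal G.
Proof.
move=> sB u uu v uv; apply: contrapT => nv.
have [W [oW Wv Wo]] : exists W, [/\ open W, W v & W `&` orbit u = set0].
  apply: contrapT => H; apply: nv => N /nbhs_openP[W [oW Wv WN]].
  apply/set0P/negP => /eqP E; apply: H; exists W; split => //.
  apply/seteqP; split => // x [Wx ox]; have : (orbit u `&` N) x by split => //; exact: WN.
  by rewrite E.
pose W' := W `&` @units G.
have oW' : open W' by apply: openI => //; exact: units_open.
have bW' : open_bisection W' by apply: bis_sub (bis_units het) oW' _ => // x [].
have [h ch hv] := Cc_bump (R := R) het hT2 hlc bW' (conj Wv uv).
have cAh := convAlg_Cc bW' ch.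
have : red_map B h = 0.
  apply: simple_red_kernel sB uu _ => c d; rewrite jmap_red //.
  apply: Cc_off ch _ => -[Wdc udc].
  have dc : gsrc (val d) = grng (ginv (val c)) by rewrite grng_inv !fiber_src.
  have : (W `&` orbit u) (gmul (val d) (ginv (val c))).
    split => //; exists (ginv (val d)); first by rewrite /= grng_inv fiber_src.
    by rewrite gsrc_inv -(rng_unit udc) grng_mul.
  by rewrite Wo.
move=> /(red_inj het cAh)/(congr1 (fun k => k v)); rewrite hv => /eqP.
by rewrite oner_eq0.
Qed.

(** A function in Cc(U) is continuous on U and vanishes on the interior of the complement, and these
    together are dense. Finite intersections of open dense sets serve for sums. *)
Lemma convAlg_continuous f : convAlg f ->
  exists O, [/\ open O, dense O & forall x, O x -> contC f x].
Proof.
elim/(@convAlg_ind R G) => [|c h k _ _ [P [oP dP Pc]] [Q [oQ dQ Qc]]|U h bU ch].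
- exists [set: G]; split; [exact: openT| |move=> x _; exact: contC_cst].
  by move=> P [x Px] _; exists x.
- exists (P `&` Q); split; first exact: openI.
    move=> W W0 oW; rewrite setIA; apply: dQ; last exact: openI.
    exact: dP.
  move=> x [Px Qx]; apply: contCD (Qc _ Qx).
  by apply: contCM (Pc _ Px); exact: contC_cst.
have oU := bis_open het bU; exists (U `|` interior (~` U)); split.
- by apply: openU => //; exact: open_interior.
- move=> W [x Wx] oW; have [[y [Wy Uy]]|nU] := pselect (W `&` U !=set0).
    by exists y; split => //; left.
  exists x; split => //; right; apply/nbhs_openP; exists W; split => // y Wy Uy.
  by apply: nU; exists y.
- have /(CcP _ oU)[ff _] := ch; move=> x [/ff //|nU].
  apply: contC_near (@contC_cst R G 0 x); apply: filterS nU => y nUy.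
  by apply/esym; exact: Cc_off ch nUy.
Qed.

(** The arrows [g] composable with [c] are the d c^-1 with d in the fibre of [u]. So these are the
    units u for which a matrix entry of L_u, taken along [V] and [U], involves an arrow outside
    [O]. *)
Let bad V U O := [set u | exists c g, [/\ V c, U g, ~ O g, gsrc g = grng c & gsrc c = u]].

(** On bisections, [u] determines [c] and then [g]. Density of [O] gives one good [g], and carrying
    a neighbourhood of it back along U and V gives an open set of units whose only candidate lies in
    [O]. *)
Let bad_nowhere_dense V U O : open_bisection V -> open_bisection U -> open O -> dense O ->
  nowhere_dense_units (bad V U O).
Proof.
move=> bV bU oO dO W oW Wu [w Ww].
have [[sc _ so] [rc _ ro]] := (src_etale het, rng_etale het).
pose P1 := V `&` @gsrc G @^-1` W.
have oP1 : open P1 by apply: openI (bis_open het bV) _; exact: open_preimage.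
pose P2 := U `&` @gsrc G @^-1` (@grng G @` P1).
have oP2 : open P2 by apply: openI (bis_open het bU) _; apply: open_preimage => //; exact: ro.
have [[g0 P2g0]|nP2] := pselect (P2 !=set0); last first.
  exists W; split => //; first by exists w.
  apply/seteqP; split => // u [Wu' [c [g [Vc Ug _ gc cu]]]]; apply: nP2; exists g.
  by split => //=; exists c => //; split => //=; rewrite cu.
have [g1 [P2g1 Og1]] := dO P2 (ex_intro _ g0 P2g0) oP2.
pose P3 := P1 `&` @grng G @^-1` (@gsrc G @` (P2 `&` O)).
have oP3 : open P3.
  by apply: openI => //; apply: open_preimage => //; apply: so; exact: openI.
exists (@gsrc G @` P3); split; first exact: so.
- have [Ug1 [c P1c cg]] := P2g1; exists (gsrc c); exists c => //; split => //=.
  by exists g1 => //; exact/esym.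
- by move=> _ [c [[Vc Wc] _] <-].
apply/seteqP; split => // _ [[c' [[Vc' _] [g' [[Ug' _] Og'] gc']] <-] [c [g [Vc Ug nO gc cu]]]].
have cc' : c = c' := bis_sinj het bV Vc Vc' cu.
apply: nO; rewrite (bis_sinj het bU Ug Ug') //.
by rewrite gc cc' gc'.
Qed.

Lemma bisection_cover : @second_countable G -> exists V : nat -> set G,
  (forall n, open_bisection (V n)) /\ forall g, exists n, V n g.
Proof.
move=> [D cD [Dopen Dbasis]]; move: cD => /countable_injP[F Finj].
exists (fun n => xget set0 [set U | [/\ D U, open_bisection U & F U = n]]); split.
  move=> n; case: xgetP => [U -> []//|_]; apply/(open_bisectionP het).
  by split => //; exact: open0.
move=> g; have [_ /(_ g setT)] := het; case=> [|U [bU Ug] _]; first exact: filterT.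
have [W [DW Wg] WU] := Dbasis g U (open_nbhs_nbhs (conj (bis_open het bU) Ug)).
exists (F W); case: xgetP => [W' _ [DW' _ E]|/(_ W)[]].
  by have <- : W = W' by apply: Finj; rewrite ?inE.
by split => //; apply: bis_sub bU _ WU => //; exact: Dopen.
Qed.

Lemma simple_supp_interior : @second_countable G -> simple_cstar B -> supp_interior B.
Proof.
move=> hsc sB a a0; apply: contrapT => nint; apply: a0.
have pos n : 0 < n.+1%:R^-1 :> R by rewrite invr_gt0 ltr0n.
have ex n : {f | convAlg f /\ rnorm (a - red_map B f) < n.+1%:R^-1}.
  by apply: cid; have [f cf fa] := red_dense a (pos n); exists f.
pose s n := sval (ex n).
have [cs sa] : (forall n, convAlg (s n)) /\ forall n, rnorm (a - red_map B (s n)) < n.+1%:R^-1.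
  by split=> n; have [] := svalP (ex n).
have exO n : {O | [/\ open O, dense O & forall x, O x -> contC (s n) x]}.
  by apply: cid; exact: convAlg_continuous.
pose O n := sval (exO n).
have [oO dO Oc] : [/\ forall n, open (O n), forall n, dense (O n) &
    forall n x, O n x -> contC (s n) x].
  by split=> n; have [] := svalP (exO n).
have suppO g : jmap a g <> 0 -> exists n, ~ O n g.
  move=> jg; apply: contrapT => nO; have Og n : O n g.
    by apply: contrapT => nOg; apply: nO; exists n.
  have e0 : 0 < rnorm (jmap a g) by apply: rnorm_neq0; exact/eqP.
  (* Going from j(a)(g) to s_n(g), then to s_n(h), then to j(a)(h) costs less than 1/(n+1) each
     time, and |j(a)(g)| exceeds four times that. *)
  pose n := Num.bound (4 / rnorm (jmap a g)).
  have ne : 4 * n.+1%:R^-1 < rnorm (jmap a g).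
    rewrite ltr_pdivrMr ?ltr0n // mulrC -ltr_pdivrMr //.
    apply: (@lt_trans _ _ n%:R); last by rewrite ltr_nat.
    by apply: archi_boundP; rewrite divr_ge0 // ltW.
  have /contC_rnorm/(_ _ (pos n)) := Oc n _ (Og n) => H.
  apply: nint; exists g; rewrite /interior; apply: filterS H => h gh.
  rewrite /supp /= => jh.
  have je k : rnorm (jmap a k - s n k) < n.+1%:R^-1.
    rewrite -(jmap_red het B k (cs n)) -jmapB.
    by apply: le_lt_trans (jmap_rnorm _ _) (sa n).
  have := je g; have := je h; rewrite jh sub0r rnormN => h1 h2.
  have := rnorm_tri (s n g) (jmap a g) 0; have := rnorm_tri (s n h) (s n g) 0; rewrite !subr0.
  move: ne (pos n) gh h1 h2; move: (n.+1%:R^-1 : R) => d; lra.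
have [V [bV Vc]] := bisection_cover hsc.
(* A triple records the approximant and the bisections of the cover containing c and d c^-1. *)
pose N k := if unpickle k is Some (n, i, j) then bad (V i) (V j) (O n) else set0.
have Nnd k : nowhere_dense_units (N k).
  rewrite /N; case: (unpickle k) => [[[n i] j]|]; first exact: bad_nowhere_dense.
  by move=> W oW Wu W0; exists W; split => //; rewrite setI0.
(* In the empty groupoid Baire yields no unit, but then C(G) = 0 is dense and [a] vanishes. *)
have [[g0 _]|noG] := pselect ([set: G] !=set0); last first.
  apply: rnorm_small => e e_gt0; have [f cf] := red_dense a e_gt0.
  have -> : f = 0 by apply/funext => g; exfalso; apply: noG; exists g.
  by rewrite (completion0 (red_mapP B)) subr0.
have [|u uu nN] := baire_units het hT2 hlc Nnd (units_open het) (@subset_refl _ _).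
  by exists (gsrc g0); exact: units_src.
apply: (simple_red_kernel sB uu) => c d; apply: contrapT => /suppO[n nO].
have [i Vi] := Vc (val c); have [j Vj] := Vc (gmul (val d) (ginv (val c))).
apply: (nN (pickle (n, i, j))); rewrite /N pickleK.
exists (val c), (gmul (val d) (ginv (val c))); split => //; last exact: fiber_src.
by rewrite gsrc_mul ?gsrc_inv // grng_inv !fiber_src.
Qed.

End SimpleReduced.

(** * Simplicity of the reduced algebra *)

Section UnitFunctions.
Context {R : realType} {G : topGroupoidType} (het : etale G)
  (hT2 : hausdorff_space (set_type (@units G))).
Implicit Types (f h : G -> R[i]) (g u : G) (U V W K : set G).

Lemma conv_unit_l f h g : Cc (@units G) f -> conv f h g = f (grng g) * h g.
Proof.
move=> cf; rewrite (conv_bisE het h (bis_units het) cf (units_rng g)) ?grng_rng //.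
by rewrite ginv_rng_unit ?gmul_rng //; exact: units_rng.
Qed.

Lemma conv_unit_r f h g : Cc (@units G) h -> conv f h g = f g * h (gsrc g).
Proof.
move=> ch; rewrite /conv (fsum_sub (S := [set g])) ?fsbig_set1 ?gmulVg //.
  by move=> _ ->.
move=> e /= eg neg; rewrite (Cc_off ch) ?mulr0 // => ueg; apply: neg => /=.
have := gmulKVg eg; have ge : gsrc (ginv e) = grng g by rewrite gsrc_inv.
have <- : gsrc e = gmul (ginv e) g by rewrite -(rng_unit ueg) grng_mul // grng_inv.
by rewrite gmul_src.
Qed.

Lemma open_nonzero U f : open U -> Cc U f -> open [set g | U g /\ f g <> 0].
Proof.
move=> oU /(CcP _ oU)[cf _]; rewrite openE => g [Ug fg].
have e0 : 0 < rnorm (f g) by apply: rnorm_neq0; exact/eqP.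
have /contC_rnorm/(_ _ e0) H := cf g Ug.
have : nbhs g U by exact: open_nbhs_nbhs.
rewrite /interior; apply: filterS2 H => h fgh Uh; split => // fh.
by move: fgh; rewrite fh subr0 ltxx.
Qed.

Lemma mulc_conjc (z : R[i]) : z * conjc z = (normsq z)%:C.
Proof.
case: z => a b; rewrite /normsq; apply/eqP; rewrite eq_complex /=.
by apply/andP; split; apply/eqP; ring.
Qed.

End UnitFunctions.

(** * Effectiveness: shrinking open sets of units *)

Section Shrink.
Context {R : realType} {G : topGroupoidType} (het : etale G)
  (hT2 : hausdorff_space (set_type (@units G))) (hlc : loc_compact G)
  (heff : effective G).
Implicit Types (f h : G -> R[i]) (g u : G) (U V W K : set G).

(** If W meets U, take the intersection. Otherwise, if U has arrows between points of W,
    effectiveness provides one whose range and source differ; separating these by P and Q, the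
    sources of nearby arrows of U lie in Q and the matching ranges in P, so no arrow of U joins two
    of these sources. *)
Lemma shrink_bisection U W : open_bisection U -> open W -> W `<=` @units G -> W !=set0 ->
  exists V, [/\ open V, V !=set0, V `<=` W &
    V `<=` U \/ forall g, U g -> V (grng g) -> V (gsrc g) -> False].
Proof.
move=> bU oW Wu W0; have oU := bis_open het bU.
have [[w [Ww Uw]]|WU] := pselect (W `&` U !=set0).
  by exists (W `&` U); split; [exact: openI|exists w|move=> x []|left => x []].
have [rc sc] := (@rng_continuous G, @src_continuous G).
pose V := U `&` (@grng G @^-1` W `&` @gsrc G @^-1` W).
have oV : open V by apply: openI => //; apply: openI; exact: open_preimage.
have [[g0 Vg0]|nV] := pselect (V !=set0); last first.
  by exists W; split => //; right => g Ug rW sW; apply: nV; exists g.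
have [g [Vg rsg]] : exists g, V g /\ grng g <> gsrc g.
  apply: contrapT => H; have : interior (isotropy (G:=G)) g0.
    apply/nbhs_openP; exists V; split => // g Vg; apply: contrapT => ng.
    by apply: H; exists g.
  rewrite heff => ug0; apply: WU; exists g0; split; last by case: Vg0.
  by case: Vg0 => _ [_ /=]; rewrite src_unit.
have [P [Q [oP oQ Pr Qs PQ]]] := unit_sep het hT2 (units_rng g) (units_src g) rsg.
pose V2 := V `&` (@grng G @^-1` P `&` @gsrc G @^-1` Q).
have oV2 : open V2 by apply: openI => //; apply: openI; exact: open_preimage.
exists (@gsrc G @` V2); split.
- by have [_ _] := src_etale het; apply.
- by exists (gsrc g); exists g.
- by move=> _ [h [[_ [_ sW]] _] <-].
right=> h Uh [k [_ [_ /= Qk]] kr] [k' [[Uk' _] [/= Pk' _]] sk'].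
have hk' : k' = h by apply: (bis_sinj het bU).
have : (P `&` Q) (grng h) by split; [rewrite -hk'|rewrite -kr].
by rewrite PQ.
Qed.

(** One shrinking per generator. On V a generator is either continuous because V lies in its
    bisection, or zero; this matters because [f] need not be continuous on the unit space. *)
Lemma shrink_convAlg f W : convAlg f -> open W -> W `<=` @units G -> W !=set0 ->
  exists V, [/\ open V, V !=set0, V `<=` W,
    forall g, V (grng g) -> V (gsrc g) -> ~ units g -> f g = 0 &
    forall u, V u -> contC f u].
Proof.
move=> cf; move: W; elim/(@convAlg_ind R G): cf => [|c h k ch ck IHh IHk|U h bU ch] W oW Wu W0.
- by exists W; split => // u _; exact: contC_cst.
- have [V [oV V0 VW Vh Vc]] := IHh W oW Wu W0.
  have [V' [oV' V'0 V'V V'k V'c]] := IHk V oV (subset_trans VW Wu) V0.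
  exists V'; split; [exact: oV'|exact: V'0|exact: subset_trans VW| |].
    move=> g rg sg ng; rewrite fun_linE (V'k g rg sg ng) (Vh g (V'V _ rg) (V'V _ sg) ng).
    by rewrite mulr0 addr0.
  move=> u Vu; apply: contCD (V'c _ Vu); apply: contCM; first exact: contC_cst.
  exact/Vc/V'V.
have oU := bis_open het bU.
have [V [oV V0 VW [VU|VU]]] := shrink_bisection bU oW Wu W0.
  exists V; split => //.
    move=> g rg sg ng; apply: (Cc_off ch) => Ug; apply: ng.
    by apply/unitsP/(bis_sinj het bU); [exact: VU|exact: Ug|exact: gsrc_src].
  by have /(CcP _ oU)[cc _] := ch; move=> u /VU; exact: cc.
have nVU u : V u -> ~ U u.
  move=> Vu Uu; have uu := Wu _ (VW _ Vu).
  by apply: (VU u Uu); rewrite ?rng_unit ?src_unit.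
exists V; split => //.
  by move=> g rg sg _; apply: (Cc_off ch) => Ug; exact: VU Ug rg sg.
move=> u Vu; apply: contC_near (@contC_cst R G 0 u).
have : nbhs u V by exact: open_nbhs_nbhs.
by apply: filterS => g /nVU nU; apply/esym; exact: Cc_off ch nU.
Qed.

End Shrink.

(** * Coefficients and norms near the unit space *)

Section IdealSupport.
Context {R : realType} {G : topGroupoidType} (het : etale G)
  (hT2 : hausdorff_space (set_type (@units G))) (hlc : loc_compact G).
Variable B : red_cstar R G.
Implicit Types (f h : G -> R[i]) (g u : G) (U V W K : set G).

Let inner_scaler (H : hilbertType R) (k : R[i]) (x y : H) :
  inner x (k *: y) = conjc k * inner x y.
Proof.
have cj (a b : H) : inner a b = conjc (inner b a) by exact: inner_conj.
have i0 : inner 0 x = 0 by have := inner_linearl x (-1) 0 0; rewrite scaler0 addr0 mulN1r addNr.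
rewrite cj; have := inner_linearl x k y 0; rewrite addr0 i0 addr0 => ->.
by rewrite [LHS]rmorphM /= -cj.
Qed.

(** For [f] on a bisection, L(f) sends the basis vector at s(g) to f(g) times the one at g. The
    formula moves the support of j(a) from a bisection to the units. *)
Lemma jmap_amul_star U f (a : B) g : open_bisection U -> Cc U f -> U g ->
  jmap (amul (red_map B (conv_star f)) a) (gsrc g) = conjc (f g) * jmap a g.
Proof.
move=> bU cf Ug; have cAf := convAlg_Cc bU cf; have us := units_src g.
have [rbd rl rm rs] := red_repP B us.
pose c0 := in_fiber_src g; pose c1 := in_fiber g.
have E : red_rep (red_map B f) (delta R c0) = f g *: delta R c1.
  apply: val_inj; apply/funext => d /=.
  rewrite [LHS](regular_coef het _ _ cAf (red_rep_map B us cAf)).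
  have dd : gmul (val d) (ginv (val c0)) = val d.
    rewrite /c0 /= ginv_rng_unit //.
    by have := gmul_src (val d); rewrite (fiber_src d).
  rewrite dd; transitivity (f g * (if d == c1 then 1 else 0)); last by [].
  case: eqP => [->|dc]; first by rewrite mulr1.
  rewrite mulr0; apply: (Cc_off cf) => Ud; apply: dc; apply: val_inj => /=.
  by apply: (bis_sinj het bU) => //; exact: fiber_src.
have := red_rep_coef het us (amul (red_map B (conv_star f)) a) c0 c0.
have -> : gmul (val c0) (ginv (val c0)) = gsrc g.
  by rewrite gmulgV /= rng_unit.
move=> <-; rewrite -inner_delta rm //= (completion_star (red_mapP B)) // rs //.
by rewrite E inner_scaler.
Qed.

(** A function on the units acts diagonally in each L_u, with entry f(r(d)) at d. *)
Lemma red_unit_norm f (C : R) : convAlg f -> 0 <= C -> (forall g, ~ units g -> f g = 0) ->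
  (forall u, units u -> rnorm (f u) <= C) -> rnorm (red_map B f) <= C.
Proof.
move=> cf C0 fu fC; apply: red_le => // u hu x.
have E (y : ell2 R (fiber u)) (d : fiber u) : red_rep (red_map B f) y d = f (grng (val d)) * y d.
  apply/eqP; rewrite -subr_eq0; apply/eqP.
  apply: (@ell2_ext R _ R[i]^o (fun y => red_rep (red_map B f) y d - f (grng (val d)) * y d)
    (rnorm (red_map B f) + rnorm (f (grng (val d))))) => [k a b|a|c].
  - have [rbd _ _ _] := red_repP B hu; have [linf _] := rbd (red_map B f) I.
    rewrite linf !ell2D !ell2Z mulrDr opprD addrACA mulrCA -mulrBr.
    by [].
  - apply: le_trans (rnormB _ _) _; rewrite mulrDl lerD //.
      by apply: le_trans (ell2_coord_rnorm _ _) _; exact: red_rep_rnorm.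
    by rewrite rnormM ler_wpM2l ?rnorm_ge0 // ell2_coord_rnorm.
  - rewrite (regular_coef het _ _ cf (red_rep_map B hu cf)) deltaE.
    case: eqP => [->|dc]; first by rewrite gmulgV mulr1 subrr.
    rewrite mulr0 subr0 fu // => udc; apply: dc; apply: val_inj => /=.
    have dd : gsrc (val d) = gsrc (val c) by rewrite !fiber_src.
    rewrite -(gmulgKV dd).
    have -> : gmul (val d) (ginv (val c)) = grng (val c).
      by rewrite -(src_unit udc) gsrc_mul ?gsrc_inv // grng_inv.
    by rewrite gmul_rng.
have : (sum_normsq (red_rep (red_map B f) x) <= (C ^+ 2)%:E * sum_normsq x)%E.
  rewrite /sum_normsq -esumZl ?sqr_ge0 //; last by move=> d; exact: normsq_ge0.
  apply: le_esum => d _; rewrite lee_fin E normsqM ler_wpM2r ?normsq_ge0 // -rnorm_sqr.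
  by rewrite lerXn2r ?nnegrE ?rnorm_ge0 //; apply: fC; exact: units_rng.
rewrite -!ell2_rnorm_sqr -EFinM lee_fin -exprMn.
by rewrite ler_pXn2r ?nnegrE ?mulr_ge0 ?ell2_rnorm_ge0.
Qed.

Variable J : set B.
Hypothesis cJ : closed_ideal J.

Let J0 : J 0. Proof. by case: cJ. Qed.
Let JL (k : R[i]) a b : J a -> J b -> J (k *: a + b).
Proof. by case: cJ => _ _ H _ _; exact: H. Qed.
Let JMl a b : J b -> J (amul a b). Proof. by case: cJ => _ _ _ H _; exact: H. Qed.
Let JMr a b : J a -> J (amul a b). Proof. by case: cJ => _ _ _ _ H; exact: H. Qed.
Let JD a b : J a -> J b -> J (a + b).
Proof. by move=> Ja Jb; have := JL 1 Ja Jb; rewrite scale1r. Qed.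
Let JZ k a : J a -> J (k *: a).
Proof. by move=> Ja; have := JL k Ja J0; rewrite addr0. Qed.
Let JC a : (forall e : R, 0 < e -> exists2 b, J b & rnorm (a - b) < e) -> J a.
Proof. by case: cJ => /closed_rnorm H _ _ _ _; exact: H. Qed.

(* [psi = psi z + psi (v - z) = psi z + psi (v - z) z + ...], a Neumann series without a unit. *)
Lemma neumann_ideal (psi v z : B) : J z -> amul psi v = psi -> rnorm (v - z) < 1 -> J psi.
Proof.
move=> Jz pv d1; pose d := v - z; pose e := fix e n := if n is m.+1 then amul (e m) d else psi.
have eJ n : J (e n - e n.+1).
  elim: n => [|n IH] /=; first by rewrite /d amulBr pv subKr; exact: JMl.
  by rewrite -amulBl; exact: JMr.
have pJ n : J (psi - e n).
  elim: n => [|n IH]; first by rewrite subrr.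
  by rewrite -(subrKA (e n)); exact: JD.
have en n : rnorm (e n) <= rnorm psi * rnorm d ^+ n.
  elim: n => [|n IH] /=; first by rewrite expr0 mulr1.
  apply: le_trans (rnorm_amul _ _) _; rewrite exprSr mulrA.
  by rewrite ler_wpM2r ?rnorm_ge0.
apply: JC => eps eps0.
have : (fun n => rnorm psi * rnorm d ^+ n) @ \oo --> rnorm psi * (0 : R).
  apply: cvgM; first exact: cvg_cst.
  by apply: cvg_expr; rewrite ger0_norm ?rnorm_ge0.
rewrite mulr0 => /cvgr_lt/(_ _ eps0)[n _ nP].
exists (psi - e n); first exact: pJ.
by rewrite subKr; apply: le_lt_trans (en n) (nP n (leqnn n)).
Qed.

End IdealSupport.

Lemma rnormV (R : realType) (c : R[i]) : c != 0 -> rnorm c^-1 = (rnorm c)^-1.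
Proof.
move=> c0; have rc : rnorm c != 0 by rewrite gt_eqF // rnorm_neq0.
rewrite -[LHS](mulfK rc) -rnormM mulVf // (rnorm_real (1 : R)) normr1 mul1r //.
Qed.

(** * From a nonzero ideal to the whole algebra *)

Section MinimalEffective.
Context {R : realType} {G : topGroupoidType} (het : etale G)
  (hT2 : hausdorff_space (set_type (@units G))) (hlc : loc_compact G).
Implicit Types (f h : G -> R[i]) (phi psi chi : G -> R) (g u : G) (U V W K N : set G).

(** The constant 2 is the slope of both cut-offs below, and [rho 0 = 0] preserves compact
    support. *)
Lemma Cc_lipschitz N phi (rho : R -> R) : open N -> N `<=` @units G ->
  rho 0 = 0 -> (forall s t, `|rho s - rho t| <= 2 * `|s - t|) ->
  (forall u, units u -> {for u, continuous phi}) ->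
  Cc N (fun g => (phi g)%:C) -> Cc N (fun g => (rho (phi g))%:C).
Proof.
move=> oN Nu r0 rl cphi /(CcP _ oN)[_ [K [cK KN K0]]]; apply/(CcP _ oN); split.
  move=> u Nuu; apply/contC_rnorm => e e0; have e2 : 0 < e / 2 by rewrite divr_gt0.
  have /cvgrPdist_lt/(_ _ e2) := cphi u (Nu _ Nuu); apply: filterS => v uv.
  rewrite -rmorphB rnorm_real; apply: le_lt_trans (rl _ _) _.
  by rewrite -ltr_pdivlMl // mulrC.
by exists K; split => // g /K0/complexI ->; rewrite r0.
Qed.

(** Both are truncations of twice one bump: [chi] is 1 where the bump is at least 1/2, and [psi]
    vanishes elsewhere. *)
Lemma unit_cutoffs N u : open N -> N `<=` @units G -> N u -> exists chi psi,
  [/\ Cc N (fun g => (chi g)%:C), Cc N (fun g => (psi g)%:C), psi u = 1,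
      forall g, 0 <= chi g <= 1 /\ 0 <= psi g & forall g, psi g * chi g = psi g].
Proof.
move=> oN Nu Nuu; have [phi [p1 p01 cphi cont]] := Cc_bump_unit (R := R) het hT2 hlc oN Nu Nuu.
exists (fun g => Num.min 1 (2 * phi g)), (fun g => Num.max 0 (2 * phi g - 1)); split.
- apply: (Cc_lipschitz (rho := fun t => Num.min 1 (2 * t))) => //.
    by rewrite mulr0 min_r.
  move=> s t; rewrite ler_norml; case: (lerP s t) => st;
    rewrite ?(ler0_norm (_ : s - t <= 0)) ?(gtr0_norm (_ : 0 < s - t)) ?subr_le0 ?subr_gt0 //;
    rewrite !minEle; case: ifP => h1; case: ifP => h2; move: h1 h2;
    do ?[move=> /negbT; rewrite -ltNge]; lra.
- apply: (Cc_lipschitz (rho := fun t => Num.max 0 (2 * t - 1))) => //.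
    by rewrite max_l // mulr0 sub0r oppr_le0.
  move=> s t; rewrite ler_norml; case: (lerP s t) => st;
    rewrite ?(ler0_norm (_ : s - t <= 0)) ?(gtr0_norm (_ : 0 < s - t)) ?subr_le0 ?subr_gt0 //;
    rewrite !maxEle; case: ifP => h1; case: ifP => h2; move: h1 h2;
    do ?[move=> /negbT; rewrite -ltNge]; lra.
- by rewrite p1 max_r; lra.
- move=> g; have /andP[p0 _] := p01 g; split; last by rewrite le_max lexx.
  by rewrite ge_min lexx le_min ler01 mulr_ge0.
- move=> g; rewrite maxEle; case: ifP; last by rewrite mul0r.
  by move=> h; rewrite min_l ?mulr1 //; lra.
Qed.

Variable B : red_cstar R G.
Hypotheses (heff : effective G) (hsupp : supp_interior B) (hmin : minimal G).
Variable J : set B.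
Hypothesis cJ : closed_ideal J.

Let J0 : J 0. Proof. by case: cJ. Qed.
Let JL (k : R[i]) a b : J a -> J b -> J (k *: a + b).
Proof. by case: cJ => _ _ H _ _; exact: H. Qed.
Let JMl a b : J b -> J (amul a b). Proof. by case: cJ => _ _ _ H _; exact: H. Qed.
Let JMr a b : J a -> J (amul a b). Proof. by case: cJ => _ _ _ _ H; exact: H. Qed.
Let JD a b : J a -> J b -> J (a + b).
Proof. by move=> Ja Jb; have := JL 1 Ja Jb; rewrite scale1r. Qed.
Let JZ k a : J a -> J (k *: a).
Proof. by move=> Ja; have := JL k Ja J0; rewrite addr0. Qed.

Let bP := red_mapP B.

Lemma ideal_nonzero_on_units a : J a -> a <> 0 -> exists b W,
  [/\ J b, open W, W `<=` @units G, W !=set0 & forall u, W u -> jmap b u <> 0].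
Proof.
move=> Ja a0; have [g /nbhs_openP[P [oP Pg Ps]]] := hsupp a0.
have [_ /(_ g P (open_nbhs_nbhs (conj oP Pg)))] := het; move=> [U [bU Ug] UP].
have [f cf fg] := Cc_bump (R := R) het hT2 hlc bU Ug.
exists (amul (red_map B (conv_star f)) a), (@gsrc G @` [set g | U g /\ f g <> 0]); split.
- exact: JMl.
- have [_ _] := src_etale het; apply; apply: open_nonzero => //; exact: bis_open.
- by move=> _ [h _ <-]; exact: units_src.
- exists (gsrc g); exists g => //; split => //; rewrite fg; apply/eqP; exact: oner_neq0.
move=> _ [h [Uh fh] <-]; rewrite (jmap_amul_star het _ bU cf Uh) => /eqP.
rewrite mulf_eq0 => /orP[/eqP E|/eqP]; last exact: (Ps _ (UP _ Uh)).
by apply: fh; apply: rnorm0_eq0; rewrite -rnorm_conj E rnorm0.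
Qed.

(** As j(b) need not be continuous, a nonzero value gives no bound nearby. But the sets where |j(b)|
    > 1/(n+1) cover W, so one of them is dense in some open V. *)
Lemma baire_lower_bound (b : B) W : open W -> W `<=` @units G -> W !=set0 ->
  (forall u, W u -> jmap b u <> 0) -> exists (d : R) V, [/\ 0 < d, open V, V !=set0, V `<=` W &
   forall V', open V' -> V' !=set0 -> V' `<=` V -> exists2 u, V' u & d < rnorm (jmap b u)].
Proof.
move=> oW Wu W0 jb; apply: contrapT => H.
have pos n : 0 < n.+1%:R^-1 :> R by rewrite invr_gt0 ltr0n.
pose N n := W `&` [set u | n.+1%:R^-1 < rnorm (jmap b u)].
have Nnd n : nowhere_dense_units (N n).
  move=> W1 oW1 W1u W10; have [WW|WW] := pselect ((W1 `&` W) !=set0); last first.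
    exists W1; split => //; apply/seteqP; split => // x [W1x [Wx _]].
    by apply: WW; exists x.
  apply: contrapT => H1; apply: H; exists n.+1%:R^-1, (W1 `&` W).
  split=> [//||//|x []//|]; first exact: openI.
  move=> V' oV' V'0 V'W; apply: contrapT => H2; apply: H1; exists V'; split => //.
    by move=> x /V'W[].
  by apply/seteqP; split => // x [V'x [_ xN]]; apply: H2; exists x.
have [u Wuu nN] := baire_units het hT2 hlc Nnd oW Wu W0.
have e0 : 0 < rnorm (jmap b u) by apply: rnorm_neq0; apply/eqP; exact: jb.
pose n := Num.bound (1 / rnorm (jmap b u)).
apply: (nN n); split => //=.
rewrite -[_^-1]mul1r ltr_pdivrMr ?ltr0n // mulrC -ltr_pdivrMr //.
apply: (@lt_trans _ _ n%:R); last by rewrite ltr_nat.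
by apply: archi_boundP; rewrite divr_ge0 // ltW.
Qed.

(* Near a suitable [u], effectiveness allows a cut-off [v] for which [v f v] is supported on the
   units and close to [f u] times [v v], hence so is [v b v]. *)
Lemma ideal_unit_function a : J a -> a <> 0 -> exists psi u, [/\ units u,
  Cc (@units G) (fun g => (psi g)%:C), psi u = 1, forall g, 0 <= psi g &
  J (red_map B (fun g => (psi g)%:C))].
Proof.
move=> Ja a0; have [b [W [Jb oW Wu W0 jb]]] := ideal_nonzero_on_units Ja a0.
have [d [W1 [d0 oW1 W10 W1W dense1]]] := baire_lower_bound oW Wu W0 jb.
have bu := bis_units het; have ccv := convAlg_conv het hT2 (R := R).
(* This makes |f(u)| > 7 e, while the final estimate 2 e / |f(u)| < 1 asks only for 2 e. *)
pose e := d / 8; have e0 : 0 < e by rewrite divr_gt0.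
have [f cf bf] := red_dense b e0.
have [V [oV V0 VW1 Vf Vc]] := shrink_convAlg het hT2 heff cf oW1 (subset_trans W1W Wu) W10.
have Vu : V `<=` @units G := subset_trans VW1 (subset_trans W1W Wu).
have [u Vuu du] := dense1 V oV V0 VW1; have uu := Vu _ Vuu.
pose c := f u.
have cn : 7 * e < rnorm c.
  have : rnorm (jmap b u - f u) < e.
    by rewrite -(jmap_red het B u cf) -jmapB; exact: le_lt_trans (jmap_rnorm _ _) bf.
  have := rnorm_tri (f u) (jmap b u) 0; rewrite !subr0 -/c; move: du; rewrite /e; lra.
have c0 : 0 < rnorm c by apply: lt_trans cn; rewrite mulr_gt0.
have c_neq0 : c != 0 by apply/eqP => E; move: c0; rewrite E rnorm0 ltxx.
have rc := rnormV c_neq0.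
have /nbhs_openP[N [oN Nuu Nf]] : nbhs u [set v | V v /\ rnorm (c - f v) < e].
  have /contC_rnorm/(_ _ e0) Hc := Vc _ Vuu.
  have : nbhs u V by exact: open_nbhs_nbhs.
  by apply: filterS2 Hc => v cv Vv.
have NV : N `<=` V by move=> v /Nf[].
have Nu := subset_trans NV Vu.
have [chi [psi [cchi cpsi psi1 cp01 pc]]] := unit_cutoffs oN Nu Nuu.
pose chiC g : R[i] := (chi g)%:C; pose psiC g : R[i] := (psi g)%:C.
have uchi : Cc (@units G) chiC by exact: (Cc_sub het hT2 oN bu Nu cchi).
have upsi : Cc (@units G) psiC by exact: (Cc_sub het hT2 oN bu Nu cpsi).
have [achi apsi] := (convAlg_Cc bu uchi, convAlg_Cc bu upsi).
exists psi, u; split => //; first by move=> g; have [] := cp01 g.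
have chi0 x : ~ N x -> chiC x = 0 by exact: (Cc_off cchi).
have chi_norm (g : G) : rnorm (chiC g) <= 1.
  by have [/andP[h0 h1] _] := cp01 g; rewrite rnorm_real ger0_norm.
pose v := red_map B chiC.
have v1 : rnorm v <= 1.
  by apply: red_unit_norm => // g; exact: Cc_off uchi.
(* The defect of c^-1 v f v from v v. It lives on the units, with value chi^2 (1 - f / c), hence has
   norm at most e / |c|; replacing f by b costs as much again. *)
pose k := conv chiC chiC - c^-1 *: conv chiC (conv f chiC).
have af := ccv _ _ cf achi; have af2 := ccv _ _ achi af; have aa := ccv _ _ achi achi.
have ak : convAlg k by apply: convAlgB => //; exact: convAlgZ.
have kE (g : G) : k g = chiC (grng g) * (chiC g - c^-1 * (f g * chiC (gsrc g))).
  rewrite -[LHS]/(conv chiC chiC g - c^-1 * conv chiC (conv f chiC) g).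
  by rewrite !(conv_unit_l het _ _ uchi) (conv_unit_r _ _ uchi) mulrBr [in RHS]mulrCA.
have kn : rnorm (red_map B k) <= e / rnorm c.
  apply: red_unit_norm => //; first by rewrite divr_ge0 // ltW.
    move=> g ng; rewrite kE (Cc_off uchi ng) sub0r.
    have [Nr|nr] := pselect (N (grng g)); last by rewrite (chi0 _ nr) mul0r.
    have [Ns|ns] := pselect (N (gsrc g)); last by rewrite (chi0 _ ns) !mulr0 oppr0 mulr0.
    by rewrite (Vf g (NV _ Nr) (NV _ Ns) ng) mul0r mulr0 oppr0 mulr0.
  move=> w uw; rewrite kE rng_unit // src_unit //.
  have [Nw|nw] := pselect (N w); last first.
    by rewrite (chi0 _ nw) mul0r rnorm0 divr_ge0 // ltW.
  have -> : chiC w - c^-1 * (f w * chiC w) = chiC w * (c^-1 * (c - f w)).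
    by rewrite mulrBr mulVf // mulrBr mulr1 [f w * _]mulrC mulrCA.
  rewrite !rnormM mulrA.
  rewrite rc mulrC; apply: (@le_trans _ _ ((rnorm c)^-1 * rnorm (c - f w) * 1)).
    rewrite ler_wpM2l ?mulr_ge0 ?invr_ge0 ?rnorm_ge0 //.
    by rewrite -[leRHS]mulr1; apply: ler_pM; rewrite ?rnorm_ge0.
  rewrite mulr1 mulrC ler_wpM2r ?invr_ge0 ?rnorm_ge0 //.
  by have [_ /ltW] := Nf _ Nw.
pose z := c^-1 *: amul v (amul b v).
have Jz : J z by apply/JZ/JMl/JMr.
have kv : red_map B k = amul v v - c^-1 *: amul v (amul (red_map B f) v).
  rewrite /k (completionB bP) //; last exact: convAlgZ.
  by rewrite (completionZ bP) // !(completion_mul bP).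
apply: (neumann_ideal cJ Jz (v := amul v v)).
  rewrite /v -!(completion_mul bP) //.
  congr (red_map B _); apply/funext => g; rewrite !conv_unit_l //.
  have [ug|nug] := pselect (units g); last first.
    by rewrite (Cc_off uchi nug) -/(psiC g) (Cc_off upsi nug) !mulr0.
  by rewrite rng_unit // /chiC -!rmorphM /= mulrA !pc.
have -> : amul v v - z = red_map B k + c^-1 *: amul v (amul (red_map B f - b) v).
  by rewrite kv /z amulBl amulBr scalerBr subrKA.
apply: le_lt_trans (rnormD _ _) _; rewrite rnormZ.
have h : rnorm (amul v (amul (red_map B f - b) v)) <= e.
  apply: le_trans (rnorm_amul _ _) _.
  apply: (@le_trans _ _ (1 * rnorm (amul (red_map B f - b) v))).
    by rewrite ler_wpM2r ?rnorm_ge0.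
  rewrite mul1r; apply: le_trans (rnorm_amul _ _) _.
  apply: (@le_trans _ _ (rnorm (red_map B f - b) * 1)).
    by rewrite ler_wpM2l ?rnorm_ge0.
  by rewrite mulr1 rnormBC ltW.
apply: (@le_lt_trans _ _ (e / rnorm c + (rnorm c)^-1 * e)).
  by rewrite lerD // rc ler_wpM2l ?invr_ge0 ?rnorm_ge0.
rewrite [_^-1 * e]mulrC -mulrDl ltr_pdivrMr // mul1r; lra.
Qed.

(** The inequality in [R[i]] also makes the values real. Nonnegativity prevents cancellation, so a
    sum vanishes only where all its terms do. *)
Definition ideal_pos h := [/\ Cc (@units G) h, J (red_map B h) & forall g, 0 <= h g].

Lemma ideal_pos0 : ideal_pos 0.
Proof.
have ou := units_open het; split.
- apply/(CcP _ ou); split; first by move=> x _; exact: contC_cst.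
  by exists set0; split => //; exact: compact0.
- by rewrite (completion0 bP).
- by [].
Qed.

Lemma ideal_posD h1 h2 : ideal_pos h1 -> ideal_pos h2 -> ideal_pos (h1 + h2).
Proof.
have ou := units_open het; have bu := bis_units het.
move=> [c1 J1 p1] [c2 J2 p2]; split.
- have /(CcP _ ou)[f1 [K1 [cK1 K1u K10]]] := c1; have /(CcP _ ou)[f2 [K2 [cK2 K2u K20]]] := c2.
  apply/(CcP _ ou); split; first by move=> x ux; apply: contCD; [exact: f1|exact: f2].
  exists (K1 `|` K2); split; [exact: compactU|by move=> x [/K1u|/K2u]|].
  move=> g /not_orP[n1 n2]; rewrite -[LHS]/(h1 g + h2 g) K10 // K20 //; exact: addr0.
- by rewrite (completionD bP); [exact: JD|exact: convAlg_Cc bu c1|exact: convAlg_Cc bu c2].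
- by move=> g; rewrite -[h in 0 <= h]/(h1 g + h2 g) addr_ge0.
Qed.

(** Minimality gives an arrow g with range v and source where psi is nonzero. For [f] on a bisection
    around g, the product of [f], psi and the adjoint of [f] is the function on units with value
    |f(e)|^2 psi(s(e)) at r(e). *)
Lemma ideal_pos_at psi u v : units u -> Cc (@units G) (fun g => (psi g)%:C) -> psi u = 1 ->
  (forall g, 0 <= psi g) -> J (red_map B (fun g => (psi g)%:C)) -> units v ->
  exists h, ideal_pos h /\ h v <> 0.
Proof.
move=> uu cpsi psi1 psi0 Jpsi uv; have ou := units_open het; have bu := bis_units het.
pose psiC g : R[i] := (psi g)%:C.
have oP := open_nonzero ou cpsi.
have [|_ [[g gv <-] [usg psig]]] := hmin uv uu (open_nbhs_nbhs (conj oP _)).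
  by split => //; rewrite psi1; apply/eqP; exact: oner_neq0.
have [_ /(_ g setT filterT)] := het; move=> [U [bU Ug] _].
have [f cf fg] := Cc_bump (R := R) het hT2 hlc bU Ug.
have bU' := bis_inv het bU; have cs := Cc_star het bU cf.
have [af as_ apsi] := And3 (convAlg_Cc bU cf) (convAlg_Cc bU' cs) (convAlg_Cc bu cpsi).
have ap := convAlg_conv het hT2 apsi as_.
pose h := conv f (conv psiC (conv_star f)).
have ch : Cc (@units G) h.
  have bUU := bis_prod het bU (bis_prod het bu bU').
  apply: (Cc_sub het hT2 (bis_open het bUU) bu); last first.
    by apply: Cc_conv => //; [exact: bis_prod|exact: Cc_conv].
  move=> _ [[a _] [/= Ua [[w k] [/= uw Uk wk] <-] ak] <-].
  have wE : w = grng k by rewrite -wk src_unit.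
  rewrite wE gmul_rng; rewrite wE gmul_rng in ak.
  have ka : ginv k = a by apply: (bis_sinj het bU) => //; rewrite gsrc_inv.
  by rewrite -ka gmulVg; exact: units_src.
have hE e : U e -> h (grng e) = (normsq (f e) * psi (gsrc e))%:C.
  move=> Ue; rewrite /h (conv_bisE het _ bU cf Ue) ?grng_rng //.
  have -> : gmul (ginv e) (grng e) = ginv e by rewrite -gsrc_inv gmul_src.
  rewrite conv_unit_l // grng_inv /conv_star ginvK mulrCA mulc_conjc.
  by rewrite -rmorphM /= mulrC.
exists h; split; last first.
  rewrite -gv hE // fg => /complexI /eqP.
  rewrite mulf_eq0 /normsq /= expr1n expr0n addr0 oner_eq0 /= => /eqP E.
  by apply: psig; rewrite E.
split => //.
- by rewrite (completion_mul bP) // (completion_mul bP) //; apply/JMl/JMr.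
move=> x; have [ux|nux] := pselect (units x); last by rewrite (Cc_off ch).
have [[e [Ue ex]]|nU] := pselect (exists e, U e /\ grng e = x).
  by rewrite -ex hE // ler0c mulr_ge0 ?normsq_ge0.
rewrite /h (conv_bis0 _ cf) // => e Ue; rewrite (rng_unit ux) => ex; apply: nU.
by exists e.
Qed.

Hypothesis ideal_pos_all : forall v, units v -> exists h, ideal_pos h /\ h v <> 0.

(** Were the zero sets in K all nonempty, they would generate a proper filter, directed because sums
    intersect zero sets. At a cluster point [ideal_pos_all] gives an [h] that is nonzero nearby, a
    contradiction. *)
Lemma ideal_pos_compact K : compact K -> exists h, ideal_pos h /\
  forall k, K k -> h (gsrc k) <> 0.
Proof.
move=> cK; apply: contrapT => H.
have ex h : ideal_pos h -> exists k, K k /\ h (gsrc k) = 0.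
  move=> ph; apply: contrapT => nk; apply: H; exists h; split => // k Kk hk.
  by apply: nk; exists k.
pose F : set_system G := [set A | exists h, ideal_pos h /\
  [set k | K k /\ h (gsrc k) = 0] `<=` A].
have FF : ProperFilter F.
  apply: Build_ProperFilter_ex.
    by move=> A [h [ph hA]]; have [k kP] := ex h ph; exists k; exact: hA.
  split; first by exists 0; split => //; exact: ideal_pos0.
  - move=> A C [h [ph hA]] [l [pl lC]]; exists (h + l); split; first exact: ideal_posD.
    move=> k [Kk]; rewrite -[(h + l) _]/(h (gsrc k) + l (gsrc k)) => /eqP.
    have [_ _ h0] := ph; have [_ _ l0] := pl.
    by rewrite paddr_eq0 // => /andP[/eqP hk /eqP lk]; split; [exact: hA|exact: lC].
  - by move=> A C AsubC [h [ph hA]]; exists h; split => //; exact: subset_trans AsubC.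
have [|p [Kp Fp]] := cK F FF; first by exists 0; split; [exact: ideal_pos0|move=> k []].
have [h [ph hp]] := ideal_pos_all (units_src p).
have [ch _ _] := ph; have on := open_nonzero (units_open het) ch.
have nn : nbhs p (@gsrc G @^-1` [set g | units g /\ h g <> 0]).
  apply: open_nbhs_nbhs; split; first by apply: open_preimage on; exact: src_continuous.
  by split => //; exact: units_src.
have [k [[Kk hk] [_ nhk]]] :=
  Fp [set k | K k /\ h (gsrc k) = 0] _ (ex_intro _ h (conj ph (fun _ => id))) nn.
exact: nhk.
Qed.

Lemma ideal_Cc U f : open_bisection U -> Cc U f -> J (red_map B f).
Proof.
move=> bU cf; have oU := bis_open het bU.
have /(CcP _ oU)[ff [K [cK KU K0]]] := cf.
have [h [[ch Jh _] hK]] := ideal_pos_compact cK.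
have /(CcP _ (units_open het))[fh _] := ch.
(* Division by [h] along sources is legitimate on K, where [f] is supported; elsewhere [f] is 0, so
   the value of the inverse is harmless. *)
pose k g : R[i] := f g * (h (gsrc g))^-1.
have ck : Cc U k.
  apply/(CcP _ oU); split; last by exists K; split => // g /K0 E; rewrite /k E mul0r.
  move=> x Ux; have [hx|hx] := eqVneq (h (gsrc x)) 0; last first.
    apply: contCM; first exact: ff.
    apply: (contCV (f := fun g => h (gsrc g)) hx).
    by apply: contC_comp; [exact: src_continuous|exact/fh/units_src].
  (* A zero of the denominator lies off K, which is closed relative to U, so [f] and [k] vanish near
     it. *)
  have nKx : ~ K x by move=> /hK; rewrite hx.
  have [N [oN Nx NK]] := bis_compact_avoid het hT2 bU cK KU Ux nKx.
  apply: contC_near (@contC_cst R G 0 x).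
  have : nbhs x N by exact: open_nbhs_nbhs.
  apply: filterS => y Ny; rewrite /k K0 ?mul0r // => Ky.
  by have : (N `&` K) y by []; rewrite NK.
have -> : f = conv k h.
  apply/funext => g; rewrite conv_unit_r // /k.
  have [Kg|/K0 ->] := pselect (K g); last by rewrite !mul0r.
  by rewrite mulfVK //; apply/eqP; exact: hK.
rewrite (completion_mul bP); [exact: JMl|exact: convAlg_Cc bU ck|].
exact: convAlg_Cc (bis_units het) ch.
Qed.

Lemma ideal_full : J = [set: B].
Proof.
apply/seteqP; split => // b _.
have Jf f : convAlg f -> J (red_map B f).
  elim/(@convAlg_ind R G) => [|c h k ch ck Jh Jk|U h bU ch].
  - by rewrite (completion0 bP).
  - by rewrite (completion_linear bP) //; exact: JL.
  - exact: ideal_Cc bU ch.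
have [/closed_rnorm clJ _ _ _ _] := cJ; apply: clJ => e e0.
by have [f cf bf] := red_dense b e0; exists (red_map B f) => //; exact: Jf.
Qed.

End MinimalEffective.

Lemma minimal_effective_simple (R : realType) (G : topGroupoidType) (het : etale G)
  (hT2 : hausdorff_space (set_type (@units G))) (hlc : loc_compact G) (B : red_cstar R G) :
  minimal G -> effective G -> supp_interior B -> simple_cstar B.
Proof.
move=> hmin heff hsupp J cJ.
have [[a [Ja a0]]|na] := pselect (exists a, J a /\ a <> 0); last first.
  left; apply/seteqP; split => [a Ja|_ ->]; last by case: cJ.
  by apply: contrapT => a0; apply: na; exists a.
right; have [psi [u [uu cpsi psi1 psi0 Jpsi]]] :=
  ideal_unit_function het hT2 hlc heff hsupp cJ Ja a0.
apply: (ideal_full het hT2 cJ) => v uv.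
exact (ideal_pos_at het hT2 hlc hmin cJ uu cpsi psi1 psi0 Jpsi uv).
Qed.

Theorem theorem4p10 (R : realType) (G : topGroupoidType)
    (A : full_cstar R G) (B : red_cstar R G)
    (hsc : @second_countable G) (hlc : loc_compact G) (het : etale G)
    (hT2 : hausdorff_space (set_type (@units G))) :
  [/\ simple_cstar A ->
        [/\ full_eq_reduced A B, effective G & supp_interior B],
      simple_cstar B -> minimal G,
      minimal G -> effective G -> supp_interior B -> simple_cstar B &
      full_eq_reduced A B ->
        (simple_cstar A <-> [/\ minimal G, effective G & supp_interior B])].
Proof.
have p3 := minimal_effective_simple het hT2 hlc (B := B).
have p2 := simple_minimal het hT2 hlc (B := B).
have p1 : simple_cstar A -> [/\ full_eq_reduced A B, effective G & supp_interior B].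
  move=> sA; have iso := simple_full_norm het hT2 B sA; split.
  - have [q cq [q' [_ _ qK q'K]]] := norm_full_eq_reduced het hT2 iso.
    by exists q => //; exists q'.
  - exact (simple_effective het hT2 hlc B sA).
  (* The support argument concerns B, to which simplicity of A is carried by the isometry [iso]. *)
  - apply: (simple_supp_interior het hT2 hlc hsc).
    exact/(simple_full_red het hT2 iso).
split => // -[q cq bq].
have iso : forall f, convAlg f -> rnorm (full_map A f) = rnorm (red_map B f).
  apply: (kernel_full_norm het hT2 cq) => a qa; apply: (bij_inj bq).
  by have [qh _ _] := cq; rewrite qa (star_hom0 qh).
have AB := simple_full_red het hT2 iso.
split=> [sA|[hm he hs]]; last exact/AB/p3.
by have [_ he hs] := p1 sA; split => //; apply/p2/AB.
Qed.
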